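(* Let $D\subset\mathbb C$ be a non-simply connected domain whose boundary contains more than one point, let $a,z\in D$ and $N\in\mathbb N^*=\{1,2,3,\dots\}\cup\{\infty\}$. Let $\pi:\mathbb D\to D$ be a holomorphic covering map with $\pi(0)=z$, and let $\pi^{-1}(a)=\{\eta_1,\eta_2,\dots\}$ with $|\eta_1|\le|\eta_2|\le\cdots$ (an enumeration without repetition). Then $$l_D^N(a,z)=\prod_{j=1}^N|\eta_j|.$$ In particular, $l_D^N(a,z)<l_D^K(a,z)$ whenever $z\ne a$ and $K<N\le\infty$ (with $K\in\{1,2,3,\dots\}$). If $A\subset D$ is nonempty and at most countable, then $$l_D(A,z)=\prod_{a'\in A}\min\{|\eta|:\eta\in\mathbb D,\ \pi(\eta)=a'\}.$$ Moreover, if $z\neq a$ and $N$ is finite, then the $l_D^N(a,z)$-extremal discs are exactly the maps of the form $\pi\circ r$, where $r$ is a rotation; and if $l_D(A,z)>0$, then the $l_D(A,z)$-extremal discs are exactly the maps of the form $\pi\circ r$, where $r$ is a rotation.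
   Context: $\mathbb D$ is the open unit disc in $\mathbb C$ and $\mathcal O(\mathbb D,D)$ is the set of holomorphic maps $\mathbb D\to D$. For a nonempty at most countable $A\subset D$ and $z\in D$, the Lempert function with poles at $A$ is $$l_D(A,z)=\inf\Big\{\prod_{a\in A}|\lambda_a|\Big\},$$ the infimum being over all families $(\lambda_a)_{a\in A}$ in $\mathbb D$ for which there is $\phi\in\mathcal O(\mathbb D,D)$ with $\phi(0)=z$ and $\phi(\lambda_a)=a$ for all $a\in A$. For $N\in\mathbb N^*$ and $a,z\in D$, $$l_D^N(a,z)=\inf\Big\{\prod_{j=1}^N|\lambda_j|\Big\},$$ the infimum being over all families $(\lambda_j)_{j=1}^N$ of pairwise distinct points of $\mathbb D$ for which there is $\phi\in\mathcal O(\mathbb D,D)$ with $\phi(0)=z$ and $\phi(\lambda_j)=a$ for all $j$. Infinite products are limits of partial products (value $0$ allowed). A map $\phi\in\mathcal O(\mathbb D,D)$ is an $l_D(A,z)$-extremal disc if $\phi(0)=z$ and there exist a nonempty $B\subset A$ and points $\lambda_a\in\mathbb D$ ($a\in B$) with $\phi(\lambda_a)=a$ for all $a\in B$ and $l_D(A,z)=\prod_{a\in B}|\lambda_a|$. A map $\phi\in\mathcal O(\mathbb D,D)$ is an $l_D^N(a,z)$-extremal disc if $\phi(0)=z$ and there exist $1\le M\le N$ and points $\lambda_1,\dots,\lambda_M\in\mathbb D$ with $\phi(\lambda_j)=a$ for all $j$ and $l_D^N(a,z)=\prod_{j=1}^M|\lambda_j|$, where repetitions among the $\lambda_j$ are allowed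 but a point $\lambda$ may occur at most as many times as the multiplicity of $\phi$ at $\lambda$ (the order of vanishing of $\phi-a$ at $\lambda$). A rotation is a map $\mathbb D\to\mathbb D$, $\zeta\mapsto e^{it}\zeta$, with $t\in\mathbb R$. *)

(* Defs.v *)
(* Stdlib world: the real numbers R of Stdlib; complex numbers, complex
   derivatives, limits and infima from Coquelicot. *)
From Stdlib Require Import Reals List.
From Coquelicot Require Import Coquelicot.

Open Scope R_scope.

(** * Domains of the plane *)

Definition unit_disc (z : C) : Prop := Cmod z < 1.

Definition connected_set (D : C -> Prop) : Prop :=
  forall U V : C -> Prop,
    open U -> open V ->
    (forall x, D x -> U x \/ V x) ->
    (forall x, D x -> ~ (U x /\ V x)) ->
    (forall x, D x -> U x) \/ (forall x, D x -> V x).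

Definition plane_domain (D : C -> Prop) : Prop :=
  (exists x, D x) /\ open D /\ connected_set D.

Definition boundary (D : C -> Prop) (p : C) : Prop :=
  forall U : C -> Prop, locally p U ->
    (exists x, U x /\ D x) /\ (exists x, U x /\ ~ D x).

Definition unit_interval (t : R) : Prop := 0 <= t <= 1.

Definition unit_square (p : R * R) : Prop :=
  unit_interval (fst p) /\ unit_interval (snd p).

Definition loop_in (D : C -> Prop) (g : R -> C) : Prop :=
  continuous_on unit_interval g /\
  (forall t, unit_interval t -> D (g t)) /\
  g 0 = g 1.

(* The basepoint g 0 is kept fixed along the homotopy H s, 0 <= s <= 1. *)
Definition null_homotopic (D : C -> Prop) (g : R -> C) : Prop :=
  exists H : R * R -> C,
    continuous_on unit_square H /\
    (forall p, unit_square p -> D (H p)) /\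
    (forall t, unit_interval t -> H (0, t) = g t) /\
    (forall t, unit_interval t -> H (1, t) = g 0) /\
    (forall s, unit_interval s -> H (s, 0) = g 0 /\ H (s, 1) = g 0).

(* Only used for domains, which are path connected. *)
Definition simply_connected (D : C -> Prop) : Prop :=
  forall g, loop_in D g -> null_homotopic D g.

(** * Holomorphic maps and coverings *)

(* Maps defined on a subset U of C are represented by total functions whose
   values outside U are irrelevant; U is open wherever this is used, so that
   complex differentiability at the points of U only involves values on U. *)
Definition holomorphic_on (U : C -> Prop) (f : C -> C) : Prop :=
  forall x, U x -> ex_derive (K := C_AbsRing) (V := C_NormedModule) f x.

Definition holomorphic_map (U V : C -> Prop) (f : C -> C) : Prop :=
  holomorphic_on U f /\ forall x, U x -> V (f x).

(* The preimage of V is the union of the pairwise disjoint open sheets S i, and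
   s i is the continuous inverse of the restriction of p to S i. *)
Definition evenly_covered (X : C -> Prop) (p : C -> C) (V : C -> Prop) : Prop :=
  exists (I : Type) (S : I -> C -> Prop) (s : I -> C -> C),
    (forall i, open (S i)) /\
    (forall i j x, S i x -> S j x -> i = j) /\
    (forall x, (X x /\ V (p x)) <-> exists i, S i x) /\
    (forall i, continuous_on V (s i)) /\
    (forall i v, V v -> S i (s i v) /\ p (s i v) = v) /\
    (forall i x, S i x -> s i (p x) = x).

Definition holomorphic_covering (X Y : C -> Prop) (p : C -> C) : Prop :=
  holomorphic_map X Y p /\
  (forall y, Y y -> exists x, X x /\ p x = y) /\
  (forall y, Y y -> exists V : C -> Prop,
     open V /\ V y /\ (forall v, V v -> Y v) /\ evenly_covered X p V).

(** * Finite and infinite products *)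

(* The nonnegative integers together with infinity. *)
Inductive enat : Set := Fin (n : nat) | Infty.

Definition lt_enat (n : nat) (N : enat) : Prop :=
  match N with Fin m => (n < m)%nat | Infty => True end.

Definition Rprod (l : list R) : R := fold_right Rmult 1 l.

(* u 0 * ... * u (n - 1) *)
Definition partial_prod (u : nat -> R) (n : nat) : R := Rprod (map u (seq 0 n)).

(* All factors below lie in [0, 1], so that the limit exists and is finite. *)
Definition eprod (u : nat -> R) (N : enat) : R :=
  match N with
  | Fin n => partial_prod u n
  | Infty => real (Lim_seq (partial_prod u))
  end.

(* (e j), j < N, lists every element of A exactly once. *)
Definition enumerates (N : enat) (e : nat -> C) (A : C -> Prop) : Prop :=
  (forall i j, lt_enat i N -> lt_enat j N -> e i = e j -> i = j) /\
  (forall x, A x <-> exists j, lt_enat j N /\ e j = x).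

Definition at_most_countable (A : C -> Prop) : Prop :=
  exists N e, enumerates N e A.

(* p is the product of f over the at most countable set A, for any order of the
   factors. *)
Definition is_prod_over (A : C -> Prop) (f : C -> R) (p : R) : Prop :=
  at_most_countable A /\
  forall N e, enumerates N e A -> p = eprod (fun j => f (e j)) N.

Definition is_min (E : R -> Prop) (m : R) : Prop :=
  E m /\ forall x, E x -> m <= x.

(* The set of all |x| with x in the disc and p x = a. *)
Definition fibre_moduli (p : C -> C) (a : C) (r : R) : Prop :=
  exists x, unit_disc x /\ p x = a /\ r = Cmod x.

(** * Lempert functions *)

(* Glb_Rbar is valued in the extended reals; the sets of products considered
   here are bounded below by 0. If they are empty the value is 0 by convention,
   which does not occur when D has a holomorphic covering by the disc taking
   the value z at 0 and having infinite fibres. *)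
Definition lempert (D A : C -> Prop) (z : C) : R :=
  real (Glb_Rbar (fun p : R =>
    exists (lam : C -> C) (phi : C -> C),
      holomorphic_map unit_disc D phi /\ phi 0%C = z /\
      (forall a, A a -> unit_disc (lam a) /\ phi (lam a) = a) /\
      is_prod_over A (fun a => Cmod (lam a)) p)).

Definition lempertN (D : C -> Prop) (N : enat) (a z : C) : R :=
  real (Glb_Rbar (fun p : R =>
    exists (lam : nat -> C) (phi : C -> C),
      holomorphic_map unit_disc D phi /\ phi 0%C = z /\
      (forall j, lt_enat j N -> unit_disc (lam j) /\ phi (lam j) = a) /\
      (forall i j, lt_enat i N -> lt_enat j N -> lam i = lam j -> i = j) /\
      p = eprod (fun j => Cmod (lam j)) N)).

Definition extremal_disc (D A : C -> Prop) (z : C) (phi : C -> C) : Prop :=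
  holomorphic_map unit_disc D phi /\ phi 0%C = z /\
  exists (B : C -> Prop) (lam : C -> C),
    (exists b, B b) /\ (forall b, B b -> A b) /\
    (forall b, B b -> unit_disc (lam b) /\ phi (lam b) = b) /\
    is_prod_over B (fun b => Cmod (lam b)) (lempert D A z).

(* f, holomorphic on the disc, vanishes at x to order at least k; this holds
   for every k when f vanishes identically. *)
Definition vanishes_to_order (f : C -> C) (x : C) (k : nat) : Prop :=
  exists g : C -> C,
    holomorphic_on unit_disc g /\
    forall w, unit_disc w -> f w = ((w - x) ^ k * g w)%C.

(* The list l consists of lambda_1, ..., lambda_M, with possible repetitions. *)
Definition extremal_discN (D : C -> Prop) (N : nat) (a z : C) (phi : C -> C)
    : Prop :=
  holomorphic_map unit_disc D phi /\ phi 0%C = z /\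
  exists l : list C,
    (1 <= length l <= N)%nat /\
    (forall x, In x l -> unit_disc x /\ phi x = a) /\
    (forall x, In x l ->
       vanishes_to_order (fun w => (phi w - a)%C) x (count_occ Ceq_dec l x)) /\
    lempertN D (Fin N) a z = Rprod (map Cmod l).

Definition rotation (r : C -> C) : Prop :=
  exists t : R, forall x : C, unit_disc x -> r x = (((cos t, sin t) : C) * x)%C.

(* phi is the composition of p with a rotation of the disc. *)
Definition rotated (p phi : C -> C) : Prop :=
  exists r, rotation r /\ forall x, unit_disc x -> phi x = p (r x).

(* Main.v *)
Require Import Defs.
From Stdlib Require Import Reals List Lra Lia Classical ClassicalEpsilon FunctionalExtensionality.
From Coquelicot Require Import Coquelicot.
Open Scope R_scope.

(** Every disc [phi] in [D] with [phi 0 = z] factors as [pi] composed with a holomorphic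
    [psi] from the unit disc to itself with [psi 0 = 0] ([lift_exists]).  If [phi] takes the
    value [a] at [lam], then [psi lam] is a point [eta] of the fibre of [a], and the Schwarz
    lemma gives [|eta| <= |lam|].  When several [lam] have the same image [eta], or
    occur with multiplicity, they are zeros of a Moebius transform of [psi] that is
    bounded by 1 and has modulus [|eta|] at 0, so [|eta|] is still at most the
    product of their moduli ([fibre_point_le]).  Hence the products in the
    definitions of the Lempert functions are at least the products of the smallest
    moduli in the fibres, and [pi] itself attains this bound ([lempertN_formula],
    [lempert_formula]).  An extremal disc whose value is positive must have
    [|psi lam| = |lam|] for some nonzero [lam], and then [psi] is a
    rotation by the equality case of the Schwarz lemma ([extremal_discN_iff],
    [extremal_disc_iff]).

    The strict inequality needs infinite fibres ([fibre_infinite]).  As [D] is not simply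
    connected, [pi] is not injective, and lifting [pi] through itself gives a
    holomorphic self-map [tau] of the disc, without fixed points, with
    [pi o tau = pi].  If a fibre were finite, [tau] would have a cycle.  By the
    Schwarz-Pick lemma [tau] does not increase the total hyperbolic deviation from the
    points of the cycle, so it would fix the unique minimiser of that deviation, the
    centre of mass in the hyperboloid model.

    The complex analysis is built from differentiability alone.  Goursat's bisection
    argument in logarithmic polar coordinates yields the mean value property
    ([circle_mean]), which yields the maximum principle ([max_modulus]).  The
    remaining facts follow from the maximum principle applied to difference quotients:
    removable singularities, division by [w - q], finite order of zeros, and the
    holomorphy of local inverses, which makes continuous lifts holomorphic.  The
    same bisection of squares ([square_bisection]) replaces compactness in
    the existence of maxima, in the lifting of maps and in the local finiteness of
    fibres. *)

(** * Moduli, continuity and complex differentiability in epsilon-delta form *)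

Lemma Cmod_sub_sym (x y : C) : Cmod (x - y) = Cmod (y - x).
Proof. rewrite <- Cmod_opp. f_equal. ring. Qed.

Lemma Cmod_sub_triangle (x y w : C) : Cmod (x - w) <= Cmod (x - y) + Cmod (y - w).
Proof. replace (x - w)%C with ((x - y) + (y - w))%C by ring. apply Cmod_triangle. Qed.

Lemma Cmod_le_add (x y : C) : Cmod x <= Cmod y + Cmod (x - y).
Proof. replace x with (y + (x - y))%C at 1 by ring. apply Cmod_triangle. Qed.

Lemma Cmod_sub_0 (x : C) : Cmod (x - 0) = Cmod x.
Proof. f_equal. ring. Qed.

Lemma Cmod_sub_diag (x : C) : Cmod (x - x) = 0.
Proof. replace (x - x)%C with (RtoC 0) by ring. apply Cmod_0. Qed.

Lemma Cmod_sub_pos (x y : C) : x <> y -> 0 < Cmod (x - y).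
Proof. intros H. apply Cmod_gt_0. now apply Cminus_eq_contra. Qed.

Lemma Cmod_sqr (x : C) : Cmod x * Cmod x = fst x * fst x + snd x * snd x.
Proof. generalize (Cmod2_alt x). unfold Re, Im. simpl. lra. Qed.

Lemma Cmod_RtoC_pos (x : R) : 0 <= x -> Cmod (RtoC x) = x.
Proof. intros H. rewrite Cmod_R. now apply Rabs_pos_eq. Qed.

Lemma Cmod_le_parts (x : C) : Cmod x <= Rabs (fst x) + Rabs (snd x).
Proof.
  replace x with (RtoC (fst x) + Ci * RtoC (snd x))%C at 1.
  - eapply Rle_trans. apply Cmod_triangle.
    rewrite Cmod_mult, !Cmod_R.
    replace (Cmod Ci) with 1. lra.
    unfold Cmod, Ci. simpl. replace (0 * (0 * 1) + 1 * (1 * 1)) with 1 by ring. now rewrite sqrt_1.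
  - destruct x as [u v]. unfold Cplus, Cmult, RtoC, Ci. simpl. f_equal; ring.
Qed.

Lemma Re_le_Cmod (x : C) : Rabs (fst x) <= Cmod x.
Proof. apply (re_le_Cmod x). Qed.

Lemma Im_le_Cmod (x : C) : Rabs (snd x) <= Cmod x.
Proof.
  apply Rsqr_incr_0_var; [|apply Cmod_ge_0].
  rewrite <- Rsqr_abs. unfold Rsqr. rewrite Cmod_sqr. nra.
Qed.

Lemma ball_of_Cmod (x y : C) (e : posreal) : Cmod (y - x) < e -> ball x e y.
Proof. intros H. now apply C_NormedModule_mixin_compat1. Qed.

Lemma Cmod_of_ball (x y : C) (e : R) : ball x e y -> Cmod (y - x) < 2 * e.
Proof.
  intros [H1 H2]. eapply Rle_lt_trans. apply Cmod_le_parts.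
  destruct x as [u v], y as [u' v']. simpl in *.
  change (Rabs (u' - u) < e) in H1. change (Rabs (v' - v) < e) in H2.
  change (Rabs (u' - u) + Rabs (v' - v) < 2 * e). lra.
Qed.

Lemma locally_C (P : C -> Prop) (x : C) :
  locally x P <-> exists d, 0 < d /\ forall y, Cmod (y - x) < d -> P y.
Proof.
  split.
  - intros [d H]. exists d. split. apply cond_pos.
    intros y Hy. apply H. now apply ball_of_Cmod.
  - intros [d [Hd H]]. exists (mkposreal (d / 2) ltac:(lra)).
    intros y Hy. apply H. apply Cmod_of_ball in Hy. simpl in Hy. lra.
Qed.

Lemma open_C (U : C -> Prop) (x : C) :
  open U -> U x -> exists d, 0 < d /\ forall y, Cmod (y - x) < d -> U y.
Proof. intros HU Hx. apply locally_C. now apply HU. Qed.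

Definition cont_in (E : C -> Prop) (f : C -> C) (x : C) : Prop :=
  forall e, 0 < e -> exists d, 0 < d /\
    forall y, E y -> Cmod (y - x) < d -> Cmod (f y - f x) < e.

Definition cont (f : C -> C) (x : C) : Prop :=
  forall e, 0 < e -> exists d, 0 < d /\
    forall y, Cmod (y - x) < d -> Cmod (f y - f x) < e.

Lemma continuous_on_C (E : C -> Prop) (f : C -> C) :
  continuous_on E f <-> forall x, E x -> cont_in E f x.
Proof.
  split; intros H x Hx.
  - intros e He. specialize (H x Hx).
    assert (L : locally (f x) (fun u => Cmod (u - f x) < e))
      by (apply locally_C; exists e; auto).
    specialize (H _ L). apply locally_C in H. destruct H as [d [Hd H]].
    exists d. split; auto.
  - intros P HP. apply locally_C in HP. destruct HP as [e [He HP]].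
    destruct (H x Hx e He) as [d [Hd Hd']].
    apply locally_C. exists d. split; auto.
Qed.

Lemma cont_in_of_cont (E : C -> Prop) f x : cont f x -> cont_in E f x.
Proof. intros H e He. destruct (H e He) as [d [Hd Hd']]. exists d. split; auto. Qed.

Lemma cont_of_cont_in (E : C -> Prop) f x : open E -> E x -> cont_in E f x -> cont f x.
Proof.
  intros HE Hx H e He. destruct (H e He) as [d [Hd Hd']].
  destruct (open_C _ _ HE Hx) as [d2 [Hd2 Hd2']].
  exists (Rmin d d2). split. now apply Rmin_glb_lt.
  intros y Hy. apply Hd'. apply Hd2'. eapply Rlt_le_trans; [apply Hy|apply Rmin_r].
  eapply Rlt_le_trans; [apply Hy|apply Rmin_l].
Qed.

Lemma cont_ext_loc (f g : C -> C) x d :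
  0 < d -> (forall y, Cmod (y - x) < d -> f y = g y) -> cont f x -> cont g x.
Proof.
  intros Hd E H e He. destruct (H e He) as [d' [Hd' H']].
  exists (Rmin d d'). split. now apply Rmin_glb_lt.
  intros y Hy. assert (Cmod (y - x) < d /\ Cmod (y - x) < d').
  { split; (eapply Rlt_le_trans; [apply Hy|]). apply Rmin_l. apply Rmin_r. }
  rewrite <- !E; try tauto. apply H'; tauto. rewrite Cmod_sub_diag. tauto.
Qed.

Lemma cont_const c x : cont (fun _ => c) x.
Proof. intros e He. exists 1. split; [lra|]. intros. now rewrite Cmod_sub_diag. Qed.

Lemma cont_id x : cont (fun y => y) x.
Proof. intros e He. exists e. split; auto. Qed.

Lemma cont_plus f g x : cont f x -> cont g x -> cont (fun y => f y + g y)%C x.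
Proof.
  intros Hf Hg e He. destruct (Hf (e/2)) as [d [Hd Hf']]. lra.
  destruct (Hg (e/2)) as [d2 [Hd2 Hg']]. lra.
  exists (Rmin d d2). split. now apply Rmin_glb_lt. intros y Hy.
  assert (H1 := Hf' y (Rlt_le_trans _ _ _ Hy (Rmin_l _ _))).
  assert (H2 := Hg' y (Rlt_le_trans _ _ _ Hy (Rmin_r _ _))).
  replace (f y + g y - (f x + g x))%C with ((f y - f x) + (g y - g x))%C by ring.
  eapply Rle_lt_trans. apply Cmod_triangle. lra.
Qed.

Lemma cont_comp f g x : cont g x -> cont f (g x) -> cont (fun y => f (g y)) x.
Proof.
  intros Hg Hf e He. destruct (Hf e He) as [d [Hd Hf']].
  destruct (Hg d Hd) as [d2 [Hd2 Hg']]. exists d2. split; auto.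
Qed.

Lemma cont_bounded f x : cont f x ->
  exists d, 0 < d /\ forall y, Cmod (y - x) < d -> Cmod (f y) < Cmod (f x) + 1.
Proof.
  intros H. destruct (H 1) as [d [Hd H']]. lra. exists d. split; auto.
  intros y Hy. specialize (H' y Hy). assert (L := Cmod_le_add (f y) (f x)). lra.
Qed.

Lemma cont_mult f g x : cont f x -> cont g x -> cont (fun y => f y * g y)%C x.
Proof.
  intros Hf Hg e He. set (M := Cmod (f x) + Cmod (g x) + 2).
  assert (A := Cmod_ge_0 (f x)). assert (B := Cmod_ge_0 (g x)).
  assert (HM : 0 < M) by (unfold M; lra).
  assert (He' : 0 < e / (2 * M)) by (apply Rdiv_lt_0_compat; lra).
  destruct (Hf _ He') as [d1 [Hd1 Hf']]. destruct (Hg _ He') as [d2 [Hd2 Hg']].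
  destruct (cont_bounded _ _ Hf) as [d3 [Hd3 Hb]].
  exists (Rmin (Rmin d1 d2) d3). split. now repeat apply Rmin_glb_lt.
  intros y Hy.
  assert (Hy3 := Rlt_le_trans _ _ _ Hy (Rmin_r _ _)).
  assert (Hy0 := Rlt_le_trans _ _ _ Hy (Rmin_l _ _)).
  assert (H1 := Hf' y (Rlt_le_trans _ _ _ Hy0 (Rmin_l _ _))).
  assert (H2 := Hg' y (Rlt_le_trans _ _ _ Hy0 (Rmin_r _ _))).
  specialize (Hb y Hy3).
  replace (f y * g y - f x * g x)%C with (f y * (g y - g x) + (f y - f x) * g x)%C by ring.
  eapply Rle_lt_trans. apply Cmod_triangle. rewrite !Cmod_mult.
  assert (E : e = e / (2 * M) * M + e / (2 * M) * M) by (field; lra).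
  assert (C1 := Cmod_ge_0 (f y)). assert (C2 := Cmod_ge_0 (g y - g x)).
  assert (C3 := Cmod_ge_0 (f y - f x)).
  set (k := e / (2 * M)) in *.
  assert (Cmod (f y) * Cmod (g y - g x) < k * M).
  { rewrite Rmult_comm. apply Rmult_le_0_lt_compat; auto. unfold M; lra. }
  assert (Cmod (f y - f x) * Cmod (g x) < k * M).
  { apply Rmult_le_0_lt_compat; auto. unfold M; lra. }
  lra.
Qed.

Lemma cont_opp f x : cont f x -> cont (fun y => - f y)%C x.
Proof.
  intros H e He. destruct (H e He) as [d [Hd H']]. exists d. split; auto.
  intros y Hy. replace (- f y - - f x)%C with (-(f y - f x))%C by ring.
  rewrite Cmod_opp. auto.
Qed.

Lemma cont_minus f g x : cont f x -> cont g x -> cont (fun y => f y - g y)%C x.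
Proof. intros. apply cont_plus; auto. now apply cont_opp. Qed.

Lemma cont_away f x : cont f x -> f x <> 0%C ->
  exists d, 0 < d /\ forall y, Cmod (y - x) < d -> Cmod (f x) / 2 < Cmod (f y).
Proof.
  intros H H0. assert (P : 0 < Cmod (f x)) by now apply Cmod_gt_0.
  destruct (H (Cmod (f x) / 2)) as [d [Hd H']]. lra. exists d. split; auto.
  intros y Hy. specialize (H' y Hy). rewrite Cmod_sub_sym in H'.
  assert (L := Cmod_le_add (f x) (f y)). lra.
Qed.

Lemma Cmod_pos_neq (x : C) : 0 < Cmod x -> x <> 0%C.
Proof. intros H E. rewrite E, Cmod_0 in H. lra. Qed.

Lemma cont_inv f x : cont f x -> f x <> 0%C -> cont (fun y => / f y)%C x.
Proof.
  intros H H0 e He. assert (P : 0 < Cmod (f x)) by now apply Cmod_gt_0.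
  destruct (cont_away _ _ H H0) as [d1 [Hd1 H1]].
  destruct (H (e * (Cmod (f x) * Cmod (f x) / 2))) as [d2 [Hd2 H2]].
  { apply Rmult_lt_0_compat; auto. nra. }
  exists (Rmin d1 d2). split. now apply Rmin_glb_lt. intros y Hy.
  specialize (H1 y (Rlt_le_trans _ _ _ Hy (Rmin_l _ _))).
  specialize (H2 y (Rlt_le_trans _ _ _ Hy (Rmin_r _ _))).
  assert (N : f y <> 0%C) by (apply Cmod_pos_neq; lra).
  replace (/ f y - / f x)%C with ((- (f y - f x)) / (f y * f x))%C by (field; auto).
  rewrite Cmod_div, Cmod_opp, Cmod_mult by now apply Cmult_neq_0.
  apply Rmult_lt_reg_r with (Cmod (f y) * Cmod (f x)). nra.
  unfold Rdiv. rewrite Rmult_assoc, Rinv_l, Rmult_1_r by nra.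
  eapply Rlt_le_trans. apply H2. apply Rmult_le_compat_l. lra. nra.
Qed.

Lemma cont_div f g x : cont f x -> cont g x -> g x <> 0%C -> cont (fun y => f y / g y)%C x.
Proof. intros. apply cont_mult; auto. now apply cont_inv. Qed.

Lemma cont_unique f g x d : 0 < d -> cont f x -> cont g x ->
  (forall y, Cmod (y - x) < d -> y <> x -> f y = g y) -> f x = g x.
Proof.
  intros Hd Hf Hg E. apply NNPP. intros N.
  assert (P := Cmod_sub_pos _ _ N).
  destruct (Hf (Cmod (f x - g x) / 2)) as [d1 [Hd1 H1]]. lra.
  destruct (Hg (Cmod (f x - g x) / 2)) as [d2 [Hd2 H2]]. lra.
  set (r := Rmin d (Rmin d1 d2)).
  assert (Hr : 0 < r) by (unfold r; now repeat apply Rmin_glb_lt).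
  set (y := (x + RtoC (r / 2))%C).
  assert (Hy : Cmod (y - x) = r / 2).
  { unfold y. replace (x + RtoC (r/2) - x)%C with (RtoC (r/2)) by ring. apply Cmod_RtoC_pos. lra. }
  assert (Hyx : y <> x) by (intros e; rewrite e, Cmod_sub_diag in Hy; lra).
  assert (r <= d) by apply Rmin_l.
  assert (r <= d1) by (eapply Rle_trans; [apply Rmin_r|apply Rmin_l]).
  assert (r <= d2) by (eapply Rle_trans; [apply Rmin_r|apply Rmin_r]).
  specialize (H1 y ltac:(lra)). specialize (H2 y ltac:(lra)).
  rewrite (E y ltac:(lra) Hyx) in H1. rewrite Cmod_sub_sym in H1.
  assert (L := Cmod_sub_triangle (f x) (g y) (g x)). lra.
Qed.

(** Caratheodory's form of the complex derivative: the difference quotient extends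
    continuously to [x] with the value [l].  It reduces the rules of
    differentiation to those of continuity. *)
Definition diff_at (f : C -> C) (x l : C) : Prop :=
  exists q d, 0 < d /\ q x = l /\ cont q x /\
    forall y, Cmod (y - x) < d -> f y = (f x + q y * (y - x))%C.

Definition hol_at (f : C -> C) (x : C) : Prop := exists l, diff_at f x l.

Definition quotient (f : C -> C) (x l y : C) : C :=
  if Ceq_dec y x then l else ((f y - f x) / (y - x))%C.

Lemma quotient_at f x l : quotient f x l x = l.
Proof. unfold quotient. destruct Ceq_dec; congruence. Qed.

Lemma quotient_off f x l y : y <> x -> quotient f x l y = ((f y - f x) / (y - x))%C.
Proof. unfold quotient. destruct Ceq_dec; congruence. Qed.

Lemma quotient_mult f x l y : f y = (f x + quotient f x l y * (y - x))%C.
Proof.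
  destruct (Ceq_dec y x) as [->|N]. ring.
  rewrite quotient_off by auto. field. now apply Cminus_eq_contra.
Qed.

Lemma diff_at_quotient f x l : diff_at f x l <-> cont (quotient f x l) x.
Proof.
  split.
  - intros [q [d [Hd [Hq [Hc E]]]]]. eapply cont_ext_loc; [apply Hd| |apply Hc].
    intros y Hy. destruct (Ceq_dec y x) as [->|N]. now rewrite quotient_at.
    rewrite quotient_off by auto. rewrite (E y Hy). field. now apply Cminus_eq_contra.
  - intros H. exists (quotient f x l), 1. split; [lra|]. split. apply quotient_at.
    split; auto. intros. apply quotient_mult.
Qed.

Lemma diff_at_eps f x l : diff_at f x l <->
  forall e, 0 < e -> exists d, 0 < d /\
    forall y, Cmod (y - x) < d -> Cmod (f y - f x - l * (y - x)) <= e * Cmod (y - x).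
Proof.
  rewrite diff_at_quotient. split; intros H e He.
  - destruct (H e He) as [d [Hd H']]. exists d. split; auto. intros y Hy.
    specialize (H' y Hy). rewrite quotient_at in H'.
    replace (f y - f x - l * (y - x))%C with ((quotient f x l y - l) * (y - x))%C.
    rewrite Cmod_mult. apply Rmult_le_compat_r. apply Cmod_ge_0. lra.
    rewrite (quotient_mult f x l y) at 1. ring.
  - destruct (H (e/2)) as [d [Hd H']]. lra. exists d. split; auto. intros y Hy.
    rewrite quotient_at.
    destruct (Ceq_dec y x) as [->|N]. rewrite quotient_at, Cmod_sub_diag; lra.
    specialize (H' y Hy). rewrite quotient_off by auto.
    assert (P := Cmod_sub_pos _ _ N).
    apply Rle_lt_trans with (e/2); [|lra].
    apply Rmult_le_reg_r with (Cmod (y - x)); auto.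
    rewrite <- Cmod_mult.
    replace (((f y - f x) / (y - x) - l) * (y - x))%C with (f y - f x - l * (y - x))%C; auto.
    field. now apply Cminus_eq_contra.
Qed.

Lemma is_derive_diff_at f x l :
  is_derive (K := C_AbsRing) (V := C_NormedModule) f x l <-> diff_at f x l.
Proof.
  rewrite diff_at_eps. split.
  - intros [_ H] e He. specialize (H x (fun P HP => HP) (mkposreal e He)).
    destruct H as [d H]. exists d. split. apply cond_pos. intros y Hy.
    specialize (H y Hy). simpl in H.
    change (Cmod (f y - f x - (y - x) * l) <= e * Cmod (y - x)) in H.
    now rewrite (Cmult_comm l).
  - intros H. split. apply is_linear_scal_l.
    intros x' Hx'. apply (@is_filter_lim_locally_unique C_AbsRing (AbsRing_NormedModule C_AbsRing)) in Hx'. subst x'.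
    intros e. destruct (H e (cond_pos e)) as [d [Hd H']].
    exists (mkposreal d Hd). intros y Hy.
    specialize (H' y Hy). rewrite (Cmult_comm l) in H'. exact H'.
Qed.
Lemma holomorphic_on_iff U f : holomorphic_on U f <-> forall x, U x -> hol_at f x.
Proof.
  split; intros H x Hx; destruct (H x Hx) as [l Hl]; exists l; now apply is_derive_diff_at.
Qed.

Lemma diff_at_cont f x l : diff_at f x l -> cont f x.
Proof.
  intros [q [d [Hd [Hq [Hc E]]]]].
  apply (cont_ext_loc (fun y => f x + q y * (y - x))%C) with d; auto.
  - intros y Hy. now rewrite (E y Hy).
  - apply cont_plus. apply cont_const. apply cont_mult; auto.
    apply cont_minus. apply cont_id. apply cont_const.
Qed.

Lemma hol_at_cont f x : hol_at f x -> cont f x.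
Proof. intros [l H]. eapply diff_at_cont; eauto. Qed.

Lemma diff_at_ext_loc f g x l d : 0 < d -> (forall y, Cmod (y - x) < d -> f y = g y) ->
  diff_at f x l -> diff_at g x l.
Proof.
  intros Hd E [q [d' [Hd' [Hq [Hc H]]]]].
  exists q, (Rmin d d'). split. now apply Rmin_glb_lt. split; auto. split; auto.
  intros y Hy. rewrite <- !E. apply H. eapply Rlt_le_trans; [apply Hy|apply Rmin_r].
  rewrite Cmod_sub_diag; auto. eapply Rlt_le_trans; [apply Hy|apply Rmin_l].
Qed.

Lemma hol_at_ext_loc f g x d : 0 < d -> (forall y, Cmod (y - x) < d -> f y = g y) ->
  hol_at f x -> hol_at g x.
Proof. intros Hd E [l H]. exists l. eapply diff_at_ext_loc; eauto. Qed.

Lemma diff_at_const c x : diff_at (fun _ => c) x 0.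
Proof.
  exists (fun _ => RtoC 0), 1. split; [lra|]. split; auto. split. apply cont_const. intros. ring.
Qed.

Lemma diff_at_id x : diff_at (fun y => y) x 1.
Proof.
  exists (fun _ => RtoC 1), 1. split; [lra|]. split; auto. split. apply cont_const. intros. ring.
Qed.

Lemma diff_at_plus f g x l m : diff_at f x l -> diff_at g x m ->
  diff_at (fun y => f y + g y)%C x (l + m)%C.
Proof.
  intros [q [d [Hd [Hq [Hc E]]]]] [q' [d' [Hd' [Hq' [Hc' E']]]]].
  exists (fun y => q y + q' y)%C, (Rmin d d'). split. now apply Rmin_glb_lt.
  split. now rewrite Hq, Hq'. split. now apply cont_plus. intros y Hy.
  rewrite (E y), (E' y). ring. eapply Rlt_le_trans; [apply Hy|apply Rmin_r].
  eapply Rlt_le_trans; [apply Hy|apply Rmin_l].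
Qed.

Lemma diff_at_mult f g x l m : diff_at f x l -> diff_at g x m ->
  diff_at (fun y => f y * g y)%C x (l * g x + f x * m)%C.
Proof.
  intros Hf [q' [d' [Hd' [Hq' [Hc' E']]]]].
  destruct Hf as [q [d [Hd [Hq [Hc E]]]]].
  exists (fun y => q y * g y + f x * q' y)%C, (Rmin d d'). split. now apply Rmin_glb_lt.
  split. now rewrite Hq, Hq'. split.
  - apply cont_plus; apply cont_mult; auto. 2: apply cont_const.
    apply diff_at_cont with m. exists q', d'. auto.
  - intros y Hy. rewrite (E y). 2: eapply Rlt_le_trans; [apply Hy|apply Rmin_l].
    rewrite (E' y). 2: eapply Rlt_le_trans; [apply Hy|apply Rmin_r]. ring.
Qed.

Lemma diff_at_inv f x l : diff_at f x l -> f x <> 0%C ->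
  diff_at (fun y => / f y)%C x (- l / (f x * f x))%C.
Proof.
  intros Hf N. assert (C := diff_at_cont _ _ _ Hf).
  destruct (cont_away _ _ C N) as [d2 [Hd2 A]].
  destruct Hf as [q [d [Hd [Hq [Hc E]]]]].
  exists (fun y => - q y / (f y * f x))%C, (Rmin d d2). split. now apply Rmin_glb_lt.
  split. now rewrite Hq. split.
  - apply cont_div. now apply cont_opp. apply cont_mult; auto. apply cont_const.
    now apply Cmult_neq_0.
  - intros y Hy.
    assert (M : f y <> 0%C).
    { apply Cmod_pos_neq. assert (B := Cmod_ge_0 (f x)).
      assert (D := A y (Rlt_le_trans _ _ _ Hy (Rmin_r _ _))). lra. }
    assert (E1 := E y (Rlt_le_trans _ _ _ Hy (Rmin_l _ _))).
    replace (/ f y)%C with (/ f x + (f x - f y) / (f y * f x))%C by (field; auto).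
    rewrite E1 at 1. field. auto.
Qed.

Lemma diff_at_comp f g x l m : diff_at g x m -> diff_at f (g x) l ->
  diff_at (fun y => f (g y)) x (l * m)%C.
Proof.
  intros Hg [q [d [Hd [Hq [Hc E]]]]].
  assert (C := diff_at_cont _ _ _ Hg).
  destruct Hg as [q' [d' [Hd' [Hq' [Hc' E']]]]].
  destruct (C d Hd) as [d2 [Hd2 C2]].
  exists (fun y => q (g y) * q' y)%C, (Rmin d' d2). split. now apply Rmin_glb_lt.
  split. now rewrite Hq, Hq'. split.
  - apply cont_mult; auto. apply (cont_comp q g); auto.
  - intros y Hy. rewrite (E (g y)).
    2: apply C2; eapply Rlt_le_trans; [apply Hy|apply Rmin_r].
    rewrite (E' y) at 2. 2: eapply Rlt_le_trans; [apply Hy|apply Rmin_l]. ring.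
Qed.

Lemma hol_const c x : hol_at (fun _ => c) x.
Proof. eexists. apply diff_at_const. Qed.
Lemma hol_id x : hol_at (fun y => y) x.
Proof. eexists. apply diff_at_id. Qed.
Lemma hol_plus f g x : hol_at f x -> hol_at g x -> hol_at (fun y => f y + g y)%C x.
Proof. intros [l H] [m K]. eexists. apply diff_at_plus; eauto. Qed.
Lemma hol_mult f g x : hol_at f x -> hol_at g x -> hol_at (fun y => f y * g y)%C x.
Proof. intros [l H] [m K]. eexists. apply diff_at_mult; eauto. Qed.
Lemma hol_opp f x : hol_at f x -> hol_at (fun y => - f y)%C x.
Proof.
  intros H. apply hol_at_ext_loc with (fun y => (-(1)) * f y)%C 1; [lra| |].
  intros; ring. apply hol_mult; auto. apply hol_const.
Qed.
Lemma hol_minus f g x : hol_at f x -> hol_at g x -> hol_at (fun y => f y - g y)%C x.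
Proof. intros. apply hol_plus; auto. now apply hol_opp. Qed.
Lemma hol_div f g x : hol_at f x -> hol_at g x -> g x <> 0%C -> hol_at (fun y => f y / g y)%C x.
Proof.
  intros H [m K] N. apply hol_mult; auto. eexists. apply diff_at_inv; eauto.
Qed.
Lemma hol_comp f g x : hol_at g x -> hol_at f (g x) -> hol_at (fun y => f (g y)) x.
Proof. intros [l H] [m K]. eexists. apply (diff_at_comp f g); eauto. Qed.
Lemma hol_pow f n x : hol_at f x -> hol_at (fun y => f y ^ n)%C x.
Proof.
  intros H. induction n as [|n IH]. apply (hol_const (RtoC 1)).
  apply hol_at_ext_loc with (fun y => f y * f y ^ n)%C 1; [lra| |].
  reflexivity. now apply hol_mult.
Qed.

Lemma diff_at_unique f x l m : diff_at f x l -> diff_at f x m -> l = m.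
Proof.
  rewrite !diff_at_quotient. intros H K.
  rewrite <- (quotient_at f x l), <- (quotient_at f x m).
  apply cont_unique with 1; auto. lra. intros y _ N. now rewrite !quotient_off.
Qed.

(** * Bisection of squares *)

Lemma nested_point (A H : nat -> R) :
  (forall m n, A n <= A m + H m) -> exists u, forall n, A n <= u <= A n + H n.
Proof.
  intros Box.
  destruct (completeness (fun x => exists n, x = A n)) as [u [Hu1 Hu2]].
  - exists (A O + H O). intros x [n ->]. apply Box.
  - exists (A O), O. reflexivity.
  - exists u. intros n. split. apply Hu1. now exists n.
    apply Hu2. intros x [m ->]. apply Box.
Qed.

(** Bisection serves as the compactness argument throughout: a property of
    rectangles that survives gluing along an edge and holds for all small squares
    near each point holds for the whole square. *)
Lemma square_bisection (P : R -> R -> R -> R -> Prop) (x0 y0 h0 : R) :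
  0 < h0 ->
  (forall a m b c d, a <= m <= b -> c <= d -> P a m c d -> P m b c d -> P a b c d) ->
  (forall a b c m d, a <= b -> c <= m <= d -> P a b c m -> P a b m d -> P a b c d) ->
  (forall u v, x0 <= u <= x0 + h0 -> y0 <= v <= y0 + h0 ->
     exists e, 0 < e /\ forall a c h, 0 < h < e ->
       x0 <= a -> a + h <= x0 + h0 -> y0 <= c -> c + h <= y0 + h0 ->
       a <= u <= a + h -> c <= v <= c + h -> P a (a + h) c (c + h)) ->
  P x0 (x0 + h0) y0 (y0 + h0).
Proof.
  intros Hh HX HY HL. apply NNPP. intros HN.
  assert (step : forall p : R * R * R, exists p' : R * R * R,
    let '(a, c, h) := p in let '(a', c', h') := p' in
    0 < h -> ~ P a (a + h) c (c + h) ->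
    h' = h / 2 /\ a <= a' /\ a' + h' <= a + h /\ c <= c' /\ c' + h' <= c + h /\
    ~ P a' (a' + h') c' (c' + h')).
  { intros [[a c] h].
    destruct (classic (0 < h /\ ~ P a (a + h) c (c + h))) as [[H N]|H].
    2: exists (a, c, h); intros; tauto.
    set (k := h / 2).
    destruct (classic (P a (a + k) c (c + k))) as [H1|H1];
      [|exists (a, c, k); unfold k; intros; repeat split; auto; lra].
    destruct (classic (P (a + k) (a + k + k) c (c + k))) as [H2|H2];
      [|exists (a + k, c, k); unfold k; intros; repeat split; auto; lra].
    destruct (classic (P a (a + k) (c + k) (c + k + k))) as [H3|H3];
      [|exists (a, c + k, k); unfold k; intros; repeat split; auto; lra].
    destruct (classic (P (a + k) (a + k + k) (c + k) (c + k + k))) as [H4|H4];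
      [|exists (a + k, c + k, k); unfold k; intros; repeat split; auto; lra].
    exfalso. apply N.
    replace (a + h) with (a + k + k) by (unfold k; lra).
    replace (c + h) with (c + k + k) by (unfold k; lra).
    assert (0 < k) by (unfold k; lra).
    apply HY with (c + k); try lra; apply HX with (a + k); auto; lra. }
  set (f := fun p => proj1_sig (constructive_indefinite_description _ (step p))).
  assert (Hf : forall p, let '(a, c, h) := p in let '(a', c', h') := f p in
    0 < h -> ~ P a (a + h) c (c + h) ->
    h' = h / 2 /\ a <= a' /\ a' + h' <= a + h /\ c <= c' /\ c' + h' <= c + h /\
    ~ P a' (a' + h') c' (c' + h')).
  { intros p. unfold f. destruct constructive_indefinite_description as [p' Hp']. exact Hp'. }
  clearbody f. clear step.
  set (s := fix s n := match n with O => (x0, y0, h0) | S n => f (s n) end).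
  set (A := fun n => fst (fst (s n))). set (B := fun n => snd (fst (s n))).
  set (Hn := fun n => snd (s n)).
  assert (Inv : forall n, 0 < Hn n /\ ~ P (A n) (A n + Hn n) (B n) (B n + Hn n)).
  { induction n as [|n [I1 I2]]. split; auto.
    specialize (Hf (s n)). unfold A, B, Hn in *. simpl. destruct (s n) as [[a c] h].
    destruct (f (a, c, h)) as [[a' c'] h']. simpl in *.
    specialize (Hf I1 I2). split. lra. tauto. }
  assert (Stp : forall n, Hn (S n) = Hn n / 2 /\ A n <= A (S n) /\ A (S n) + Hn (S n) <= A n + Hn n /\
     B n <= B (S n) /\ B (S n) + Hn (S n) <= B n + Hn n).
  { intros n. destruct (Inv n) as [I1 I2].
    specialize (Hf (s n)). unfold A, B, Hn in *. simpl. destruct (s n) as [[a c] h].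
    destruct (f (a, c, h)) as [[a' c'] h']. simpl in *.
    specialize (Hf I1 I2). tauto. }
  assert (A0 : A O = x0) by reflexivity. assert (B0 : B O = y0) by reflexivity.
  assert (H0 : Hn O = h0) by reflexivity.
  clearbody A B Hn.
  assert (Mon : forall m k, A m <= A (m + k)%nat /\ A (m + k)%nat + Hn (m + k)%nat <= A m + Hn m /\
      B m <= B (m + k)%nat /\ B (m + k)%nat + Hn (m + k)%nat <= B m + Hn m).
  { intros m k. induction k as [|k IH]. rewrite Nat.add_0_r. lra.
    replace (m + S k)%nat with (S (m + k)) by lia. specialize (Stp (m + k)%nat). lra. }
  assert (Box : forall m n, A n <= A m + Hn m /\ B n <= B m + Hn m).
  { intros m n. destruct (Nat.le_ge_cases m n) as [L|L].
    - replace n with (m + (n - m))%nat by lia.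
      specialize (Mon m (n - m)%nat). destruct (Inv (m + (n - m))%nat). lra.
    - assert (M := Mon n (m - n)%nat). replace (n + (m - n))%nat with m in M by lia.
      destruct (Inv m). lra. }
  destruct (nested_point A Hn) as [u Hu]. { intros. apply Box. }
  destruct (nested_point B Hn) as [v Hv]. { intros. apply Box. }
  assert (Hu0 := Hu O). assert (Hv0 := Hv O). rewrite A0, H0 in Hu0. rewrite B0, H0 in Hv0.
  destruct (HL u v Hu0 Hv0) as [e [He Hloc]].
  assert (Hpow : forall n, Hn n = h0 * (/ 2) ^ n).
  { induction n as [|n IH]. simpl. lra. destruct (Stp n) as [E _]. rewrite E, IH. simpl. lra. }
  destruct (pow_lt_1_zero (/ 2)) with (y := e / h0) as [n Hn'].
  { rewrite Rabs_pos_eq; lra. } { apply Rdiv_lt_0_compat; lra. }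
  specialize (Hn' n (Nat.le_refl n)).
  assert (He' : Hn n < e).
  { rewrite Hpow. rewrite Rabs_pos_eq in Hn' by (apply pow_le; lra).
    apply Rmult_lt_compat_l with (r := h0) in Hn'; auto.
    replace (h0 * (e / h0)) with e in Hn' by (field; lra). lra. }
  destruct (Inv n) as [I1 I2]. apply I2.
  specialize (Mon O n). simpl in Mon. rewrite A0, B0, H0 in Mon.
  apply Hloc; try lra; auto.
Qed.
(** * The mean value property on circles *)

(** The complex exponential of [s + i t]: it turns circles around 0 into segments, so
    that squares in the coordinates [s] and [t] are sectors of annuli. *)
Definition polar (s t : R) : C := (exp s * cos t, exp s * sin t).

Lemma Cmod_polar s t : Cmod (polar s t) = exp s.
Proof.
  apply Rsqr_inj. apply Cmod_ge_0. left; apply exp_pos.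
  unfold Rsqr. rewrite Cmod_sqr. unfold polar. simpl.
  replace (exp s * cos t * (exp s * cos t) + exp s * sin t * (exp s * sin t))
    with (exp s * exp s * ((sin t)² + (cos t)²)) by (unfold Rsqr; ring).
  rewrite sin2_cos2. ring.
Qed.

Lemma exp_lipschitz S s s' : s <= S -> s' <= S -> Rabs (exp s - exp s') <= exp S * Rabs (s - s').
Proof.
  intros H H'.
  assert (K : forall a b, a <= b -> b <= S -> Rabs (exp b - exp a) <= exp S * Rabs (b - a)).
  { intros a b Hab HbS. rewrite !Rabs_pos_eq; try lra.
    - assert (E := exp_ineq1_le (a - b)).
      assert (F : exp a = exp b * exp (a - b)) by (rewrite <- exp_plus; f_equal; ring).
      assert (G : exp b <= exp S). { destruct HbS as [L| ->]; [left; now apply exp_increasing|lra]. }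
      assert (P := exp_pos b). nra.
    - destruct Hab as [L| ->]; [assert (X := exp_increasing _ _ L); lra|lra]. }
  destruct (Rle_or_lt s s') as [L|L].
  - rewrite (Rabs_minus_sym (exp s)), (Rabs_minus_sym s). now apply K.
  - apply K; lra.
Qed.

Lemma cos_lipschitz t t' : Rabs (cos t - cos t') <= Rabs (t - t').
Proof.
  destruct (MVT_gen cos t' t (fun x => - sin x)) as [c [_ E]].
  - intros. auto_derive; auto. ring.
  - intros. apply continuity_cos.
  - rewrite E, Rabs_mult, Rabs_Ropp. assert (B := SIN_bound c).
    assert (Rabs (sin c) <= 1) by (apply Rabs_le; lra). assert (P := Rabs_pos (t - t')). nra.
Qed.

Lemma sin_lipschitz t t' : Rabs (sin t - sin t') <= Rabs (t - t').
Proof.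
  destruct (MVT_gen sin t' t cos) as [c [_ E]].
  - intros. auto_derive; auto. ring.
  - intros. apply continuity_sin.
  - rewrite E, Rabs_mult. assert (B := COS_bound c).
    assert (Rabs (cos c) <= 1) by (apply Rabs_le; lra). assert (P := Rabs_pos (t - t')). nra.
Qed.

Lemma polar_lipschitz S s s' t t' : s <= S -> s' <= S ->
  Cmod (polar s t - polar s' t') <= 2 * exp S * (Rabs (s - s') + Rabs (t - t')).
Proof.
  intros H H'. eapply Rle_trans. apply Cmod_le_parts. unfold polar. simpl.
  assert (P := exp_pos s'). assert (E := exp_lipschitz S s s' H H').
  assert (Q : exp s' <= exp S). { destruct H' as [L| ->]; [left; now apply exp_increasing|lra]. }
  assert (Ct := cos_lipschitz t t'). assert (St := sin_lipschitz t t').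
  assert (B1 : Rabs (cos t) <= 1) by (apply Rabs_le; assert (B := COS_bound t); lra).
  assert (B2 : Rabs (sin t) <= 1) by (apply Rabs_le; assert (B := SIN_bound t); lra).
  assert (P1 := Rabs_pos (exp s - exp s')). assert (P2 := Rabs_pos (t - t')).
  assert (K : forall x y, Rabs x <= 1 -> Rabs (x - y) <= Rabs (t - t') ->
    Rabs (exp s * x + - (exp s' * y)) <= exp S * (Rabs (s - s') + Rabs (t - t'))).
  { intros x y Hx Hy.
    replace (exp s * x + - (exp s' * y)) with ((exp s - exp s') * x + exp s' * (x - y)) by ring.
    eapply Rle_trans. apply Rabs_triang. rewrite !Rabs_mult, (Rabs_pos_eq (exp s')) by lra.
    assert (Px := Rabs_pos x). assert (Py := Rabs_pos (x - y)). nra. }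
  assert (K1 := K _ _ B1 Ct). assert (K2 := K _ _ B2 St). lra.
Qed.

Definition int_re (F : R -> R -> C) (s t0 t1 : R) : R := RInt (fun t => fst (F s t)) t0 t1.
Definition int_im (F : R -> R -> C) (t s0 s1 : R) : R := RInt (fun s => snd (F s t)) s0 s1.

(** The imaginary part of the integral of [F] along the boundary of a rectangle,
    in the variable [s + i t]. *)
Definition boundary_int (F : R -> R -> C) (s0 s1 t0 t1 : R) : R :=
  (int_re F s1 t0 t1 - int_re F s0 t0 t1) - (int_im F t1 s0 s1 - int_im F t0 s0 s1).

Definition cont_sides (F : R -> R -> C) (S : R) : Prop :=
  forall s t, s <= S ->
    continuous (fun t => fst (F s t)) t /\ continuous (fun s => snd (F s t)) s.

Lemma cont_sides_ex_re F S s a b : cont_sides F S -> s <= S -> ex_RInt (fun t => fst (F s t)) a b.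
Proof. intros H Hs. apply (ex_RInt_continuous (V := R_CompleteNormedModule)). intros. now apply H. Qed.

Lemma cont_sides_ex_im F S t a b : cont_sides F S -> a <= S -> b <= S ->
  ex_RInt (fun s => snd (F s t)) a b.
Proof.
  intros H Ha Hb. apply (ex_RInt_continuous (V := R_CompleteNormedModule)). intros s [_ Hs]. apply H.
  eapply Rle_trans. apply Hs. now apply Rmax_lub.
Qed.

Lemma boundary_int_split_s F S a m b c d : cont_sides F S -> a <= m <= b -> b <= S ->
  boundary_int F a b c d = boundary_int F a m c d + boundary_int F m b c d.
Proof.
  intros H Hm Hb. unfold boundary_int, int_im.
  rewrite <- (RInt_Chasles (fun s => snd (F s d)) a m b),
          <- (RInt_Chasles (fun s => snd (F s c)) a m b);
    try (apply (cont_sides_ex_im F S); auto; lra).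
  unfold plus; simpl. ring.
Qed.

Lemma boundary_int_split_t F S a b c m d : cont_sides F S -> a <= b -> b <= S ->
  boundary_int F a b c d = boundary_int F a b c m + boundary_int F a b m d.
Proof.
  intros H Ha Hb. unfold boundary_int, int_re.
  rewrite <- (RInt_Chasles (fun t => fst (F b t)) c m d),
          <- (RInt_Chasles (fun t => fst (F a t)) c m d);
    try (apply (cont_sides_ex_re F S); auto; lra).
  unfold plus; simpl. ring.
Qed.

Lemma cont_path (f : C -> C) (g : R -> C) t L :
  0 < L -> (forall t', Rabs (t' - t) < 1 -> Cmod (g t' - g t) <= L * Rabs (t' - t)) ->
  cont f (g t) ->
  continuous (fun t => fst (f (g t))) t /\ continuous (fun t => snd (f (g t))) t.
Proof.
  intros HL Hg Hf.
  assert (K : forall e : posreal, exists d : posreal, forall t', ball t d t' ->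
     Cmod (f (g t') - f (g t)) < e).
  { intros e. destruct (Hf e (cond_pos e)) as [d [Hd H]].
    assert (Hm : 0 < Rmin 1 (d / L)) by (apply Rmin_glb_lt; [lra|now apply Rdiv_lt_0_compat]).
    exists (mkposreal _ Hm). intros t' Ht'. change (Rabs (t' - t) < Rmin 1 (d / L)) in Ht'.
    apply H. eapply Rle_lt_trans. apply Hg. eapply Rlt_le_trans; [apply Ht'|apply Rmin_l].
    replace d with (L * (d / L)) by (field; lra). apply Rmult_lt_compat_l; auto.
    eapply Rlt_le_trans; [apply Ht'|apply Rmin_r]. }
  split; apply filterlim_locally; intros e; destruct (K e) as [d Hd];
    exists d; intros t' Ht'; specialize (Hd t' Ht'); eapply Rle_lt_trans; try apply Hd.
  - apply (Re_le_Cmod (f (g t') - f (g t))%C).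
  - apply (Im_le_Cmod (f (g t') - f (g t))%C).
Qed.

Lemma cont_sides_polar f q S :
  (forall s t, s <= S -> cont f (q + polar s t)) -> cont_sides (fun s t => f (q + polar s t)%C) S.
Proof.
  intros H s t Hs. assert (P : 0 < 2 * exp (S + 1)) by (assert (X := exp_pos (S + 1)); lra).
  split.
  - apply (cont_path f (fun t => q + polar s t)%C t (2 * exp (S + 1))); auto.
    intros t' _. replace (q + polar s t' - (q + polar s t))%C with (polar s t' - polar s t)%C by ring.
    assert (L := polar_lipschitz (S + 1) s s t' t ltac:(lra) ltac:(lra)).
    replace (s - s) with 0 in L by ring. rewrite Rabs_R0 in L. lra.
  - apply (cont_path f (fun s => q + polar s t)%C s (2 * exp (S + 1))); auto.
    intros s' Hs'. replace (q + polar s' t - (q + polar s t))%C with (polar s' t - polar s t)%C by ring.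
    assert (s' <= S + 1) by (apply Rabs_def2 in Hs'; lra).
    assert (L := polar_lipschitz (S + 1) s' s t t ltac:(lra) ltac:(lra)).
    replace (t - t) with 0 in L by ring. rewrite Rabs_R0 in L. lra.
Qed.

(** Both parts of the boundary integral reduce to the same difference of values of
    a primitive. *)
Lemma boundary_int_affine (A B : C) s0 s1 t0 t1 :
  boundary_int (fun s t => A + B * polar s t)%C s0 s1 t0 t1 = 0.
Proof.
  assert (HU : forall s, int_re (fun s t => A + B * polar s t)%C s t0 t1 =
    (fst A * t1 + exp s * (fst B * sin t1 + snd B * cos t1)) -
    (fst A * t0 + exp s * (fst B * sin t0 + snd B * cos t0))).
  { intros s. unfold int_re. apply is_RInt_unique.
    apply (is_RInt_derive (fun t => fst A * t + exp s * (fst B * sin t + snd B * cos t))).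
    - intros t _. unfold polar. simpl. auto_derive; auto. ring.
    - intros t _. unfold polar. simpl. apply (ex_derive_continuous (V := R_NormedModule)). auto_derive. auto. }
  assert (HV : forall t, int_im (fun s t => A + B * polar s t)%C t s0 s1 =
    (snd A * s1 + exp s1 * (fst B * sin t + snd B * cos t)) -
    (snd A * s0 + exp s0 * (fst B * sin t + snd B * cos t))).
  { intros t. unfold int_im. apply is_RInt_unique.
    apply (is_RInt_derive (fun s => snd A * s + exp s * (fst B * sin t + snd B * cos t))).
    - intros s _. unfold polar. simpl. auto_derive; auto. ring.
    - intros s _. unfold polar. simpl. apply (ex_derive_continuous (V := R_NormedModule)). auto_derive. auto. }
  unfold boundary_int. rewrite !HU, !HV. ring.
Qed.

Lemma RInt_close (u v : R -> R) a b e : a <= b -> ex_RInt u a b -> ex_RInt v a b ->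
  (forall x, a <= x <= b -> Rabs (u x - v x) <= e) ->
  Rabs (RInt u a b - RInt v a b) <= e * (b - a).
Proof.
  intros Hab Hu Hv H.
  replace (RInt u a b - RInt v a b) with (RInt (fun x => u x - v x) a b).
  - rewrite Rmult_comm. apply abs_RInt_le_const; auto.
    apply (ex_RInt_minus (V := R_NormedModule) u v); auto.
  - apply (RInt_minus (V := R_CompleteNormedModule) u v); auto.
Qed.

Lemma boundary_int_close F G S e s t h : cont_sides F S -> cont_sides G S -> 0 < h -> s + h <= S ->
  (forall s' t', s <= s' <= s + h -> t <= t' <= t + h -> Cmod (F s' t' - G s' t') <= e) ->
  Rabs (boundary_int F s (s + h) t (t + h) - boundary_int G s (s + h) t (t + h)) <= 4 * e * h.
Proof.
  intros HF HG Hh HS H.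
  assert (KU : forall s', s <= s' <= s + h ->
    Rabs (int_re F s' t (t + h) - int_re G s' t (t + h)) <= e * h).
  { intros s' Hs'. replace (e * h) with (e * (t + h - t)) by ring.
    apply RInt_close; try lra; try (eapply cont_sides_ex_re; eauto; lra).
    intros t' Ht'. eapply Rle_trans; [|apply (H s' t' Hs' Ht')].
    apply (Re_le_Cmod (F s' t' - G s' t')%C). }
  assert (KV : forall t', t <= t' <= t + h ->
    Rabs (int_im F t' s (s + h) - int_im G t' s (s + h)) <= e * h).
  { intros t' Ht'. replace (e * h) with (e * (s + h - s)) by ring.
    apply RInt_close; try lra; try (eapply cont_sides_ex_im; eauto; lra).
    intros s' Hs'. eapply Rle_trans; [|apply (H s' t' Hs' Ht')].
    apply (Im_le_Cmod (F s' t' - G s' t')%C). }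
  assert (K1 := KU s ltac:(lra)). assert (K2 := KU (s + h) ltac:(lra)).
  assert (K3 := KV t ltac:(lra)). assert (K4 := KV (t + h) ltac:(lra)).
  unfold boundary_int. apply Rabs_le_between in K1, K2, K3, K4. apply Rabs_le. lra.
Qed.

(** Goursat's argument: near each point [f] is affine up to an error that is small
    relative to the side of the square, so the boundary integral is small relative
    to the area, and by bisection this persists on a big square. *)
Lemma boundary_int_polar_zero f q s t h : 0 < h ->
  (forall s' t', s' <= s + h -> hol_at f (q + polar s' t')) ->
  boundary_int (fun s t => f (q + polar s t)%C) s (s + h) t (t + h) = 0.
Proof.
  intros Hh Hf. set (F := fun s t => f (q + polar s t)%C). set (S := s + h).
  assert (CS : cont_sides F S).
  { apply cont_sides_polar. intros. now apply hol_at_cont, Hf. }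
  assert (K : forall e, 0 < e -> Rabs (boundary_int F s (s + h) t (t + h)) <= e * (h * h)).
  { intros e He.
    enough (X : s + h <= S -> Rabs (boundary_int F s (s + h) t (t + h)) <= e * ((s + h - s) * (t + h - t))).
    { replace (h * h) with ((s + h - s) * (t + h - t)) by ring. apply X. unfold S; lra. }
    apply (square_bisection (fun a b c d => b <= S -> Rabs (boundary_int F a b c d) <= e * ((b - a) * (d - c)))); auto.
    - intros a m b c d Hm Hc H1 H2 Hb. rewrite (boundary_int_split_s F S a m b) by auto.
      eapply Rle_trans. apply Rabs_triang. specialize (H1 ltac:(lra)). specialize (H2 ltac:(lra)). lra.
    - intros a b c m d Ha Hm H1 H2 Hb. rewrite (boundary_int_split_t F S a b c m) by auto.
      eapply Rle_trans. apply Rabs_triang. specialize (H1 ltac:(lra)). specialize (H2 ltac:(lra)). lra.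
    - intros u v Hu Hv. destruct (Hf u v) as [l Hl]; [lra|].
      apply diff_at_eps with (e := e / (16 * exp S)) in Hl.
      2: { apply Rdiv_lt_0_compat; auto. assert (X := exp_pos S); lra. }
      destruct Hl as [d [Hd Hl]]. assert (PS := exp_pos S).
      exists (d / (4 * exp S)). split. apply Rdiv_lt_0_compat; lra.
      intros a c k Hk A1 A2 B1 B2 Ua Vc _.
      set (p := (q + polar u v)%C) in *.
      set (G := fun s t => ((f p - l * (p - q)) + l * polar s t)%C).
      assert (CG : cont_sides G S).
      { replace G with (fun s t => (f p - l * (p - q)) + l * (q + polar s t - q))%C.
        { apply (cont_sides_polar (fun y => (f p - l * (p - q)) + l * (y - q))%C).
          intros. apply cont_plus. apply cont_const. apply cont_mult. apply cont_const.
          apply cont_minus. apply cont_id. apply cont_const. }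
        apply functional_extensionality; intros x; apply functional_extensionality; intros y.
        unfold G. ring. }
      assert (Cl : forall s' t', a <= s' <= a + k -> c <= t' <= c + k ->
         Cmod (F s' t' - G s' t') <= e * k / 4).
      { intros s' t' Hs' Ht'. assert (L := polar_lipschitz S s' u t' v ltac:(unfold S; lra) ltac:(unfold S; lra)).
        assert (D1 : Rabs (s' - u) <= k) by (apply Rabs_le; lra).
        assert (D2 : Rabs (t' - v) <= k) by (apply Rabs_le; lra).
        assert (L' : Cmod (q + polar s' t' - p) <= 4 * exp S * k).
        { unfold p. replace (q + polar s' t' - (q + polar u v))%C with (polar s' t' - polar u v)%C by ring. nra. }
        replace (F s' t' - G s' t')%C with (f (q + polar s' t') - f p - l * (q + polar s' t' - p))%C.
        2: { unfold F, G. ring. }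
        eapply Rle_trans. apply Hl.
        { eapply Rle_lt_trans. apply L'. replace d with (4 * exp S * (d / (4 * exp S))) by (field; lra).
          apply Rmult_lt_compat_l; lra. }
        replace (e * k / 4) with (e / (16 * exp S) * (4 * exp S * k)) by (field; lra).
        apply Rmult_le_compat_l; auto. left. apply Rdiv_lt_0_compat; lra. }
      assert (X := boundary_int_close F G S (e * k / 4) a c k CS CG ltac:(lra) ltac:(unfold S; lra) Cl).
      unfold G in X. rewrite boundary_int_affine in X. rewrite Rminus_0_r in X.
      replace (e * ((a + k - a) * (c + k - c))) with (4 * (e * k / 4) * k) by field. exact X. }
  apply NNPP. intros N. apply Rabs_pos_lt in N.
  change (s + h) with S in K. set (b := boundary_int F s S t (t + h)) in *.
  clearbody b. clear - N K Hh.
  assert (Q : 0 < h * h) by nra.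
  assert (Q2 : 0 < Rabs b / (2 * (h * h))) by (apply Rdiv_lt_0_compat; [exact N|lra]).
  specialize (K _ Q2).
  replace (Rabs b / (2 * (h * h)) * (h * h)) with (Rabs b / 2) in K by (field; lra). lra.
Qed.
(** The mean over a circle does not depend on its radius, since the two sides
    [t = 0] and [t = 2 PI] of the square in logarithmic polar coordinates cancel. *)
Lemma circle_mean_shrink f q s :
  (forall s' t', s' <= s -> hol_at f (q + polar s' t')) ->
  int_re (fun s t => f (q + polar s t)%C) s 0 (2 * PI) =
  int_re (fun s t => f (q + polar s t)%C) (s - 2 * PI) 0 (2 * PI).
Proof.
  intros H. assert (P := PI_RGT_0).
  assert (E := boundary_int_polar_zero f q (s - 2 * PI) 0 (2 * PI) ltac:(lra)).
  replace (s - 2 * PI + 2 * PI) with s in E by ring. rewrite Rplus_0_l in E.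
  specialize (E H). unfold boundary_int in E.
  replace (int_im (fun s t => f (q + polar s t)%C) (2 * PI) (s - 2 * PI) s)
    with (int_im (fun s t => f (q + polar s t)%C) 0 (s - 2 * PI) s) in E.
  - lra.
  - unfold int_im. f_equal. apply functional_extensionality. intros s'.
    unfold polar. now rewrite cos_2PI, sin_2PI, cos_0, sin_0.
Qed.

(** Shrinking the radius by the factor [exp (- 2 PI)] does not change the mean, and the
    means tend to the value at the centre by continuity. *)
Lemma circle_mean f q r s : cont f q -> exp s < r ->
  (forall y, 0 < Cmod (y - q) < r -> hol_at f y) ->
  RInt (fun t => fst (f (q + polar s t)%C)) 0 (2 * PI) = 2 * PI * fst (f q).
Proof.
  intros Hc Hs Hf. assert (P := PI_RGT_0).
  assert (Hp : forall s' t', s' <= s -> hol_at f (q + polar s' t')).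
  { intros s' t' Hs'. apply Hf.
    replace (q + polar s' t' - q)%C with (polar s' t') by ring. rewrite Cmod_polar.
    split. apply exp_pos. eapply Rle_lt_trans; [|apply Hs].
    destruct Hs' as [L| ->]; [left; now apply exp_increasing|lra]. }
  set (F := fun s t => f (q + polar s t)%C).
  change (int_re F s 0 (2 * PI) = 2 * PI * fst (f q)).
  assert (HI : forall n, int_re F s 0 (2 * PI) = int_re F (s - INR n * (2 * PI)) 0 (2 * PI)).
  { induction n as [|n IH]. simpl. f_equal. ring.
    rewrite IH. unfold F at 1. rewrite circle_mean_shrink.
    - rewrite S_INR. unfold F. f_equal. ring.
    - intros s' t' Hs'. apply Hp. assert (0 <= INR n * (2 * PI)) by (apply Rmult_le_pos; [apply pos_INR|lra]). lra. }
  assert (K : forall e, 0 < e -> Rabs (int_re F s 0 (2 * PI) - 2 * PI * fst (f q)) <= e * (2 * PI)).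
  { intros e He. destruct (Hc e He) as [d [Hd Hd']].
    destruct (INR_unbounded ((s - ln d) / (2 * PI))) as [n Hn].
    assert (Hn' : s - INR n * (2 * PI) < ln d).
    { apply Rmult_lt_compat_r with (r := 2 * PI) in Hn; [|lra].
      unfold Rdiv in Hn. rewrite Rmult_assoc, Rinv_l, Rmult_1_r in Hn by lra. lra. }
    rewrite (HI n). set (s' := s - INR n * (2 * PI)) in *.
    assert (Hs' : s' <= s).
    { unfold s'. assert (0 <= INR n * (2 * PI)) by (apply Rmult_le_pos; [apply pos_INR|lra]). lra. }
    replace (2 * PI * fst (f q)) with (RInt (fun _ => fst (f q)) 0 (2 * PI)).
    2: { rewrite RInt_const. unfold scal; simpl; unfold mult; simpl. ring. }
    replace (e * (2 * PI)) with (e * (2 * PI - 0)) by ring. unfold int_re.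
    apply RInt_close. lra.
    - apply (cont_sides_ex_re F s); auto. apply cont_sides_polar. intros. now apply hol_at_cont, Hp.
    - apply ex_RInt_const.
    - intros t _. eapply Rle_trans. apply (Re_le_Cmod (F s' t - f q)%C). left. apply Hd'.
      replace (q + polar s' t - q)%C with (polar s' t) by ring. rewrite Cmod_polar.
      rewrite <- (exp_ln d) by auto. now apply exp_increasing. }
  apply Rminus_diag_uniq. apply NNPP. intros N. apply Rabs_pos_lt in N.
  set (b := int_re F s 0 (2 * PI) - 2 * PI * fst (f q)) in *. clearbody b. clear - N K P.
  assert (Q : 0 < Rabs b / (4 * PI)) by (apply Rdiv_lt_0_compat; lra).
  specialize (K _ Q). replace (Rabs b / (4 * PI) * (2 * PI)) with (Rabs b / 2) in K by (field; lra). lra.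
Qed.

(** * The maximum modulus principle *)

Definition rcont (h : C -> R) (x : C) : Prop :=
  forall e, 0 < e -> exists d, 0 < d /\
    forall y, Cmod (y - x) < d -> Rabs (h y - h x) < e.

(** If no point were maximal, every point would be beaten, together with a
    neighbourhood, by some other point; by bisection a single point would beat the whole
    disc, itself included. *)
Lemma closed_disc_max (h : C -> R) c r : 0 <= r ->
  (forall x, Cmod (x - c) <= r -> rcont h x) ->
  exists q, Cmod (q - c) <= r /\ forall x, Cmod (x - c) <= r -> h x <= h q.
Proof.
  intros Hr Hh. apply NNPP. intros HN.
  assert (Up : forall q, Cmod (q - c) <= r -> exists y, Cmod (y - c) <= r /\ h q < h y).
  { intros q Hq. apply NNPP. intros HM. apply HN. exists q. split; auto.
    intros x Hx. apply Rnot_lt_le. intros HL. apply HM. exists x. auto. }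
  set (P := fun a b u v => exists y, Cmod (y - c) <= r /\
    forall x, a <= fst x <= b -> u <= snd x <= v -> Cmod (x - c) <= r -> h x < h y).
  assert (HP : P (fst c - r) ((fst c - r) + (2 * r + 1)) (snd c - r) ((snd c - r) + (2 * r + 1))).
  { apply square_bisection. lra.
    - intros a m b u v Hm _ [y1 [Y1 H1]] [y2 [Y2 H2]].
      destruct (Rle_or_lt (h y1) (h y2)) as [L|L]; [exists y2|exists y1]; split; auto;
        intros x Hx1 Hx2 Hx; (destruct (Rle_or_lt (fst x) m);
        [specialize (H1 x ltac:(lra) Hx2 Hx)|specialize (H2 x ltac:(lra) Hx2 Hx)]; lra).
    - intros a b u m v _ Hm [y1 [Y1 H1]] [y2 [Y2 H2]].
      destruct (Rle_or_lt (h y1) (h y2)) as [L|L]; [exists y2|exists y1]; split; auto;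
        intros x Hx1 Hx2 Hx; (destruct (Rle_or_lt (snd x) m);
        [specialize (H1 x Hx1 ltac:(lra) Hx)|specialize (H2 x Hx1 ltac:(lra) Hx)]; lra).
    - intros u v _ _. set (p := (u, v) : C).
      assert (Near : exists d y, 0 < d /\ Cmod (y - c) <= r /\
        forall x, Cmod (x - p) < d -> Cmod (x - c) <= r -> h x < h y).
      { destruct (Rle_or_lt (Cmod (p - c)) r) as [L|L].
        - destruct (Up p L) as [y [Hy Hlt]]. destruct (Hh p L (h y - h p)) as [d [Hd Hd']]. lra.
          exists d, y. split; auto. split; auto. intros x Hx _. specialize (Hd' x Hx).
          apply Rabs_def2 in Hd'. lra.
        - exists (Cmod (p - c) - r), c. split. lra. split. rewrite Cmod_sub_diag. lra.
          intros x Hx Hxr. exfalso. assert (T := Cmod_sub_triangle p x c).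
          rewrite (Cmod_sub_sym p x) in T. lra. }
      destruct Near as [d [y [Hd [Hy Hn]]]]. exists (d / 2). split. lra.
      intros a b k Hk _ _ _ _ Hu Hv. exists y. split; auto.
      intros x Hx1 Hx2 Hx. apply Hn; auto. eapply Rle_lt_trans. apply Cmod_le_parts.
      simpl. assert (Rabs (fst x + - u) <= k) by (apply Rabs_le; lra).
      assert (Rabs (snd x + - v) <= k) by (apply Rabs_le; lra). lra. }
  destruct HP as [y [Hy H]].
  assert (B1 := Re_le_Cmod (y - c)%C). assert (B2 := Im_le_Cmod (y - c)%C). simpl in B1, B2.
  assert (C1 : Rabs (fst y + - fst c) <= r) by lra. assert (C2 : Rabs (snd y + - snd c) <= r) by lra.
  apply Rabs_le_between in C1, C2. specialize (H y ltac:(lra) ltac:(lra) Hy). lra.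
Qed.

(** Isolated exceptional points are allowed because a difference quotient is at first
    only known to be continuous at its centre. *)
Definition hol_off_isolated (f : C -> C) (c : C) (r : R) : Prop :=
  (forall x, Cmod (x - c) <= r -> cont f x) /\
  (forall x, Cmod (x - c) < r ->
     exists d, 0 < d /\ forall y, 0 < Cmod (y - x) < d -> hol_at f y).

(** The mean value property makes [|f| + e |x - c|^2] strictly smaller at an interior point
    than somewhere on a circle around it, so its maximum lies on the boundary. *)
Lemma max_modulus f c r M : 0 < r -> hol_off_isolated f c r ->
  (forall x, Cmod (x - c) = r -> Cmod (f x) <= M) ->
  forall x, Cmod (x - c) <= r -> Cmod (f x) <= M.
Proof.
  intros Hr [Hc Hf] HM x0 Hx0. assert (P := PI_RGT_0).
  assert (K : forall e, 0 < e -> Cmod (f x0) <= M + e * (r * r)).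
  { intros e He.
    set (h := fun x => Cmod (f x) + e * (Cmod (x - c) * Cmod (x - c))).
    destruct (closed_disc_max h c r) as [q [Hq Hmax]]. lra.
    { intros x Hx eps Heps. destruct (Hc x Hx (eps / 2)) as [d [Hd Hd']]. lra.
      assert (Cx : cont (fun x => (x - c) * (x - c))%C x).
      { apply cont_mult; apply cont_minus; (apply cont_id || apply cont_const). }
      destruct (Cx (eps / (2 * e))) as [d2 [Hd2 Hd2']]. apply Rdiv_lt_0_compat; lra.
      exists (Rmin d d2). split. now apply Rmin_glb_lt. intros y Hy.
      specialize (Hd' y (Rlt_le_trans _ _ _ Hy (Rmin_l _ _))).
      specialize (Hd2' y (Rlt_le_trans _ _ _ Hy (Rmin_r _ _))).
      assert (A1 := Cmod_le_add (f y) (f x)). assert (A2 := Cmod_le_add (f x) (f y)).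
      rewrite Cmod_sub_sym in A2.
      assert (B1 := Cmod_le_add ((y - c) * (y - c)) ((x - c) * (x - c))).
      assert (B2 := Cmod_le_add ((x - c) * (x - c)) ((y - c) * (y - c))).
      rewrite Cmod_sub_sym in B2. rewrite !(Cmod_mult (_ - c)) in B1, B2.
      unfold h.
      set (X := Cmod (x - c) * Cmod (x - c)) in *. set (Y := Cmod (y - c) * Cmod (y - c)) in *.
      apply Rmult_lt_compat_l with (r := e) in Hd2'; auto.
      replace (e * (eps / (2 * e))) with (eps / 2) in Hd2' by (field; lra).
      apply Rabs_def1; nra. }
    destruct (Rle_or_lt r (Cmod (q - c))) as [L|L].
    - assert (E : Cmod (q - c) = r) by lra.
      specialize (Hmax x0 Hx0). unfold h in Hmax. rewrite E in Hmax. specialize (HM q E).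
      assert (0 <= Cmod (x0 - c) * Cmod (x0 - c)) by (assert (Z := Cmod_ge_0 (x0 - c)); nra). nra.
    - exfalso. destruct (Hf q L) as [d [Hd Hd']].
      set (d2 := Rmin d (r - Cmod (q - c))).
      assert (Hd2 : 0 < d2) by (apply Rmin_glb_lt; lra).
      set (rho := d2 / 2). set (s := ln rho).
      assert (Hrho : 0 < rho) by (unfold rho; lra).
      assert (Es : exp s = rho) by (now apply exp_ln).
      assert (D1 : rho < d) by (assert (d2 <= d) by apply Rmin_l; unfold rho; lra).
      assert (D2 : rho < r - Cmod (q - c)) by (assert (d2 <= r - Cmod (q - c)) by apply Rmin_r; unfold rho; lra).
      (* Multiplication by u makes the value at q real, so that real parts suffice. *)
      set (u := if Ceq_dec (f q) 0 then RtoC 1 else (Cconj (f q) / RtoC (Cmod (f q)))%C).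
      assert (Hu : Cmod u <= 1 /\ fst (u * f q)%C = Cmod (f q)).
      { unfold u. destruct Ceq_dec as [E|E].
        - rewrite E, Cmod_R, Cmod_0, Rabs_R1. simpl. lra.
        - assert (G : 0 < Cmod (f q)) by now apply Cmod_gt_0.
          assert (G' : RtoC (Cmod (f q)) <> 0%C) by (intros Z; apply RtoC_inj in Z; lra).
          split.
          + rewrite Cmod_div, Cmod_conj, Cmod_R, Rabs_pos_eq by (auto; lra).
            right. field. lra.
          + replace (Cconj (f q) / RtoC (Cmod (f q)) * f q)%C with
              ((f q * Cconj (f q)) / RtoC (Cmod (f q)))%C by (field; auto).
            rewrite <- Cmod2_conj. rewrite <- RtoC_div by lra. simpl. field. lra. }
      destruct Hu as [Hu1 Hu2].
      assert (Mean := circle_mean (fun y => u * f y)%C q d s).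
      cbv beta in Mean. rewrite Hu2 in Mean.
      assert (Mean' : RInt (fun t => fst (u * f (q + polar s t))%C) 0 (2 * PI) = 2 * PI * Cmod (f q)).
      { apply Mean. apply cont_mult. apply cont_const. apply Hc. lra. lra.
        intros y Hy. apply hol_mult. apply hol_const. now apply Hd'. }
      set (w := (q - c)%C).
      (* Maximality at q bounds the modulus of f by G on the circle; the terms with
         cos and sin integrate to 0 and leave the gain e rho^2. *)
      set (G := fun t => Cmod (f q) - e * (rho * rho + 2 * rho * (fst w * cos t + snd w * sin t))).
      assert (IG : is_RInt G 0 (2 * PI) (2 * PI * (Cmod (f q) - e * (rho * rho)))).
      { replace (2 * PI * (Cmod (f q) - e * (rho * rho))) with
          (((Cmod (f q) - e * (rho * rho)) * (2 * PI) - e * (2 * rho * (fst w * sin (2 * PI) - snd w * cos (2 * PI))))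
                 - ((Cmod (f q) - e * (rho * rho)) * 0 - e * (2 * rho * (fst w * sin 0 - snd w * cos 0)))).
        2: { rewrite sin_2PI, cos_2PI, sin_0, cos_0. ring. }
        apply (is_RInt_derive (fun t => (Cmod (f q) - e * (rho * rho)) * t - e * (2 * rho * (fst w * sin t - snd w * cos t)))).
        - intros t _. unfold G. auto_derive; auto. simpl. ring.
        - intros t _. unfold G. apply (ex_derive_continuous (V := R_NormedModule)). auto_derive. auto. }
      assert (Le : RInt (fun t => fst (u * f (q + polar s t))%C) 0 (2 * PI) <= RInt G 0 (2 * PI)).
      { apply RInt_le. lra.
        - assert (CS : cont_sides (fun s t => u * f (q + polar s t))%C s).
          { apply (cont_sides_polar (fun y => u * f y)%C). intros s' t Hs'. apply cont_mult. apply cont_const.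
            apply Hc. assert (T := Cmod_triangle (q - c) (polar s' t)). rewrite Cmod_polar in T.
            replace (q - c + polar s' t)%C with (q + polar s' t - c)%C in T by ring.
            assert (exp s' <= exp s). { destruct Hs' as [Z| ->]; [left; now apply exp_increasing|lra]. } lra. }
          apply (cont_sides_ex_re _ s s _ _ CS). lra.
        - eexists. apply IG.
        - intros t _. eapply Rle_trans. apply Rle_abs. eapply Rle_trans. apply Re_le_Cmod.
          rewrite Cmod_mult. set (y := (q + polar s t)%C).
          assert (Hy : Cmod (y - c) <= r).
          { assert (T := Cmod_triangle (q - c) (polar s t)). rewrite Cmod_polar in T.
            replace (q - c + polar s t)%C with (y - c)%C in T by (unfold y; ring). lra. }
          specialize (Hmax y Hy). unfold h in Hmax.
          assert (N : Cmod (y - c) * Cmod (y - c) = Cmod (q - c) * Cmod (q - c) +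
             rho * rho + 2 * rho * (fst w * cos t + snd w * sin t)).
          { rewrite !Cmod_sqr. unfold y, w, polar. rewrite Es. simpl.
            assert (SC := sin2_cos2 t). unfold Rsqr in SC.
            replace (rho * rho) with (rho * rho * (sin t * sin t + cos t * cos t)) by (rewrite SC; ring). ring. }
          rewrite N in Hmax. unfold G.
          assert (Z := Cmod_ge_0 (f y)). nra. }
      rewrite Mean', (is_RInt_unique _ _ _ _ IG) in Le.
      assert (0 < e * (rho * rho)) by (apply Rmult_lt_0_compat; nra). nra. }
  apply Rnot_lt_le. intros L.
  set (e := (Cmod (f x0) - M) / (2 * (r * r))).
  assert (He : 0 < e) by (apply Rdiv_lt_0_compat; nra). specialize (K e He).
  replace (e * (r * r)) with ((Cmod (f x0) - M) / 2) in K by (unfold e; field; lra). lra.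
Qed.
(** * Removable singularities, division, inverse functions *)

Lemma cauchy_limit (h : C -> C) x :
  (forall e, 0 < e -> exists d, 0 < d /\ forall y y',
     0 < Cmod (y - x) < d -> 0 < Cmod (y' - x) < d -> Cmod (h y - h y') <= e) ->
  exists l, forall e, 0 < e -> exists d, 0 < d /\ forall y,
     0 < Cmod (y - x) < d -> Cmod (h y - l) <= e.
Proof.
  intros H. set (ys := fun n => (x + RtoC (/ INR (S n)))%C).
  assert (Hys : forall n, Cmod (ys n - x) = / INR (S n)).
  { intros n. unfold ys. replace (x + RtoC (/ INR (S n)) - x)%C with (RtoC (/ INR (S n))) by ring.
    apply Cmod_RtoC_pos. left. apply Rinv_0_lt_compat, lt_0_INR. lia. }
  assert (Sm : forall d, 0 < d -> exists N, forall n, (n >= N)%nat -> 0 < Cmod (ys n - x) < d).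
  { intros d Hd. destruct (archimed_cor1 d Hd) as [N [HN HN0]]. exists N. intros n Hn. rewrite Hys.
    split. apply Rinv_0_lt_compat, lt_0_INR. lia.
    eapply Rle_lt_trans; [|apply HN]. apply Rinv_le_contravar. now apply lt_0_INR. apply le_INR. lia. }
  assert (Cau : forall e, 0 < e -> exists N, forall n m, (n >= N)%nat -> (m >= N)%nat ->
     Cmod (h (ys n) - h (ys m)) < e).
  { intros e He. destruct (H (e / 2)) as [d [Hd Hd']]. lra. destruct (Sm d Hd) as [N HN].
    exists N. intros n m Hn Hm. apply Rle_lt_trans with (e / 2); [|lra]. apply Hd'; auto. }
  destruct (Rcomplete.R_complete (fun n => fst (h (ys n)))) as [a Ha].
  { intros e He. destruct (Cau e He) as [N HN]. exists N. intros n m Hn Hm.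
    eapply Rle_lt_trans; [|apply (HN n m Hn Hm)]. apply (Re_le_Cmod (h (ys n) - h (ys m))%C). }
  destruct (Rcomplete.R_complete (fun n => snd (h (ys n)))) as [b Hb].
  { intros e He. destruct (Cau e He) as [N HN]. exists N. intros n m Hn Hm.
    eapply Rle_lt_trans; [|apply (HN n m Hn Hm)]. apply (Im_le_Cmod (h (ys n) - h (ys m))%C). }
  exists (a, b). intros e He. destruct (H (e / 2)) as [d [Hd Hd']]. lra.
  exists d. split; auto. intros y Hy.
  destruct (Ha (e / 4)) as [N1 H1]. lra. destruct (Hb (e / 4)) as [N2 H2]. lra.
  destruct (Sm d Hd) as [N3 H3]. set (n := (N1 + N2 + N3)%nat).
  assert (K1 := H1 n ltac:(unfold n; lia)). assert (K2 := H2 n ltac:(unfold n; lia)).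
  assert (K3 := Hd' y (ys n) Hy (H3 n ltac:(unfold n; lia))).
  assert (T := Cmod_sub_triangle (h y) (h (ys n)) (a, b)).
  assert (L := Cmod_le_parts (h (ys n) - (a, b))%C). simpl in L.
  unfold Rdist, Rminus in K1, K2. lra.
Qed.

Lemma away_from x q : exists d, 0 < d /\ forall y, 0 < Cmod (y - x) < d -> y <> q.
Proof.
  destruct (Ceq_dec x q) as [->|N].
  - exists 1. split. lra. intros y [Hy _] ->. rewrite Cmod_sub_diag in Hy. lra.
  - exists (Cmod (x - q)). split. now apply Cmod_sub_pos.
    intros y [_ Hy] ->. rewrite Cmod_sub_sym in Hy. lra.
Qed.

Lemma quotient_cont g q l y : y <> q -> cont g y -> cont (quotient g q l) y.
Proof.
  intros N H.
  apply cont_ext_loc with (fun w => (g w - g q) / (w - q))%C (Cmod (y - q)).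
  - now apply Cmod_sub_pos.
  - intros w Hw. rewrite quotient_off; auto. intros ->. rewrite Cmod_sub_sym in Hw. lra.
  - apply cont_div. apply cont_minus; auto. apply cont_const.
    apply cont_minus. apply cont_id. apply cont_const. now apply Cminus_eq_contra.
Qed.

Lemma quotient_hol g q l y : y <> q -> hol_at g y -> hol_at (quotient g q l) y.
Proof.
  intros N H.
  apply hol_at_ext_loc with (fun w => (g w - g q) / (w - q))%C (Cmod (y - q)).
  - now apply Cmod_sub_pos.
  - intros w Hw. rewrite quotient_off; auto. intros ->. rewrite Cmod_sub_sym in Hw. lra.
  - apply hol_div. apply hol_minus; auto. apply hol_const.
    apply hol_minus. apply hol_id. apply hol_const. now apply Cminus_eq_contra.
Qed.

Lemma cont_Cmod f x : cont f x -> rcont (fun y => Cmod (f y)) x.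
Proof.
  intros H e He. destruct (H e He) as [d [Hd H']]. exists d. split; auto. intros y Hy.
  specialize (H' y Hy).
  assert (A := Cmod_le_add (f y) (f x)). assert (B := Cmod_le_add (f x) (f y)).
  rewrite Cmod_sub_sym in B. apply Rabs_def1; lra.
Qed.

Lemma closed_disc_bounded f c r : 0 <= r -> (forall x, Cmod (x - c) <= r -> cont f x) ->
  exists M, 0 <= M /\ forall x, Cmod (x - c) <= r -> Cmod (f x) <= M.
Proof.
  intros Hr H. destruct (closed_disc_max (fun x => Cmod (f x)) c r Hr) as [q [_ Hq]].
  { intros. now apply cont_Cmod, H. }
  exists (Cmod (f q)). split; auto. apply Cmod_ge_0.
Qed.

(** The difference quotients of [g] at the points [q] near [q0], compared on a fixed circle,
    form a Cauchy family; by the maximum principle they do so at [q0] too, where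
    they are the difference quotients of [g] at [q0]. *)
Lemma removable_singularity g q0 R : 0 < R -> cont g q0 ->
  (forall y, 0 < Cmod (y - q0) < R -> hol_at g y) -> hol_at g q0.
Proof.
  intros HR Hc Hh. set (r := R / 2). assert (Hr : 0 < r) by (unfold r; lra).
  assert (Hcont : forall y, Cmod (y - q0) <= r -> cont g y).
  { intros y Hy. destruct (Ceq_dec y q0) as [->|N]; auto. apply hol_at_cont, Hh.
    split. now apply Cmod_sub_pos. unfold r in Hy; lra. }
  destruct (closed_disc_bounded g q0 r) as [B [HB0 HB]]; auto. lra.
  destruct (cauchy_limit (fun q => (g q - g q0) / (q - q0))%C q0) as [l Hl].
  { intros e He.
    destruct (Hc (e * r / 8)) as [d1 [Hd1 Hd1']]. { assert (0 < e * r) by now apply Rmult_lt_0_compat. lra. }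
    (* On the circle the difference below is at most
       2 B |q - q'| / (r / 2)^2 + |g q - g q'| / (r / 2); the bounds d1 and d2 make each
       term at most e / 2. *)
    set (d2 := e * (r * r) / (32 * (B + 1))).
    assert (Hd2 : 0 < d2). { apply Rdiv_lt_0_compat. apply Rmult_lt_0_compat; nra. lra. }
    exists (Rmin (r / 2) (Rmin d1 d2)). split. repeat apply Rmin_glb_lt; lra.
    intros q q' Hq Hq'.
    assert (Spl : forall q, 0 < Cmod (q - q0) < Rmin (r / 2) (Rmin d1 d2) ->
       q <> q0 /\ Cmod (q - q0) < r / 2 /\ Cmod (q - q0) < d2 /\ Cmod (g q - g q0) < e * r / 8).
    { intros p [Hp1 Hp2]. assert (M1 := Rmin_l (r / 2) (Rmin d1 d2)). assert (M2 := Rmin_r (r / 2) (Rmin d1 d2)).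
      assert (M3 := Rmin_l d1 d2). assert (M4 := Rmin_r d1 d2).
      split. intros ->. rewrite Cmod_sub_diag in Hp1. lra.
      split. lra. split. lra. apply Hd1'. lra. }
    destruct (Spl q Hq) as [N [L1 [L2 L3]]]. destruct (Spl q' Hq') as [N' [L1' [L2' L3']]].
    destruct (Hh q) as [k Hk]. { unfold r in *; lra. }
    destruct (Hh q') as [k' Hk']. { unfold r in *; lra. }
    set (D := fun w => (quotient g q k w - quotient g q' k' w)%C).
    assert (HD : hol_off_isolated D q0 r).
    { split.
      - intros x Hx. apply cont_minus.
        + destruct (Ceq_dec x q) as [->|Nx]. now apply diff_at_quotient. apply quotient_cont; auto.
        + destruct (Ceq_dec x q') as [->|Nx]. now apply diff_at_quotient. apply quotient_cont; auto.
      - intros x Hx. destruct (away_from x q) as [e1 [E1 E1']]. destruct (away_from x q') as [e2 [E2 E2']].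
        destruct (away_from x q0) as [e3 [E3 E3']].
        exists (Rmin (r - Cmod (x - q0)) (Rmin e1 (Rmin e2 e3))). split. repeat apply Rmin_glb_lt; lra.
        intros y [Hy1 Hy2].
        assert (M1 := Rmin_l (r - Cmod (x - q0)) (Rmin e1 (Rmin e2 e3))).
        assert (M2 := Rmin_r (r - Cmod (x - q0)) (Rmin e1 (Rmin e2 e3))).
        assert (M3 := Rmin_l e1 (Rmin e2 e3)). assert (M4 := Rmin_r e1 (Rmin e2 e3)).
        assert (M5 := Rmin_l e2 e3). assert (M6 := Rmin_r e2 e3).
        assert (Hg : hol_at g y).
        { apply Hh. split. apply Cmod_sub_pos. apply E3'. lra.
          assert (T := Cmod_sub_triangle y x q0). unfold r in *. lra. }
        apply hol_minus; apply quotient_hol; auto. apply E1'; lra. apply E2'; lra. }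
    assert (Bd : forall w, Cmod (w - q0) = r -> Cmod (D w) <= e).
    { intros w Hw.
      assert (F : forall p, Cmod (p - q0) < r / 2 -> r / 2 < Cmod (w - p)).
      { intros p Hp. assert (T := Cmod_sub_triangle w p q0). lra. }
      assert (F1 := F q L1). assert (F2 := F q' L1').
      assert (W1 : w <> q) by (intros ->; rewrite Cmod_sub_diag in F1; lra).
      assert (W2 : w <> q') by (intros ->; rewrite Cmod_sub_diag in F2; lra).
      unfold D. rewrite !quotient_off by auto.
      replace ((g w - g q) / (w - q) - (g w - g q') / (w - q'))%C with
        ((g w - g q) * (q - q') / ((w - q) * (w - q')) + (g q' - g q) / (w - q'))%C
        by (field; split; now apply Cminus_eq_contra).
      eapply Rle_trans. apply Cmod_triangle.
      rewrite !Cmod_div, !Cmod_mult by (repeat apply Cmult_neq_0; now apply Cminus_eq_contra).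
      assert (G1 : Cmod (g w - g q) <= 2 * (B + 1)).
      { assert (T := Cmod_triangle (g w) (- g q)). rewrite Cmod_opp in T.
        assert (X1 := HB w ltac:(lra)). assert (X2 := HB q ltac:(lra)).
        change (g w - g q)%C with (g w + - g q)%C. lra. }
      assert (G2 : Cmod (q - q') <= 2 * d2).
      { assert (T := Cmod_sub_triangle q q0 q'). rewrite (Cmod_sub_sym q0 q') in T. lra. }
      assert (G3 : Cmod (g q' - g q) <= e * r / 4).
      { assert (T := Cmod_sub_triangle (g q') (g q0) (g q)). rewrite (Cmod_sub_sym (g q0) (g q)) in T. lra. }
      assert (P1 := Cmod_ge_0 (g w - g q)). assert (P2 := Cmod_ge_0 (q - q')).
      assert (Q1 : Cmod (g w - g q) * Cmod (q - q') / (Cmod (w - q) * Cmod (w - q')) <= e / 2).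
      { apply Rmult_le_reg_r with (Cmod (w - q) * Cmod (w - q')). nra.
        unfold Rdiv. rewrite Rmult_assoc, Rinv_l, Rmult_1_r by nra.
        apply Rle_trans with (2 * (B + 1) * (2 * d2)). apply Rmult_le_compat; auto.
        replace (2 * (B + 1) * (2 * d2)) with (e / 2 * (r / 2 * (r / 2))) by (unfold d2; field; lra).
        apply Rmult_le_compat_l. lra. apply Rmult_le_compat; lra. }
      assert (Q2 : Cmod (g q' - g q) / Cmod (w - q') <= e / 2).
      { apply Rmult_le_reg_r with (Cmod (w - q')). lra.
        unfold Rdiv. rewrite Rmult_assoc, Rinv_l, Rmult_1_r by lra. nra. }
      lra. }
    assert (X := max_modulus D q0 r e Hr HD Bd q0 ltac:(rewrite Cmod_sub_diag; lra)).
    unfold D in X. rewrite !quotient_off in X by auto.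
    replace ((g q - g q0) / (q - q0) - (g q' - g q0) / (q' - q0))%C with
      ((g q0 - g q) / (q0 - q) - (g q0 - g q') / (q0 - q'))%C. exact X.
    field. repeat split; apply Cminus_eq_contra; auto. }
  exists l. apply diff_at_quotient. intros e He. destruct (Hl (e / 2)) as [d [Hd Hd']]. lra.
  exists d. split; auto. intros y Hy. rewrite quotient_at.
  destruct (Ceq_dec y q0) as [->|N]. rewrite quotient_at, Cmod_sub_diag. lra.
  rewrite quotient_off by auto. apply Rle_lt_trans with (e / 2); [|lra]. apply Hd'. split; auto.
  now apply Cmod_sub_pos.
Qed.

(** The difference quotient at [q] is continuous there, so its singularity is
    removable. *)
Lemma divide_zero U f q : open U -> holomorphic_on U f -> U q -> f q = 0%C ->
  exists g, holomorphic_on U g /\ (forall y, f y = ((y - q) * g y)%C) /\ diff_at f q (g q).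
Proof.
  intros HU Hf Hq H0. rewrite holomorphic_on_iff in Hf. destruct (Hf q Hq) as [l Hl].
  exists (quotient f q l).
  assert (Off : forall y, U y -> y <> q -> hol_at (quotient f q l) y)
    by (intros; apply quotient_hol; auto).
  split; [|split].
  - apply holomorphic_on_iff. intros y Hy. destruct (Ceq_dec y q) as [->|N]; auto.
    destruct (open_C _ _ HU Hq) as [d [Hd Hd']].
    apply removable_singularity with d; auto. now apply diff_at_quotient.
    intros w [W1 W2]. apply Off. auto. intros ->. rewrite Cmod_sub_diag in W1. lra.
  - intros y. rewrite (quotient_mult f q l y), H0 at 1. ring.
  - now rewrite quotient_at.
Qed.

(** A function divisible by every power of [y - p] is bounded near [p] by
    [M t ^ n] for all [n] with [t < 1], hence vanishes. *)
Lemma order_at U f p R : open U -> holomorphic_on U f -> U p ->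
  0 < R -> (forall y, Cmod (y - p) < R -> U y) ->
  (exists y, Cmod (y - p) < R /\ f y <> 0%C) ->
  exists n g, holomorphic_on U g /\ g p <> 0%C /\ forall y, f y = ((y - p) ^ n * g y)%C.
Proof.
  intros HU Hf Hp HR HB [x [Hx Hfx]]. apply NNPP. intros HN. apply Hfx.
  assert (Dv : forall n, exists g, holomorphic_on U g /\ forall y, f y = ((y - p) ^ n * g y)%C).
  { induction n as [|n [g [Hg E]]].
    - exists f. split; auto. intros y. change ((y - p) ^ 0)%C with (RtoC 1). ring.
    - destruct (classic (g p = 0%C)) as [Z|Z].
      + destruct (divide_zero U g p HU Hg Hp Z) as [g' [Hg' [E' _]]].
        exists g'. split; auto. intros y. rewrite E, E', Cpow_S. ring.
      + exfalso. apply HN. exists n, g. auto. }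
  set (r := (Cmod (x - p) + R) / 2). assert (Px := Cmod_ge_0 (x - p)).
  assert (Hr : 0 < r) by (unfold r; lra). assert (Hxr : Cmod (x - p) < r) by (unfold r; lra).
  assert (HrR : r < R) by (unfold r; lra).
  assert (Hf' := proj1 (holomorphic_on_iff U f) Hf).
  destruct (closed_disc_bounded f p r) as [M [HM0 HM]]. lra.
  { intros y Hy. apply hol_at_cont, Hf', HB. lra. }
  set (t := Cmod (x - p) / r).
  assert (Ht : 0 <= t < 1).
  { unfold t. split. apply Rle_div_r; lra. apply Rlt_div_l; lra. }
  assert (K : forall n, Cmod (f x) <= t ^ n * M).
  { intros n. destruct (Dv n) as [g [Hg E]]. rewrite holomorphic_on_iff in Hg.
    assert (G : Cmod (g x) <= M / r ^ n).
    { apply (max_modulus g p r); auto; try lra.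
      - split. intros y Hy. apply hol_at_cont, Hg, HB. lra.
        intros y Hy. exists (r - Cmod (y - p)). split. lra. intros w Hw. apply Hg, HB.
        assert (T := Cmod_sub_triangle w y p). lra.
      - intros y Hy. apply Rle_div_r. now apply pow_lt. rewrite <- Hy, <- Cmod_pow, Rmult_comm, <- Cmod_mult, <- E.
        apply HM. lra. }
    rewrite E, Cmod_mult, Cmod_pow. unfold t, Rdiv. rewrite Rpow_mult_distr, pow_inv.
    rewrite Rmult_assoc, (Rmult_comm (/ r ^ n)). apply Rmult_le_compat_l; auto. apply pow_le; auto. }
  apply Cmod_eq_0. apply Rle_antisym; [|apply Cmod_ge_0]. apply Rnot_lt_le. intros L.
  destruct (pow_lt_1_zero t) with (y := Cmod (f x) / (M + 1)) as [n Hn].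
  rewrite Rabs_pos_eq; lra. apply Rdiv_lt_0_compat; lra.
  specialize (Hn n (Nat.le_refl n)). rewrite Rabs_pos_eq in Hn by (apply pow_le; lra).
  specialize (K n). apply Rlt_div_r in Hn; [|lra].
  assert (0 <= t ^ n) by (apply pow_le; lra). nra.
Qed.

(** The derivative is the value at [q] of the difference quotient centred at [q], which
    the maximum principle bounds by its values on the circle. *)
Lemma cauchy_estimate g p r M q l : 0 < r -> (forall y, Cmod (y - p) <= r -> hol_at g y) ->
  (forall y, Cmod (y - p) <= r -> Cmod (g y) <= M) ->
  Cmod (q - p) <= r / 2 -> diff_at g q l -> Cmod l <= 4 * M / r.
Proof.
  intros Hr Hg HM Hq Hl. rewrite <- (quotient_at g q l).
  apply (max_modulus (quotient g q l) p r); auto; try lra.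
  - split.
    + intros x Hx. destruct (Ceq_dec x q) as [->|N]. now apply diff_at_quotient.
      apply quotient_cont; auto. now apply hol_at_cont, Hg.
    + intros x Hx. destruct (away_from x q) as [d [Hd Hd']].
      exists (Rmin d (r - Cmod (x - p))). split. apply Rmin_glb_lt; lra.
      intros y [Y1 Y2]. assert (M1 := Rmin_l d (r - Cmod (x - p))). assert (M2 := Rmin_r d (r - Cmod (x - p))).
      apply quotient_hol. apply Hd'. lra. apply Hg. assert (T := Cmod_sub_triangle y x p). lra.
  - intros w Hw. assert (T := Cmod_sub_triangle w q p).
    assert (N : w <> q) by (intros ->; lra). rewrite quotient_off, Cmod_div by (auto; now apply Cminus_eq_contra).
    assert (T2 := Cmod_triangle (g w) (- g q)). rewrite Cmod_opp in T2.
    assert (X1 := HM w ltac:(lra)). assert (X2 := HM q ltac:(lra)). assert (P := Cmod_ge_0 (g w)).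
    apply Rle_div_l. lra. change (g w - g q)%C with (g w + - g q)%C.
    apply Rle_trans with (4 * M / r * (r / 2)). replace (4 * M / r * (r / 2)) with (2 * M) by (field; lra). lra.
    apply Rmult_le_compat_l. apply Rle_div_r; lra. lra.
Qed.

Lemma diff_at_pow p n y :
  diff_at (fun w => (w - p) ^ S n)%C y (RtoC (INR (S n)) * (y - p) ^ n)%C.
Proof.
  assert (D1 : diff_at (fun w => w - p)%C y 1).
  { replace (RtoC 1) with (RtoC 1 + RtoC 0)%C by ring. apply diff_at_plus. apply diff_at_id. apply diff_at_const. }
  induction n as [|n IH].
  - simpl INR. change ((y - p) ^ 0)%C with (RtoC 1). rewrite Cmult_1_r.
    apply diff_at_ext_loc with (fun w => w - p)%C 1; [lra| |exact D1].
    intros w _. now rewrite Cpow_1_r.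
  - rewrite S_INR, RtoC_plus.
    replace ((RtoC (INR (S n)) + 1) * (y - p) ^ S n)%C with
      (1 * (y - p) ^ S n + (y - p) * (RtoC (INR (S n)) * (y - p) ^ n))%C by (rewrite Cpow_S; ring).
    apply (diff_at_mult (fun w => w - p)%C (fun w => (w - p) ^ S n)%C); auto.
Qed.

(** The derivative is [(y - p) ^ n * ((n + 1) * g y + (y - p) * g' y)], where [g'] is bounded
    near [p] by the Cauchy estimate while [g] stays away from 0. *)
Lemma critical_isolated U f p n g : open U -> U p -> holomorphic_on U g -> g p <> 0%C ->
  (forall y, f y = ((y - p) ^ S n * g y)%C) ->
  exists d, 0 < d /\ forall y l, 0 < Cmod (y - p) < d -> diff_at f y l -> l <> 0%C.
Proof.
  intros HU Hp Hg H0 E. rewrite holomorphic_on_iff in Hg.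
  destruct (open_C _ _ HU Hp) as [R [HR HRU]].
  set (r := R / 2). assert (Hr : 0 < r) by (unfold r; lra).
  assert (Hg' : forall y, Cmod (y - p) <= r -> hol_at g y). { intros y Hy. apply Hg, HRU. unfold r in Hy; lra. }
  destruct (closed_disc_bounded g p r) as [M [HM0 HM]]. lra. { intros; now apply hol_at_cont, Hg'. }
  destruct (cont_away g p) as [d1 [Hd1 Hd1']]; auto. { apply hol_at_cont, Hg; auto. }
  assert (P0 : 0 < Cmod (g p)) by now apply Cmod_gt_0.
  set (d2 := Cmod (g p) / 2 / (4 * M / r + 1)).
  assert (HMr : 0 <= 4 * M / r) by (apply Rle_div_r; lra).
  assert (Hd2 : 0 < d2) by (apply Rdiv_lt_0_compat; lra).
  exists (Rmin (r / 2) (Rmin d1 d2)). split. repeat apply Rmin_glb_lt; lra.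
  intros y l [Hy1 Hy2] Hl ->.
  assert (M1 := Rmin_l (r / 2) (Rmin d1 d2)). assert (M2 := Rmin_r (r / 2) (Rmin d1 d2)).
  assert (M3 := Rmin_l d1 d2). assert (M4 := Rmin_r d1 d2).
  destruct (Hg' y) as [m Hm]. lra.
  assert (Cm := cauchy_estimate g p r M y m Hr Hg' HM ltac:(lra) Hm).
  assert (D := diff_at_mult _ _ _ _ _ (diff_at_pow p n y) Hm).
  assert (D' := diff_at_ext_loc _ f y _ 1 ltac:(lra) (fun w _ => eq_sym (E w)) D).
  assert (Z := diff_at_unique _ _ _ _ Hl D').
  assert (Ny : (y - p)%C <> 0%C) by now apply Cmod_pos_neq.
  assert (Z' : ((y - p) ^ n * (RtoC (INR (S n)) * g y + (y - p) * m) = 0)%C).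
  { rewrite Z, Cpow_S. ring. }
  assert (Z2 : (RtoC (INR (S n)) * g y + (y - p) * m = 0)%C).
  { apply NNPP. intros W. apply (Cmult_neq_0 _ _ (Cpow_nz _ n Ny) W Z'). }
  assert (Z3 : (RtoC (INR (S n)) * g y = - ((y - p) * m))%C).
  { replace (RtoC (INR (S n)) * g y)%C with ((RtoC (INR (S n)) * g y + (y - p) * m) - (y - p) * m)%C by ring.
    rewrite Z2. ring. }
  apply (f_equal Cmod) in Z3. rewrite Cmod_opp, !Cmod_mult, Cmod_RtoC_pos in Z3 by apply pos_INR.
  assert (G := Hd1' y ltac:(lra)).
  assert (I1 : 1 <= INR (S n)) by (rewrite S_INR; assert (X := pos_INR n); lra).
  assert (K : Cmod (y - p) * Cmod m < Cmod (g p) / 2).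
  { apply Rle_lt_trans with (Cmod (y - p) * (4 * M / r + 1)).
    - apply Rmult_le_compat_l; lra.
    - replace (Cmod (g p) / 2) with (d2 * (4 * M / r + 1)) by (unfold d2; field; lra).
      apply Rmult_lt_compat_r; lra. }
  nra.
Qed.

Lemma diff_at_inverse f s v l d : 0 < d -> cont s v -> diff_at f (s v) l -> l <> 0%C ->
  (forall v', Cmod (v' - v) < d -> f (s v') = v') -> diff_at s v (/ l)%C.
Proof.
  intros Hd Hs [q [d1 [Hd1 [Hq [Hc E]]]]] Hl Hfs.
  assert (Cq : cont (fun v => q (s v)) v) by now apply cont_comp.
  destruct (cont_away _ _ Cq) as [d2 [Hd2 Hd2']]. { now rewrite Hq. }
  destruct (Hs d1 Hd1) as [d3 [Hd3 Hd3']].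
  exists (fun v => / q (s v))%C, (Rmin d (Rmin d2 d3)). split. repeat apply Rmin_glb_lt; auto.
  split. now rewrite Hq. split. apply cont_inv; auto. now rewrite Hq.
  intros v' Hv'.
  assert (M1 := Rmin_l d (Rmin d2 d3)). assert (M2 := Rmin_r d (Rmin d2 d3)).
  assert (M3 := Rmin_l d2 d3). assert (M4 := Rmin_r d2 d3).
  assert (N : q (s v') <> 0%C).
  { apply Cmod_pos_neq. assert (X := Hd2' v' ltac:(lra)). assert (Y := Cmod_ge_0 (q (s v))). lra. }
  assert (E' := E (s v') ltac:(apply Hd3'; lra)).
  rewrite (Hfs v'), (Hfs v) in E' by (rewrite ?Cmod_sub_diag; lra).
  set (a := s v') in *. clearbody a. rewrite E'. field. auto.
Qed.

(** The critical points of [f] are isolated, so [s] is holomorphic off an isolated set;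
    as it is continuous, it is holomorphic everywhere. *)
Lemma inverse_holomorphic (S V : C -> Prop) (f s : C -> C) :
  open S -> open V -> holomorphic_on S f ->
  (forall x, S x -> V (f x) /\ s (f x) = x) ->
  (forall v, V v -> S (s v) /\ f (s v) = v) ->
  (forall v, V v -> cont s v) ->
  forall v, V v -> hol_at s v.
Proof.
  intros HS HV Hf HSV HVS Hs v0 Hv0. set (p := s v0).
  destruct (HVS v0 Hv0) as [Hp Hfp]. fold p in Hp, Hfp.
  destruct (open_C _ _ HS Hp) as [R [HR HRS]].
  set (F := fun y => (f y - v0)%C).
  assert (HF : holomorphic_on S F).
  { apply holomorphic_on_iff. intros x Hx. apply hol_minus; [|apply hol_const].
    rewrite holomorphic_on_iff in Hf. auto. }
  destruct (order_at S F p R HS HF Hp HR HRS) as [n [g [Hg [Hgp E]]]].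
  { set (y := (p + RtoC (R / 2))%C).
    assert (Hy : Cmod (y - p) = R / 2).
    { unfold y. replace (p + RtoC (R / 2) - p)%C with (RtoC (R / 2)) by ring. apply Cmod_RtoC_pos. lra. }
    exists y. split. lra. intros Z. apply Ceq_minus in Z.
    assert (Sy : S y) by (apply HRS; lra). destruct (HSV y Sy) as [_ E1]. rewrite Z in E1.
    fold p in E1. rewrite <- E1, Cmod_sub_diag in Hy. lra. }
  destruct n as [|n].
  { exfalso. apply Hgp. specialize (E p). unfold F in E. rewrite Hfp in E.
    change ((p - p) ^ 0)%C with (RtoC 1) in E. rewrite Cmult_1_l in E. rewrite <- E. ring. }
  destruct (critical_isolated S F p n g HS Hp Hg Hgp E) as [d [Hd Hcrit]].
  destruct (open_C _ _ HV Hv0) as [d1 [Hd1 Hd1']].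
  destruct (Hs v0 Hv0 d Hd) as [d2 [Hd2 Hd2']].
  apply removable_singularity with (Rmin d1 d2). now apply Rmin_glb_lt. auto.
  intros v [V1 V2]. assert (M1 := Rmin_l d1 d2). assert (M2 := Rmin_r d1 d2).
  assert (Hv : V v) by (apply Hd1'; lra). destruct (HVS v Hv) as [Hsv Hfsv].
  destruct (proj1 (holomorphic_on_iff S F) HF (s v) Hsv) as [l Hl].
  assert (Hl0 : l <> 0%C).
  { apply (Hcrit (s v)); auto. split. apply Cmod_sub_pos. intros Z.
    rewrite Z, Hfp in Hfsv. rewrite <- Hfsv, Cmod_sub_diag in V1. lra. apply Hd2'. lra. }
  destruct (open_C _ _ HV Hv) as [d3 [Hd3 Hd3']].
  exists (/ l)%C. apply (diff_at_inverse f s v l d3); auto.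
  - apply diff_at_ext_loc with (fun y => F y + v0)%C 1; [lra| |].
    intros; unfold F; ring. replace l with (l + 0)%C by ring. apply diff_at_plus; auto. apply diff_at_const.
  - intros v' Hv'. now apply HVS, Hd3'.
Qed.
(** * The Schwarz lemma and finite Blaschke products *)

Lemma unit_disc_open : open unit_disc.
Proof.
  intros x Hx. apply locally_C. exists (1 - Cmod x). unfold unit_disc in *. split. lra.
  intros y Hy. assert (T := Cmod_le_add y x). lra.
Qed.

Lemma unit_disc_0 : unit_disc 0.
Proof. unfold unit_disc. rewrite Cmod_0. lra. Qed.

(** The automorphism of the disc that exchanges [l] and [0]. *)
Definition blaschke (l x : C) : C := ((l - x) / (1 - Cconj l * x))%C.

Lemma blaschke_den_pos l x : Cmod l < 1 -> Cmod x <= 1 -> 1 - Cmod l <= Cmod (1 - Cconj l * x).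
Proof.
  intros Hl Hx. assert (T := Cmod_le_add 1 (Cconj l * x)).
  rewrite Cmod_1, Cmod_mult, Cmod_conj in T. assert (P := Cmod_ge_0 l). nra.
Qed.

Lemma blaschke_den_neq l x : Cmod l < 1 -> Cmod x <= 1 -> (1 - Cconj l * x)%C <> 0%C.
Proof. intros Hl Hx. apply Cmod_pos_neq. assert (T := blaschke_den_pos l x Hl Hx). lra. Qed.

Lemma blaschke_identity l x :
  Cmod (1 - Cconj l * x) * Cmod (1 - Cconj l * x) =
  Cmod (l - x) * Cmod (l - x) + (1 - Cmod l * Cmod l) * (1 - Cmod x * Cmod x).
Proof. rewrite !Cmod_sqr. destruct l as [a b], x as [u v]. simpl. ring. Qed.

Lemma blaschke_lt_1 l x : Cmod l < 1 -> Cmod x < 1 -> Cmod (blaschke l x) < 1.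
Proof.
  intros Hl Hx. unfold blaschke. rewrite Cmod_div by (apply blaschke_den_neq; lra).
  assert (D := blaschke_den_pos l x Hl ltac:(lra)). apply Rlt_div_l. lra. rewrite Rmult_1_l.
  assert (I := blaschke_identity l x). assert (P := Cmod_ge_0 l). assert (Q := Cmod_ge_0 x).
  assert (0 < (1 - Cmod l * Cmod l) * (1 - Cmod x * Cmod x)) by (apply Rmult_lt_0_compat; nra).
  assert (N := Cmod_ge_0 (l - x)). nra.
Qed.

Lemma blaschke_hol l x : Cmod l < 1 -> Cmod x < 1 -> hol_at (blaschke l) x.
Proof.
  intros Hl Hx. apply hol_div.
  - apply hol_minus. apply hol_const. apply hol_id.
  - apply hol_minus. apply hol_const. apply hol_mult. apply hol_const. apply hol_id.
  - apply blaschke_den_neq; lra.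
Qed.

Lemma disc_max_modulus G r M : 0 < r < 1 -> holomorphic_on unit_disc G ->
  (forall w, Cmod w = r -> Cmod (G w) <= M) -> forall x, Cmod x <= r -> Cmod (G x) <= M.
Proof.
  intros Hr HG HM x Hx. rewrite holomorphic_on_iff in HG. unfold unit_disc in HG.
  apply (max_modulus G 0 r M). lra.
  - split.
    + intros y Hy. rewrite Cmod_sub_0 in Hy. apply hol_at_cont, HG. lra.
    + intros y Hy. rewrite Cmod_sub_0 in Hy. exists (r - Cmod y). split. lra.
      intros w Hw. apply HG. assert (T := Cmod_le_add w y). lra.
  - intros w Hw. rewrite Cmod_sub_0 in Hw. auto.
  - now rewrite Cmod_sub_0.
Qed.

(** The quotient is bounded by 1 because [|blaschke l|] tends to 1 at the boundary. *)
Lemma blaschke_divide F l : holomorphic_on unit_disc F -> (forall x, unit_disc x -> Cmod (F x) <= 1) ->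
  unit_disc l -> F l = 0%C ->
  exists G, holomorphic_on unit_disc G /\ (forall x, unit_disc x -> Cmod (G x) <= 1) /\
    forall x, unit_disc x -> F x = (blaschke l x * G x)%C.
Proof.
  intros HF HF1 Hl H0. destruct (divide_zero unit_disc F l unit_disc_open HF Hl H0) as [g [Hg [E _]]].
  set (G := fun x => (- (1 - Cconj l * x) * g x)%C). unfold unit_disc in *.
  assert (HG : holomorphic_on unit_disc G).
  { rewrite holomorphic_on_iff in *. intros x Hx. apply hol_mult; auto. apply hol_opp.
    apply hol_minus. apply hol_const. apply hol_mult. apply hol_const. apply hol_id. }
  assert (EG : forall x, Cmod x < 1 -> F x = (blaschke l x * G x)%C).
  { intros x Hx. rewrite E. unfold blaschke, G. field. apply blaschke_den_neq; lra. }
  exists G. split; auto. split; auto. intros x Hx. apply Rnot_lt_le. intros L.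
  set (T := Cmod (G x)) in *. assert (Pl := Cmod_ge_0 l). assert (Px := Cmod_ge_0 x).
  set (K := (1 - Cmod l) * (1 - Cmod l)). assert (HK : 0 < K) by (unfold K; nra).
  set (m := (1 + T) / 2). assert (Hm : 1 < m < T) by (unfold m; lra).
  (* With 1 - r^2 at most d, the Blaschke factor has modulus at least 1 / m on the circle of
     radius r, so G is bounded by m there. *)
  set (d := K * (1 - / (m * m))).
  assert (Hmm : 0 < / (m * m) < 1).
  { split. apply Rinv_0_lt_compat; nra. rewrite <- Rinv_1. apply Rinv_lt_contravar; nra. }
  assert (Hd : 0 < d) by (unfold d; apply Rmult_lt_0_compat; lra).
  set (r := Rmax ((1 + Cmod x) / 2) (1 - d / 2)).
  assert (R1 : (1 + Cmod x) / 2 <= r) by apply Rmax_l. assert (R2 : 1 - d / 2 <= r) by apply Rmax_r.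
  assert (R3 : r < 1) by (apply Rmax_lub_lt; lra).
  assert (X : Cmod (G x) <= m); [|unfold T in *; lra].
  apply (disc_max_modulus G r); auto; try lra.
  intros w Hw. assert (Hw1 : Cmod w < 1) by lra.
  assert (B := HF1 w Hw1). rewrite (EG w Hw1), Cmod_mult in B.
  set (b := Cmod (blaschke l w)) in *.
  assert (Hb : / m <= b).
  { apply Rsqr_incr_0_var; [|apply Cmod_ge_0]. unfold Rsqr.
    unfold b, blaschke. rewrite Cmod_div by (apply blaschke_den_neq; lra).
    assert (D := blaschke_den_pos l w Hl ltac:(lra)). assert (I := blaschke_identity l w).
    set (q := Cmod (1 - Cconj l * w)) in *. set (c := Cmod (l - w)) in *.
    assert (Pq : 0 < q) by lra. assert (Pqq := Rmult_lt_0_compat _ _ Pq Pq).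
    replace (c / q * (c / q)) with ((c * c) / (q * q)) by (field; lra).
    apply (proj1 (Rle_div_r (/ m * / m) (c * c) (q * q) Pqq)). rewrite Hw in I.
    assert (Kq : K <= q * q) by (unfold K; nra).
    assert (Q1 : (1 - Cmod l * Cmod l) * (1 - r * r) <= d).
    { apply Rle_trans with (1 * (1 - r * r)). apply Rmult_le_compat_r; nra. nra. }
    assert (Q2 : d <= q * q * (1 - / (m * m))). { unfold d. apply Rmult_le_compat_r; lra. }
    rewrite Rinv_mult in Q2. nra. }
  assert (P := Cmod_ge_0 (G w)).
  assert (Cmod (G w) * / m <= 1) by nra.
  apply Rmult_le_reg_r with (/ m). apply Rinv_0_lt_compat; lra. rewrite Rinv_r; lra.
Qed.

Lemma blaschke_0_l x : blaschke 0 x = (- x)%C.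
Proof.
  unfold blaschke. replace (Cconj 0) with (RtoC 0).
  2: { unfold Cconj. apply injective_projections; simpl; ring. }
  replace (1 - 0 * x)%C with (RtoC 1) by ring. field.
Qed.

Lemma blaschke_0_r l : blaschke l 0 = l.
Proof.
  unfold blaschke. replace (1 - Cconj l * 0)%C with (RtoC 1) by ring. field.
Qed.

(** The Schwarz-Pick inequality cleared of denominators.  The function
    [blaschke (psi x)] composed with [psi] vanishes at [x], so it is divisible by
    [blaschke x]. *)
Lemma schwarz_pick psi x y : holomorphic_map unit_disc unit_disc psi -> unit_disc x -> unit_disc y ->
  Cmod (psi x - psi y) * Cmod (psi x - psi y) * ((1 - Cmod x * Cmod x) * (1 - Cmod y * Cmod y)) <=
  Cmod (x - y) * Cmod (x - y) *
    ((1 - Cmod (psi x) * Cmod (psi x)) * (1 - Cmod (psi y) * Cmod (psi y))).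
Proof.
  intros [Hh Hm] Hx Hy. set (a := psi x) in *. set (F := fun w => blaschke a (psi w)).
  assert (Ha : Cmod a < 1) by now apply Hm. assert (Hb : Cmod (psi y) < 1) by now apply Hm.
  destruct (blaschke_divide F x) as [G [_ [HG E]]]; auto.
  - rewrite holomorphic_on_iff in *. intros w Hw. apply (hol_comp (blaschke a)); auto. apply blaschke_hol; auto. now apply Hm.
  - intros w Hw. left. apply blaschke_lt_1; auto. now apply Hm.
  - unfold F, blaschke. fold a. unfold Cdiv. replace (a - a)%C with (RtoC 0) by ring. ring.
  - specialize (E y Hy). specialize (HG y Hy). apply (f_equal Cmod) in E. rewrite Cmod_mult in E.
    unfold F, blaschke in E. unfold unit_disc in *.
    rewrite !Cmod_div in E by (apply blaschke_den_neq; lra).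
    assert (I1 := blaschke_identity a (psi y)). assert (I2 := blaschke_identity x y).
    assert (D1 := blaschke_den_pos a (psi y) Ha ltac:(lra)).
    assert (D2 := blaschke_den_pos x y Hx ltac:(lra)).
    set (P := (1 - Cmod x * Cmod x) * (1 - Cmod y * Cmod y)) in *.
    set (P' := (1 - Cmod a * Cmod a) * (1 - Cmod (psi y) * Cmod (psi y))) in *.
    set (q := Cmod (1 - Cconj a * psi y)) in *. set (q' := Cmod (1 - Cconj x * y)) in *.
    set (c := Cmod (a - psi y)) in *. set (c' := Cmod (x - y)) in *.
    assert (Pc : 0 <= c) by apply Cmod_ge_0. assert (Pc' : 0 <= c') by apply Cmod_ge_0.
    assert (PG := Cmod_ge_0 (G y)). set (t := Cmod (G y)) in *.
    assert (L : c * q' <= c' * q).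
    { assert (Z : c = c' / q' * t * q) by (rewrite <- E; field; lra).
      rewrite Z. replace (c' / q' * t * q * q') with (c' * q * t) by (field; lra).
      assert (0 <= c' * q) by (apply Rmult_le_pos; lra). nra. }
    assert (L2 : (c * q') * (c * q') <= (c' * q) * (c' * q)).
    { apply Rmult_le_compat; auto; apply Rmult_le_pos; lra. }
    replace (c * q' * (c * q')) with (c * c * (q' * q')) in L2 by ring.
    replace (c' * q * (c' * q)) with (c' * c' * (q * q)) in L2 by ring.
    rewrite I1, I2 in L2. lra.
Qed.

(** The Schwarz-Pick inequality for [t * G] with [t < 1] bounds [|G p - G y|] by a quantity that
    tends to 0 as [t] tends to 1. *)
Lemma strong_max_modulus G p : holomorphic_on unit_disc G ->
  (forall x, unit_disc x -> Cmod (G x) <= 1) -> unit_disc p -> Cmod (G p) = 1 ->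
  forall y, unit_disc y -> G y = G p.
Proof.
  intros HG H1 Hp Ep y Hy. unfold unit_disc in *.
  set (Q := (1 - Cmod p * Cmod p) * (1 - Cmod y * Cmod y)).
  assert (Pp := Cmod_ge_0 p). assert (Py := Cmod_ge_0 y).
  assert (HQ : 0 < Q) by (apply Rmult_lt_0_compat; nra).
  set (c := Cmod (G p - G y)). assert (Hc : 0 <= c) by apply Cmod_ge_0.
  assert (K : forall t, 0 < t < 1 -> t * t * (c * c * Q) <= 4 * (1 - t * t)).
  { intros t Ht.
    assert (X := schwarz_pick (fun w => RtoC t * G w)%C p y).
    cbv beta in X. replace (RtoC t * G p - RtoC t * G y)%C with (RtoC t * (G p - G y))%C in X by ring.
    rewrite !Cmod_mult, !Cmod_RtoC_pos in X by lra. rewrite Ep in X. fold c Q in X.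
    assert (D : Cmod (p - y) <= 2).
    { assert (T := Cmod_triangle p (- y)). rewrite Cmod_opp in T. change (p - y)%C with (p + - y)%C. lra. }
    assert (D0 := Cmod_ge_0 (p - y)). assert (GY := H1 y Hy). assert (GY0 := Cmod_ge_0 (G y)).
    set (g := Cmod (G y)) in *. set (d := Cmod (p - y)) in *.
    eapply Rle_trans; [eapply Rle_trans; [|apply X]|].
    - lra.
    - split.
      + rewrite holomorphic_on_iff in *. intros w Hw. apply hol_mult; auto. apply hol_const.
      + intros w Hw. unfold unit_disc. rewrite Cmod_mult, Cmod_RtoC_pos by lra.
        assert (Z := H1 w Hw). assert (Z0 := Cmod_ge_0 (G w)). nra.
    - exact Hp.
    - exact Hy.
    - assert (U1 : 0 <= 1 - t * 1 * (t * 1) <= 1 - t * t) by nra.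
      assert (U2 : 0 <= 1 - t * g * (t * g) <= 1) by (split; [assert (t * g <= 1) by nra; assert (0 <= t * g) by nra; nra|nra]).
      assert (U3 : d * d <= 4) by nra.
      apply Rmult_le_compat; try nra. }
  apply eq_sym. apply Ceq_minus. apply Cmod_eq_0. fold c. apply NNPP. intros N.
  assert (Hc' : 0 < c * c * Q). { apply Rmult_lt_0_compat; auto. nra. }
  set (e := c * c * Q) in *. clearbody e. clear - K Hc'.
  set (s := Rmin (1 / 4) (e / 64)). assert (S1 : s <= 1 / 4) by apply Rmin_l. assert (S2 : s <= e / 64) by apply Rmin_r.
  assert (S0 : 0 < s) by (apply Rmin_glb_lt; lra).
  specialize (K (1 - s) ltac:(lra)). nra.
Qed.

Lemma unit_polar (c : C) : Cmod c = 1 -> exists t, c = (cos t, sin t).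
Proof.
  intros H. assert (S := Cmod_sqr c). rewrite H in S. destruct c as [u v]. simpl in S.
  assert (Hu : -1 <= u <= 1) by nra.
  assert (Es : sin (acos u) * sin (acos u) = v * v).
  { assert (T := sin2_cos2 (acos u)). rewrite cos_acos in T by auto. unfold Rsqr in T. lra. }
  destruct (Rle_or_lt 0 v) as [L|L].
  - exists (acos u). rewrite cos_acos by auto. f_equal.
    assert (B := acos_bound u). assert (0 <= sin (acos u)) by (apply sin_ge_0; lra). nra.
  - exists (- acos u). rewrite cos_neg, sin_neg, cos_acos by auto. f_equal.
    assert (B := acos_bound u). assert (0 <= sin (acos u)) by (apply sin_ge_0; lra). nra.
Qed.

(** The quotient [psi x / x] is bounded by 1, and it is constant if its modulus
    reaches 1. *)
Lemma schwarz psi : holomorphic_map unit_disc unit_disc psi -> psi 0%C = 0%C ->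
  (forall x, unit_disc x -> Cmod (psi x) <= Cmod x) /\
  forall p, unit_disc p -> p <> 0%C -> Cmod (psi p) = Cmod p ->
    exists t : R, forall x, unit_disc x -> psi x = (((cos t, sin t) : C) * x)%C.
Proof.
  intros [Hh Hm] H0.
  destruct (blaschke_divide psi 0) as [G [HG [HG1 E]]]; auto.
  { intros x Hx. left. now apply Hm. } { apply unit_disc_0. }
  assert (E' : forall x, unit_disc x -> psi x = (- x * G x)%C).
  { intros x Hx. rewrite E by auto. now rewrite blaschke_0_l. }
  split.
  - intros x Hx. rewrite E', Cmod_mult, Cmod_opp by auto.
    assert (P := Cmod_ge_0 x). assert (Q := HG1 x Hx). nra.
  - intros p Hp Np Ep. rewrite E', Cmod_mult, Cmod_opp in Ep by auto.
    assert (P : 0 < Cmod p) by now apply Cmod_gt_0.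
    assert (Gp : Cmod (G p) = 1) by nra.
    destruct (unit_polar (- G p)%C) as [t Ht]. now rewrite Cmod_opp.
    exists t. intros x Hx. rewrite <- Ht, E', (strong_max_modulus G p) by auto. ring.
Qed.

Lemma Cmult_cancel_l (a b c : C) : a <> 0%C -> (a * b)%C = (a * c)%C -> b = c.
Proof.
  intros N E. replace b with ((a * b) / a)%C by (field; auto). rewrite E. field; auto.
Qed.

Lemma hol_sub_const p x : hol_at (fun w => w - p)%C x.
Proof. apply hol_minus. apply hol_id. apply hol_const. Qed.

(** Cancelling [w - x], legitimate off [x], extends to [x] by continuity. *)
Lemma cancel_factor u v x : holomorphic_on unit_disc u -> holomorphic_on unit_disc v -> unit_disc x ->
  (forall w, unit_disc w -> ((w - x) * u w = (w - x) * v w)%C) -> forall w, unit_disc w -> u w = v w.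
Proof.
  intros Hu Hv Hx E w Hw. rewrite holomorphic_on_iff in *.
  assert (Off : forall w, unit_disc w -> w <> x -> u w = v w).
  { intros y Hy N. apply (Cmult_cancel_l (y - x)%C); auto. now apply Cminus_eq_contra. }
  destruct (Ceq_dec w x) as [->|N]; auto.
  destruct (open_C _ _ unit_disc_open Hx) as [d [Hd Hd']].
  apply (cont_unique u v x d); auto; apply hol_at_cont; auto.
Qed.

Lemma vanishes_0 f x k : unit_disc x -> vanishes_to_order f x (S k) -> f x = 0%C.
Proof. intros Hx [g [_ E]]. rewrite E, Cpow_S by auto. replace (x - x)%C with (RtoC 0) by ring. ring. Qed.

(** Each zero can be divided out by its Blaschke factor without losing the bound 1, and
    the factor for [a] has modulus [|a|] at 0. *)
Lemma blaschke_zeros (l : list C) : forall F, holomorphic_on unit_disc F ->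
  (forall x, unit_disc x -> Cmod (F x) <= 1) ->
  (forall x, In x l -> unit_disc x /\ vanishes_to_order F x (count_occ Ceq_dec l x)) ->
  Cmod (F 0) <= Rprod (map Cmod l).
Proof.
  induction l as [|a l IH]; intros F HF H1 Hl.
  - apply H1, unit_disc_0.
  - destruct (Hl a (or_introl eq_refl)) as [Ha Va].
    assert (Va' := Va). rewrite count_occ_cons_eq in Va' by auto. apply vanishes_0 in Va'; auto.
    destruct (blaschke_divide F a HF H1 Ha Va') as [G [HG [G1 E]]].
    simpl. rewrite E, Cmod_mult, blaschke_0_r by apply unit_disc_0.
    apply Rmult_le_compat_l. apply Cmod_ge_0. apply IH; auto.
    intros x Hx. destruct (Hl x (or_intror Hx)) as [Dx Vx]. split; auto.
    assert (K : exists h, holomorphic_on unit_disc h /\ forall w, unit_disc w ->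
       F w = ((w - a) * ((w - x) ^ count_occ Ceq_dec l x * h w))%C).
    { destruct (Ceq_dec a x) as [<-|N].
      - rewrite count_occ_cons_eq in Vx by auto. destruct Vx as [h [Hh Eh]]. exists h. split; auto.
        intros w Hw. rewrite Eh by auto. rewrite Cpow_S. ring.
      - rewrite count_occ_cons_neq in Vx by auto. destruct Vx as [h [Hh Eh]].
        assert (h0 : h a = 0%C).
        { apply NNPP. intros Z. rewrite Eh in Va' by auto.
          apply (Cmult_neq_0 ((a - x) ^ count_occ Ceq_dec l x)%C (h a)); auto.
          apply Cpow_nz. now apply Cminus_eq_contra. }
        destruct (divide_zero unit_disc h a unit_disc_open Hh Ha h0) as [h' [Hh' [E' _]]].
        exists h'. split; auto. intros w Hw. rewrite Eh, E' by auto. ring. }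
    destruct K as [h [Hh Eh]]. set (k := count_occ Ceq_dec l x) in *.
    assert (Hden : forall w, hol_at (fun w => - (1 - Cconj a * w))%C w).
    { intros w. apply hol_opp, hol_minus. apply hol_const. apply hol_mult. apply hol_const. apply hol_id. }
    exists (fun w => - (1 - Cconj a * w) * h w)%C. split.
    + rewrite holomorphic_on_iff in *. intros w Hw. apply hol_mult; auto.
    + apply (cancel_factor G (fun w => (w - x) ^ k * (- (1 - Cconj a * w) * h w))%C a); auto.
      * rewrite holomorphic_on_iff in *. intros w Hw. apply hol_mult.
        apply (hol_pow (fun w => w - x)%C). apply hol_sub_const. apply hol_mult; auto.
      * intros w Hw. unfold unit_disc in *.
        assert (Nz := blaschke_den_neq a w Ha ltac:(lra)).
        replace ((w - a) * ((w - x) ^ k * (- (1 - Cconj a * w) * h w)))%C with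
          (- (1 - Cconj a * w) * ((w - a) * ((w - x) ^ k * h w)))%C by ring.
        rewrite <- Eh, E by auto. unfold blaschke. field. auto.
Qed.
(** * Lifting through a holomorphic covering by the disc *)

(** Connectedness of the unit interval, by bisection of a square in which the second
    coordinate is idle. *)
Lemma interval_connected (T : R -> Prop) :
  (forall t, 0 <= t <= 1 -> exists d, 0 < d /\ forall t' t'', 0 <= t' <= 1 -> 0 <= t'' <= 1 ->
     Rabs (t' - t) < d -> Rabs (t'' - t) < d -> T t' -> T t'') ->
  T 0 -> T 1.
Proof.
  intros H.
  assert (K : forall t' t'', 0 <= t' <= 0 + 1 -> 0 <= t'' <= 0 + 1 -> T t' -> T t'').
  { apply (square_bisection (fun a b _ _ => forall t' t'', a <= t' <= b -> a <= t'' <= b -> T t' -> T t'') 0 0 1).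
    - lra.
    - intros a m b _ _ Hm _ H1 H2 t' t'' Ht' Ht'' HT.
      assert (Tm : T m).
      { destruct (Rle_or_lt t' m); [apply (H1 t')|apply (H2 t')]; auto; lra. }
      destruct (Rle_or_lt t'' m); [apply (H1 m)|apply (H2 m)]; auto; lra.
    - intros; eauto.
    - intros u v Hu _. destruct (H u) as [d [Hd Hd']]. lra. exists d. split; auto.
      intros a c h Hh A1 A2 _ _ Hua _ t' t'' Ht' Ht''. apply Hd'; try lra; apply Rabs_def1; lra. }
  apply K; lra.
Qed.

Definition convex (E : C -> Prop) : Prop :=
  forall x y t, E x -> E y -> 0 <= t <= 1 -> E (x + RtoC t * (y - x))%C.

Lemma disc_convex r : convex (fun w => Cmod w <= r).
Proof.
  intros x y t Hx Hy Ht. cbv beta in *.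
  replace (x + RtoC t * (y - x))%C with (RtoC (1 - t) * x + RtoC t * y)%C by (rewrite RtoC_minus; ring).
  eapply Rle_trans. apply Cmod_triangle. rewrite !Cmod_mult, !Cmod_RtoC_pos by lra. nra.
Qed.

Lemma unit_disc_convex : convex unit_disc.
Proof.
  intros x y t Hx Hy Ht. unfold unit_disc in *.
  set (r := Rmax (Cmod x) (Cmod y)).
  apply Rle_lt_trans with r.
  - apply (disc_convex r); auto. apply Rmax_l. apply Rmax_r.
  - unfold r. now apply Rmax_lub_lt.
Qed.

(** The continuous local inverses of the covering are holomorphic by
    [inverse_holomorphic]. *)
Lemma covering_sheets D pi y : holomorphic_covering unit_disc D pi -> D y ->
  exists (V : C -> Prop) (I : Type) (S : I -> C -> Prop) (s : I -> C -> C),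
    open V /\ V y /\
    (forall i, open (S i)) /\ (forall i j x, S i x -> S j x -> i = j) /\
    (forall x, unit_disc x -> V (pi x) -> exists i, S i x) /\
    (forall i v, V v -> S i (s i v) /\ unit_disc (s i v) /\ pi (s i v) = v) /\
    (forall i x, S i x -> s i (pi x) = x) /\
    (forall i v, V v -> hol_at (s i) v).
Proof.
  intros [[Hpi _] [_ Hc]] Hy. destruct (Hc y Hy) as [V [HV [Vy [_ [I [S [s [H1 [H2 [H3 [H4 [H5 H6]]]]]]]]]]]].
  exists V, I, S, s. split; [auto|]. split; [auto|]. split; [auto|]. split; [auto|].
  split. { intros x Hx Hv. apply H3. auto. }
  split. { intros i v Hv. destruct (H5 i v Hv) as [A B]. split; auto. split; auto.
    apply H3. now exists i. }
  split; [auto|].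
  intros i v Hv. apply (inverse_holomorphic (S i) V pi (s i)); auto.
  - intros x Hx. apply Hpi. apply H3. now exists i.
  - intros x Hx. split; auto. apply H3. now exists i.
  - intros w Hw. apply cont_of_cont_in with V; auto. apply continuous_on_C; auto.
Qed.

Definition is_lift (pi : C -> C) (E : C -> Prop) (phi psi : C -> C) : Prop :=
  forall w, E w -> unit_disc (psi w) /\ pi (psi w) = phi w /\ cont_in E psi w.

(** Along a segment in [E], the parameters at which two lifts agree form an open and closed
    set, because distinct sheets are disjoint and open. *)
Lemma lift_unique D pi E phi a b w0 w : holomorphic_covering unit_disc D pi -> convex E ->
  (forall x, E x -> D (phi x) /\ cont_in E phi x) ->
  is_lift pi E phi a -> is_lift pi E phi b -> E w0 -> E w -> a w0 = b w0 -> a w = b w.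
Proof.
  intros Hcov HE Hphi Ha Hb H0 Hw Eq.
  set (c := fun t => (w0 + RtoC t * (w - w0))%C).
  assert (Hc : forall t, 0 <= t <= 1 -> E (c t)) by (intros; apply HE; auto).
  assert (Cc : forall t t', Cmod (c t' - c t) = Rabs (t' - t) * Cmod (w - w0)).
  { intros t t'. unfold c. replace (w0 + t' * (w - w0) - (w0 + t * (w - w0)))%C with (RtoC (t' - t) * (w - w0))%C.
    now rewrite Cmod_mult, Cmod_R. rewrite RtoC_minus. ring. }
  enough (T : a (c 1) = b (c 1)).
  { unfold c in T. replace (w0 + 1 * (w - w0))%C with w in T by ring. exact T. }
  apply (interval_connected (fun t => a (c t) = b (c t))).
  2: { unfold c. replace (w0 + 0 * (w - w0))%C with w0 by ring. exact Eq. }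
  intros t Ht. set (p := c t). assert (Hp : E p) by now apply Hc.
  destruct (Hphi p Hp) as [Dp Cp].
  destruct (covering_sheets D pi (phi p) Hcov Dp) as [V [I [S [s [HV [Vp [S1 [S2 [S3 [S4 [S5 _]]]]]]]]]]].
  destruct (Ha p Hp) as [A1 [A2 A3]]. destruct (Hb p Hp) as [B1 [B2 B3]].
  destruct (S3 (a p) A1) as [i Hi]. now rewrite A2. destruct (S3 (b p) B1) as [j Hj]. now rewrite B2.
  destruct (open_C _ _ HV Vp) as [e1 [E1 E1']]. destruct (Cp e1 E1) as [d1 [D1 D1']].
  destruct (open_C _ _ (S1 i) Hi) as [e2 [E2 E2']]. destruct (A3 e2 E2) as [d2 [D2 D2']].
  destruct (open_C _ _ (S1 j) Hj) as [e3 [E3 E3']]. destruct (B3 e3 E3) as [d3 [D3 D3']].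
  set (L := Cmod (w - w0) + 1). assert (HL : 0 < L) by (unfold L; assert (X := Cmod_ge_0 (w - w0)); lra).
  set (d := Rmin d1 (Rmin d2 d3)). assert (Hd : 0 < d) by (repeat apply Rmin_glb_lt; auto).
  assert (M1 : d <= d1) by apply Rmin_l.
  assert (M2 : d <= d2) by (eapply Rle_trans; [apply Rmin_r|apply Rmin_l]).
  assert (M3 : d <= d3) by (eapply Rle_trans; [apply Rmin_r|apply Rmin_r]).
  exists (d / L). split. now apply Rdiv_lt_0_compat.
  assert (Near : forall t', 0 <= t' <= 1 -> Rabs (t' - t) < d / L ->
    V (phi (c t')) /\ S i (a (c t')) /\ S j (b (c t'))).
  { intros t' Ht' Hd'. assert (K : Cmod (c t' - p) < d).
    { unfold p. rewrite Cc. apply Rle_lt_trans with (Rabs (t' - t) * L).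
      apply Rmult_le_compat_l. apply Rabs_pos. unfold L. lra. apply Rlt_div_r in Hd'; auto. }
    split; [apply E1', D1'|split; [apply E2', D2'|apply E3', D3']]; auto; lra. }
  intros t' t'' Ht' Ht'' Hd' Hd'' Eq'.
  destruct (Near t' Ht' Hd') as [_ [N2 N3]]. destruct (Near t'' Ht'' Hd'') as [_ [N2' N3']].
  rewrite <- Eq' in N3. assert (Eij := S2 i j _ N2 N3). subst j.
  rewrite <- (S5 i _ N2'), <- (S5 i _ N3').
  destruct (Ha _ (Hc t'' Ht'')) as [_ [-> _]]. destruct (Hb _ (Hc t'' Ht'')) as [_ [-> _]]. reflexivity.
Qed.

(** The value is prescribed at an arbitrary base point, so that lifts on adjacent pieces
    can be matched at a common point. *)
Definition liftable (pi : C -> C) (phi : C -> C) (E : C -> Prop) : Prop :=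
  forall w0 x0, E w0 -> unit_disc x0 -> pi x0 = phi w0 ->
    exists psi, is_lift pi E phi psi /\ psi w0 = x0.

Definition closed_set (E : C -> Prop) : Prop :=
  forall x, ~ E x -> exists d, 0 < d /\ forall y, Cmod (y - x) < d -> ~ E y.

Lemma liftable_ext pi phi E E' : (forall x, E x <-> E' x) -> liftable pi phi E -> liftable pi phi E'.
Proof.
  intros H L w0 x0 H0 Hx0 Ex. destruct (L w0 x0) as [psi [P Q]]; auto. now apply H.
  exists psi. split; auto. intros w Hw. apply H in Hw. destruct (P w Hw) as [A [B Cw]].
  split; auto. split; auto. intros e He. destruct (Cw e He) as [d [Hd Hd']]. exists d. split; auto.
  intros y Hy. apply Hd'. now apply H.
Qed.

(** Lifts on [E1] and [E2] that agree at [e] agree on the convex set where both are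
    defined, hence glue to a lift on the union. *)
Lemma liftable_union D pi phi E1 E2 e : holomorphic_covering unit_disc D pi ->
  (forall x, D (phi x) /\ cont phi x) ->
  closed_set E1 -> closed_set E2 -> convex (fun x => E1 x /\ E2 x) -> E1 e -> E2 e ->
  liftable pi phi E1 -> liftable pi phi E2 -> liftable pi phi (fun x => E1 x \/ E2 x).
Proof.
  intros Hcov Hphi.
  assert (Half : forall E1 E2 : C -> Prop, closed_set E1 -> closed_set E2 -> convex (fun x => E1 x /\ E2 x) -> E1 e -> E2 e ->
    liftable pi phi E1 -> liftable pi phi E2 -> forall w0 x0, E1 w0 -> unit_disc x0 -> pi x0 = phi w0 ->
    exists psi, is_lift pi (fun x => E1 x \/ E2 x) phi psi /\ psi w0 = x0).
  { clear E1 E2. intros E1 E2 C1 C2 Cv e1 e2 L1 L2 w0 x0 H0 Hx0 Ex.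
    destruct (L1 w0 x0 H0 Hx0 Ex) as [p1 [P1 Q1]].
    destruct (P1 e e1) as [A1 [A2 _]]. destruct (L2 e (p1 e) e2 A1 A2) as [p2 [P2 Q2]].
    set (psi := fun w => if excluded_middle_informative (E1 w) then p1 w else p2 w).
    assert (F1 : forall w, E1 w -> psi w = p1 w).
    { intros w Hw. unfold psi. now destruct excluded_middle_informative. }
    assert (F2 : forall w, E2 w -> psi w = p2 w).
    { intros w Hw. unfold psi. destruct excluded_middle_informative as [Hw1|]; auto.
      apply (lift_unique D pi (fun x => E1 x /\ E2 x) phi p1 p2 e w); auto.
      - intros x Hx. split. apply Hphi. apply cont_in_of_cont, Hphi.
      - intros x [X1 X2]. destruct (P1 x X1) as [B1 [B2 B3]]. split; auto. split; auto.
        intros eps He. destruct (B3 eps He) as [d [Hd Hd']]. exists d. split; auto. intros y [Y _]. auto.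
      - intros x [X1 X2]. destruct (P2 x X2) as [B1 [B2 B3]]. split; auto. split; auto.
        intros eps He. destruct (B3 eps He) as [d [Hd Hd']]. exists d. split; auto. intros y [_ Y]. auto. }
    exists psi. split; [|rewrite F1; auto].
    intros w Hw. split; [|split].
    - destruct Hw as [Hw|Hw]. rewrite F1 by auto. now apply P1. rewrite F2 by auto. now apply P2.
    - destruct Hw as [Hw|Hw]. rewrite F1 by auto. now apply P1. rewrite F2 by auto. now apply P2.
    - intros eps He.
      assert (N1 : exists d, 0 < d /\ forall y, E1 y -> Cmod (y - w) < d -> Cmod (psi y - psi w) < eps).
      { destruct (classic (E1 w)) as [X|X].
        - destruct (P1 w X) as [_ [_ Cw]]. destruct (Cw eps He) as [d [Hd Hd']]. exists d. split; auto.
          intros y Hy Hyd. rewrite !F1 by auto. auto.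
        - destruct (C1 w X) as [d [Hd Hd']]. exists d. split; auto. intros y Hy Hyd. now destruct (Hd' y Hyd). }
      assert (N2 : exists d, 0 < d /\ forall y, E2 y -> Cmod (y - w) < d -> Cmod (psi y - psi w) < eps).
      { destruct (classic (E2 w)) as [X|X].
        - destruct (P2 w X) as [_ [_ Cw]]. destruct (Cw eps He) as [d [Hd Hd']]. exists d. split; auto.
          intros y Hy Hyd. rewrite !F2 by auto. auto.
        - destruct (C2 w X) as [d [Hd Hd']]. exists d. split; auto. intros y Hy Hyd. now destruct (Hd' y Hyd). }
      destruct N1 as [d1 [D1 D1']]. destruct N2 as [d2 [D2 D2']].
      exists (Rmin d1 d2). split. now apply Rmin_glb_lt.
      assert (M1 := Rmin_l d1 d2). assert (M2 := Rmin_r d1 d2).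
      intros y [Hy|Hy] Hyd; [apply D1'|apply D2']; auto; lra. }
  intros C1 C2 Cv e1 e2 L1 L2 w0 x0 [H0|H0] Hx0 Ex.
  - apply (Half E1 E2); auto.
  - destruct (Half E2 E1) with (w0 := w0) (x0 := x0) as [psi [P Q]]; auto.
    { intros x y t [X1 X2] [Y1 Y2] Ht. destruct (Cv x y t); auto. }
    exists psi. split; auto. intros w Hw. destruct (P w) as [A [B Cw]]. tauto.
    split; auto. split; auto. intros eps He. destruct (Cw eps He) as [d [Hd Hd']].
    exists d. split; auto. intros y Hy. apply Hd'. tauto.
Qed.

Definition rectangle (a b c d : R) (w : C) : Prop := a <= fst w <= b /\ c <= snd w <= d.

Lemma rectangle_closed a b c d : closed_set (rectangle a b c d).
Proof.
  intros x Hx.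
  assert (H : fst x < a \/ b < fst x \/ snd x < c \/ d < snd x).
  { destruct (Rlt_or_le (fst x) a); auto. destruct (Rlt_or_le b (fst x)); auto.
    destruct (Rlt_or_le (snd x) c); auto. destruct (Rlt_or_le d (snd x)); auto.
    exfalso. apply Hx. unfold rectangle. lra. }
  assert (K : forall e y, Cmod (y - x) < e -> - e < fst y - fst x < e /\ - e < snd y - snd x < e).
  { intros e y Hy. assert (A := Re_le_Cmod (y - x)%C). assert (B := Im_le_Cmod (y - x)%C). simpl in A, B.
    assert (A' : Rabs (fst y - fst x) < e) by (unfold Rminus; lra).
    assert (B' : Rabs (snd y - snd x) < e) by (unfold Rminus; lra).
    apply Rabs_def2 in A', B'. lra. }
  destruct H as [H|[H|[H|H]]].
  - exists (a - fst x). split. lra. intros y Hy [Y1 Y2]. apply K in Hy. lra.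
  - exists (fst x - b). split. lra. intros y Hy [Y1 Y2]. apply K in Hy. lra.
  - exists (c - snd x). split. lra. intros y Hy [Y1 Y2]. apply K in Hy. lra.
  - exists (snd x - d). split. lra. intros y Hy [Y1 Y2]. apply K in Hy. lra.
Qed.

Lemma rectangle_convex a b c d : convex (rectangle a b c d).
Proof.
  intros x y t [X1 X2] [Y1 Y2] Ht. unfold rectangle. simpl. split; nra.
Qed.

Lemma convex_inter E1 E2 : convex E1 -> convex E2 -> convex (fun x => E1 x /\ E2 x).
Proof. intros H1 H2 x y t [X1 X2] [Y1 Y2] Ht. split; [apply H1|apply H2]; auto. Qed.

(** Small squares map into evenly covered sets, where a sheet gives the lift; the gluing of
    lifts along edges makes liftability accessible to bisection. *)
Lemma liftable_square D pi phi x0 y0 h : holomorphic_covering unit_disc D pi ->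
  (forall x, D (phi x) /\ cont phi x) -> 0 < h ->
  liftable pi phi (rectangle x0 (x0 + h) y0 (y0 + h)).
Proof.
  intros Hcov Hphi Hh.
  apply (square_bisection (fun a b c d => liftable pi phi (rectangle a b c d))); auto.
  - intros a m b c d Hm Hc L1 L2.
    apply liftable_ext with (fun x => rectangle a m c d x \/ rectangle m b c d x).
    { intros x. unfold rectangle. destruct (Rle_or_lt (fst x) m); split; lra. }
    apply (liftable_union D pi phi _ _ (m, c)); auto using rectangle_closed.
    apply convex_inter; apply rectangle_convex. split; simpl; lra. split; simpl; lra.
  - intros a b c m d Ha Hm L1 L2.
    apply liftable_ext with (fun x => rectangle a b c m x \/ rectangle a b m d x).
    { intros x. unfold rectangle. destruct (Rle_or_lt (snd x) m); split; lra. }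
    apply (liftable_union D pi phi _ _ (a, m)); auto using rectangle_closed.
    apply convex_inter; apply rectangle_convex. split; simpl; lra. split; simpl; lra.
  - intros u v _ _. set (p := (u, v) : C). destruct (Hphi p) as [Dp Cp].
    destruct (covering_sheets D pi (phi p) Hcov Dp) as [V [I [S [s [HV [Vp [S1 [S2 [S3 [S4 [S5 S6]]]]]]]]]]].
    destruct (open_C _ _ HV Vp) as [e1 [E1 E1']]. destruct (Cp e1 E1) as [d1 [D1 D1']].
    exists (d1 / 2). split. lra.
    intros a c k Hk _ _ _ _ Hu Hv w0 z0 Hw0 Hz0 Ez.
    assert (Near : forall w, rectangle a (a + k) c (c + k) w -> V (phi w)).
    { intros w [W1 W2]. apply E1', D1'. eapply Rle_lt_trans. apply Cmod_le_parts. simpl.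
      assert (Rabs (fst w + - u) <= k) by (apply Rabs_le; lra).
      assert (Rabs (snd w + - v) <= k) by (apply Rabs_le; lra). lra. }
    destruct (S3 z0 Hz0) as [i Hi]. { rewrite Ez. auto. }
    exists (fun w => s i (phi w)). split.
    + intros w Hw. destruct (S4 i _ (Near w Hw)) as [_ [A B]]. split; auto. split; auto.
      apply cont_in_of_cont. apply (cont_comp (s i)). apply Hphi. apply hol_at_cont, S6. auto.
    + rewrite <- Ez. auto.
Qed.

(** Composition with the radial retraction extends a map on the closed disc of radius [r] to
    the plane, where the lifting over squares applies. *)
Definition retract (r : R) (w : C) : C := (w * (RtoC r / RtoC (Rmax r (Cmod w))))%C.

Lemma retract_id r w : 0 < r -> Cmod w <= r -> retract r w = w.
Proof.
  intros Hr Hw. unfold retract. rewrite Rmax_left by auto.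
  assert (RtoC r <> 0%C) by (intros E; apply RtoC_inj in E; lra). field. auto.
Qed.

Lemma retract_le r w : 0 < r -> Cmod (retract r w) <= r.
Proof.
  intros Hr. assert (M1 := Rmax_l r (Cmod w)). assert (M2 := Rmax_r r (Cmod w)).
  unfold retract. set (m := Rmax r (Cmod w)) in *.
  rewrite Cmod_mult, Cmod_div, !Cmod_RtoC_pos by (try lra; intros E; apply RtoC_inj in E; lra).
  replace (Cmod w * (r / m)) with (r * (Cmod w / m)) by (field; lra).
  assert (Cmod w / m <= 1) by (apply Rle_div_l; lra). nra.
Qed.

Lemma retract_cont r w : 0 < r -> cont (retract r) w.
Proof.
  intros Hr. apply cont_mult. apply cont_id. apply cont_div. apply cont_const.
  - intros e He. exists e. split; auto. intros y Hy.
    rewrite <- RtoC_minus, Cmod_R.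
    assert (A := Cmod_le_add y w). assert (B := Cmod_le_add w y). rewrite Cmod_sub_sym in B.
    unfold Rmax. destruct (Rle_dec r (Cmod y)), (Rle_dec r (Cmod w)); apply Rabs_def1; lra.
  - assert (M := Rmax_l r (Cmod w)). intros E; apply RtoC_inj in E; lra.
Qed.

Lemma cont_in_subset (E E' : C -> Prop) f x : (forall y, E y -> E' y) -> cont_in E' f x -> cont_in E f x.
Proof. intros H K e He. destruct (K e He) as [d [Hd Hd']]. exists d. split; auto. Qed.

(** Lifts on the closed discs of radii [r < 1] agree with one another by uniqueness, so they
    define a lift on the open disc. *)
Lemma lift_continuous D pi phi w0 x0 : holomorphic_covering unit_disc D pi ->
  holomorphic_map unit_disc D phi -> unit_disc w0 -> unit_disc x0 -> pi x0 = phi w0 ->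
  exists psi, is_lift pi unit_disc phi psi /\ psi w0 = x0.
Proof.
  intros Hcov [Hphi Dphi] Hw0 Hx0 Ex. rewrite holomorphic_on_iff in Hphi.
  assert (Lr : forall r, exists psi, Cmod w0 < r < 1 ->
     is_lift pi (fun w => Cmod w <= r) phi psi /\ psi w0 = x0).
  { intros r. destruct (classic (Cmod w0 < r < 1)) as [Hr|Hr]; [|exists (fun w => w); tauto].
    assert (P0 := Cmod_ge_0 w0). assert (Hr0 : 0 < r) by lra.
    destruct (liftable_square D pi (fun w => phi (retract r w)) (-1) (-1) 2 Hcov) with (w0 := w0) (x0 := x0)
      as [psi [L E]]; auto; try lra.
    - intros x. assert (R1 := retract_le r x Hr0).
      assert (U : unit_disc (retract r x)) by (unfold unit_disc; lra).
      split. auto. apply (cont_comp phi). now apply retract_cont. now apply hol_at_cont, Hphi.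
    - assert (A := Re_le_Cmod w0). assert (B := Im_le_Cmod w0). unfold unit_disc in Hw0.
      assert (A' : Rabs (fst w0) <= 1) by lra. assert (B' : Rabs (snd w0) <= 1) by lra.
      apply Rabs_le_between in A', B'. unfold rectangle. lra.
    - rewrite retract_id by lra. auto.
    - exists psi. intros _. split; auto. intros w Hw.
      assert (Sub : forall y, Cmod y <= r -> rectangle (-1) (-1 + 2) (-1) (-1 + 2) y).
      { intros y Hy. assert (A := Re_le_Cmod y). assert (B := Im_le_Cmod y).
        assert (A' : Rabs (fst y) <= 1) by lra. assert (B' : Rabs (snd y) <= 1) by lra.
        apply Rabs_le_between in A', B'. unfold rectangle. lra. }
      destruct (L w (Sub w Hw)) as [A [B Cw]]. rewrite retract_id in B by auto.
      split; auto. split; auto. now apply cont_in_subset with (2 := Cw). }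
  set (F := fun r => proj1_sig (constructive_indefinite_description _ (Lr r))).
  assert (HF : forall r, Cmod w0 < r < 1 -> is_lift pi (fun w => Cmod w <= r) phi (F r) /\ F r w0 = x0).
  { intros r. unfold F. destruct constructive_indefinite_description as [p Hp]. exact Hp. }
  clearbody F. clear Lr. unfold unit_disc in Hw0.
  set (Rd := fun w => (1 + Rmax (Cmod w0) (Cmod w)) / 2).
  assert (HRd : forall w, Cmod w < 1 -> Cmod w0 < Rd w < 1 /\ Cmod w < Rd w).
  { intros w Hw. unfold Rd. assert (A := Rmax_l (Cmod w0) (Cmod w)). assert (B := Rmax_r (Cmod w0) (Cmod w)).
    assert (M : Rmax (Cmod w0) (Cmod w) < 1) by now apply Rmax_lub_lt. lra. }
  assert (Agree : forall r r' w, Cmod w0 < r < 1 -> Cmod w0 < r' < 1 -> Cmod w <= r -> Cmod w <= r' -> F r w = F r' w).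
  { intros r r' w Hr Hr' Wr Wr'.
    destruct (HF r Hr) as [L1 Q1]. destruct (HF r' Hr') as [L2 Q2].
    set (m := Rmin r r'). assert (M1 : m <= r) by apply Rmin_l. assert (M2 : m <= r') by apply Rmin_r.
    apply (lift_unique D pi (fun w => Cmod w <= m) phi (F r) (F r') w0 w); auto using disc_convex.
    - intros x Hx. assert (U : unit_disc x) by (unfold unit_disc; lra). split; auto.
      now apply cont_in_of_cont, hol_at_cont, Hphi.
    - intros x Hx. destruct (L1 x ltac:(lra)) as [A [B Cx]]. split; auto. split; auto.
      apply cont_in_subset with (2 := Cx). intros; lra.
    - intros x Hx. destruct (L2 x ltac:(lra)) as [A [B Cx]]. split; auto. split; auto.
      apply cont_in_subset with (2 := Cx). intros; lra.
    - apply Rmin_glb; lra.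
    - now apply Rmin_glb.
    - congruence. }
  exists (fun w => F (Rd w) w). split.
  - intros w Hw. destruct (HRd w Hw) as [H1 H2]. destruct (HF _ H1) as [L _].
    destruct (L w ltac:(lra)) as [A [B Cx]]. split; auto. split; auto.
    intros e He. destruct (Cx e He) as [d [Hd Hd']].
    exists (Rmin d (Rd w - Cmod w)). split. apply Rmin_glb_lt; lra.
    intros y Hy Hyd. assert (M1 := Rmin_l d (Rd w - Cmod w)). assert (M2 := Rmin_r d (Rd w - Cmod w)).
    destruct (HRd y Hy) as [Y1 Y2]. assert (T := Cmod_le_add y w).
    rewrite (Agree (Rd y) (Rd w) y) by (auto; lra). apply Hd'; lra.
  - destruct (HRd w0 Hw0) as [H1 H2]. apply HF; auto.
Qed.

(** Near each point a continuous lift is a holomorphic local inverse of the covering composed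
    with [phi]. *)
Lemma lift_exists D pi phi w0 x0 : holomorphic_covering unit_disc D pi ->
  holomorphic_map unit_disc D phi -> unit_disc w0 -> unit_disc x0 -> pi x0 = phi w0 ->
  exists psi, holomorphic_map unit_disc unit_disc psi /\ psi w0 = x0 /\
    forall w, unit_disc w -> pi (psi w) = phi w.
Proof.
  intros Hcov Hphi Hw0 Hx0 Ex.
  destruct (lift_continuous D pi phi w0 x0 Hcov Hphi Hw0 Hx0 Ex) as [psi [L E]].
  destruct Hphi as [Hphi Dphi]. rewrite holomorphic_on_iff in Hphi.
  exists psi. split; [split|split]; auto; try (intros w Hw; now apply L).
  apply holomorphic_on_iff. intros w Hw. destruct (L w Hw) as [A [B Cw]].
  apply cont_of_cont_in in Cw; auto using unit_disc_open.
  destruct (covering_sheets D pi (phi w) Hcov (Dphi w Hw)) as [V [I [S [s [HV [Vp [S1 [S2 [S3 [S4 [S5 S6]]]]]]]]]]].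
  destruct (S3 (psi w) A) as [i Hi]. now rewrite B.
  destruct (open_C _ _ (S1 i) Hi) as [e [He He']]. destruct (Cw e He) as [d [Hd Hd']].
  destruct (open_C _ _ unit_disc_open Hw) as [d2 [Hd2 Hd2']].
  apply hol_at_ext_loc with (fun w => s i (phi w)) (Rmin d d2). now apply Rmin_glb_lt.
  - intros y Hy. assert (M1 := Rmin_l d d2). assert (M2 := Rmin_r d d2).
    destruct (L y) as [_ [By _]]. apply Hd2'; lra. rewrite <- By. apply S5, He', Hd'. lra.
  - apply (hol_comp (s i)); auto.
Qed.

Lemma holomorphic_lift_unique D pi a b w0 : holomorphic_covering unit_disc D pi ->
  holomorphic_map unit_disc unit_disc a -> holomorphic_map unit_disc unit_disc b ->
  (forall w, unit_disc w -> pi (a w) = pi (b w)) ->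
  unit_disc w0 -> a w0 = b w0 -> forall w, unit_disc w -> a w = b w.
Proof.
  intros Hcov [Ha Da] [Hb Db] E Hw0 E0 w Hw. rewrite holomorphic_on_iff in Ha, Hb.
  apply (lift_unique D pi unit_disc (fun w => pi (b w)) a b w0 w); auto using unit_disc_convex.
  - intros x Hx. destruct Hcov as [[Hpi Dpi] _]. rewrite holomorphic_on_iff in Hpi. split. auto.
    apply cont_in_of_cont. apply (cont_comp pi b). now apply hol_at_cont, Hb. now apply hol_at_cont, Hpi, Db.
  - intros x Hx. split; auto. split; auto. now apply cont_in_of_cont, hol_at_cont, Ha.
  - intros x Hx. split; auto. split; auto. now apply cont_in_of_cont, hol_at_cont, Hb.
Qed.

(** A sheet contains at most one point of the fibre, so every point has a neighbourhood with
    at most one point of the fibre, and bisection collects finite lists. *)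
Lemma fibre_locally_finite D pi a r : holomorphic_covering unit_disc D pi -> r < 1 ->
  exists l : list C, forall x, Cmod x <= r -> pi x = a -> In x l.
Proof.
  intros Hcov Hr.
  assert (K : exists l : list C, forall x, rectangle (-1) (-1 + 2) (-1) (-1 + 2) x -> Cmod x <= r -> pi x = a -> In x l).
  { apply (square_bisection (fun u v u' v' => exists l : list C, forall x, rectangle u v u' v' x -> Cmod x <= r -> pi x = a -> In x l)).
    - lra.
    - intros u m v u' v' _ _ [l1 H1] [l2 H2]. exists (l1 ++ l2). intros x [X1 X2] Hx Ex. apply in_or_app.
      destruct (Rle_or_lt (fst x) m); [left; apply H1|right; apply H2]; auto; unfold rectangle; lra.
    - intros u v u' m v' _ _ [l1 H1] [l2 H2]. exists (l1 ++ l2). intros x [X1 X2] Hx Ex. apply in_or_app.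
      destruct (Rle_or_lt (snd x) m); [left; apply H1|right; apply H2]; auto; unfold rectangle; lra.
    - intros u v _ _. set (p := (u, v) : C).
      assert (Near : exists d l, 0 < d /\ forall x, Cmod (x - p) < d -> Cmod x <= r -> pi x = a -> In x l).
      { destruct (Rle_or_lt (Cmod p) r) as [L|L].
        - assert (Up : unit_disc p) by (unfold unit_disc; lra). assert (Hc := Hcov). destruct Hc as [[Hpi Dpi] _].
          rewrite holomorphic_on_iff in Hpi.
          destruct (Ceq_dec (pi p) a) as [E|N].
          + destruct (covering_sheets D pi (pi p) Hcov (Dpi p Up)) as [V [I [S [s [HV [Vp [S1 [S2 [S3 [S4 [S5 S6]]]]]]]]]]].
            destruct (S3 p Up Vp) as [i Hi]. destruct (open_C _ _ (S1 i) Hi) as [d [Hd Hd']].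
            exists d, (p :: nil). split; auto. intros x Hx _ Ex. left.
            rewrite <- (S5 i p Hi), <- (S5 i x (Hd' x Hx)). congruence.
          + destruct (hol_at_cont _ _ (Hpi p Up) (Cmod (pi p - a))) as [d [Hd Hd']]. now apply Cmod_sub_pos.
            exists d, nil. split; auto. intros x Hx _ Ex. specialize (Hd' x Hx). rewrite Ex, Cmod_sub_sym in Hd'. lra.
        - exists (Cmod p - r), nil. split. lra. intros x Hx Hxr. exfalso.
          assert (T := Cmod_le_add p x). rewrite Cmod_sub_sym in T. lra. }
      destruct Near as [d [l [Hd Hl]]]. exists (d / 2). split. lra.
      intros b c k Hk _ _ _ _ Hu Hv. exists l. intros x [X1 X2]. apply Hl.
      eapply Rle_lt_trans. apply Cmod_le_parts. simpl.
      assert (Rabs (fst x + - u) <= k) by (apply Rabs_le; lra).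
      assert (Rabs (snd x + - v) <= k) by (apply Rabs_le; lra). lra. }
  destruct K as [l Hl]. exists l. intros x Hx. apply Hl; auto.
  assert (A := Re_le_Cmod x). assert (B := Im_le_Cmod x).
  assert (A' : Rabs (fst x) <= 1) by lra. assert (B' : Rabs (snd x) <= 1) by lra.
  apply Rabs_le_between in A', B'. unfold rectangle. lra.
Qed.
(** * Coverings of domains that are not simply connected have infinite fibres *)

(** The local inverses show that the inverse of an injective covering is continuous;
    loops are then carried to the disc and contracted along segments. *)
Lemma simply_connected_of_injective D pi : holomorphic_covering unit_disc D pi ->
  (forall x y, unit_disc x -> unit_disc y -> pi x = pi y -> x = y) -> simply_connected D.
Proof.
  intros Hcov Hinj g [Gc [Gd G01]].
  assert (Hc := Hcov). destruct Hc as [[Hpi Dpi] [Sur _]]. rewrite holomorphic_on_iff in Hpi.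
  assert (Ex : forall y, exists x, D y -> unit_disc x /\ pi x = y).
  { intros y. destruct (classic (D y)) as [Dy|Dy]. destruct (Sur y Dy) as [x Hx]. now exists x.
    exists (RtoC 0). tauto. }
  set (inv := fun y => proj1_sig (constructive_indefinite_description _ (Ex y))).
  assert (Hinv : forall y, D y -> unit_disc (inv y) /\ pi (inv y) = y).
  { intros y. unfold inv. destruct constructive_indefinite_description as [x Hx]. exact Hx. }
  clearbody inv. clear Ex.
  assert (Cinv : forall y, D y -> cont_in D inv y).
  { intros y Dy. destruct (Hinv y Dy) as [I1 I2].
    destruct (covering_sheets D pi y Hcov Dy) as [V [I [S [s [HV [Vp [S1 [S2 [S3 [S4 [S5 S6]]]]]]]]]]].
    destruct (S3 (inv y) I1) as [i Hi]. now rewrite I2.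
    assert (K : forall y', D y' -> V y' -> inv y' = s i y').
    { intros y' Dy' Vy'. destruct (S4 i y' Vy') as [_ [A B]]. destruct (Hinv y' Dy') as [A' B'].
      apply Hinj; auto. congruence. }
    intros e He. destruct (hol_at_cont _ _ (S6 i y Vp) e He) as [d [Hd Hd']].
    destruct (open_C _ _ HV Vp) as [d2 [Hd2 Hd2']]. exists (Rmin d d2). split. now apply Rmin_glb_lt.
    intros y' Dy' Hy'. assert (M1 := Rmin_l d d2). assert (M2 := Rmin_r d d2).
    rewrite !K; auto. apply Hd'. lra. apply Hd2'. lra. }
  set (h := fun t => inv (g t)).
  assert (Uh : forall t, unit_interval t -> unit_disc (h t) /\ pi (h t) = g t).
  { intros t Ht. apply Hinv. auto. }
  assert (Ch : forall t e, unit_interval t -> 0 < e -> exists d, 0 < d /\ forall t', unit_interval t' ->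
     Rabs (t' - t) < d -> Cmod (h t' - h t) < e).
  { intros t e Ht He. destruct (Cinv (g t) (Gd t Ht) e He) as [d [Hd Hd']].
    assert (L : locally (g t) (fun u => Cmod (u - g t) < d)) by (apply locally_C; exists d; auto).
    specialize (Gc t Ht _ L). destruct Gc as [d2 Hd2]. exists d2. split. apply cond_pos.
    intros t' Ht' Hlt. apply Hd'. auto. apply Hd2; auto. }
  assert (I0 : unit_interval 0) by (unfold unit_interval; lra).
  assert (I1 : unit_interval 1) by (unfold unit_interval; lra).
  exists (fun p => pi (h (snd p) + RtoC (fst p) * (h 0 - h (snd p)))%C).
  assert (Um : forall p, unit_square p -> unit_disc (h (snd p) + RtoC (fst p) * (h 0 - h (snd p)))%C).
  { intros p [Hs Ht]. apply unit_disc_convex; auto. now apply Uh. now apply Uh. }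
  split; [|split; [|split; [|split]]].
  - intros p Hp P HP. apply locally_C in HP. destruct HP as [e [He HP]].
    destruct (hol_at_cont _ _ (Hpi _ (Um p Hp)) e He) as [d [Hd Hd']].
    destruct Hp as [Hs Ht]. destruct p as [s t]. cbn [fst snd] in *.
    destruct (Ch t (d / 4) Ht) as [d2 [Hd2 Hd2']]. lra.
    assert (Hm : 0 < Rmin d2 (d / 8)) by (apply Rmin_glb_lt; lra).
    exists (mkposreal _ Hm). intros [s' t'] [B1 B2] [Hs' Ht']. cbn [fst snd] in *.
    change (Rabs (s' - s) < Rmin d2 (d / 8)) in B1. change (Rabs (t' - t) < Rmin d2 (d / 8)) in B2.
    assert (M1 := Rmin_l d2 (d / 8)). assert (M2 := Rmin_r d2 (d / 8)).
    apply HP, Hd'. specialize (Hd2' t' Ht' ltac:(lra)).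
    replace (h t' + s' * (h 0 - h t') - (h t + s * (h 0 - h t)))%C with
      (RtoC (1 - s') * (h t' - h t) + RtoC (s' - s) * (h 0 - h t))%C by (rewrite !RtoC_minus; ring).
    eapply Rle_lt_trans. apply Cmod_triangle. rewrite !Cmod_mult, !Cmod_R.
    assert (K1 : Rabs (1 - s') <= 1) by (destruct Hs'; apply Rabs_le; lra).
    assert (K2 : Cmod (h 0 - h t) <= 2).
    { destruct (Uh 0 I0) as [A _]. destruct (Uh t Ht) as [B _]. unfold unit_disc in *.
      assert (T := Cmod_triangle (h 0) (- h t)). rewrite Cmod_opp in T. change (h 0 - h t)%C with (h 0 + - h t)%C. lra. }
    assert (P1 := Cmod_ge_0 (h t' - h t)). assert (P2 := Rabs_pos (s' - s)). assert (P3 := Rabs_pos (1 - s')). nra.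
  - intros p Hp. apply Dpi. auto.
  - intros t Ht. cbn [fst snd]. replace (h t + 0 * (h 0 - h t))%C with (h t) by ring. now apply Uh.
  - intros t Ht. cbn [fst snd]. replace (h t + 1 * (h 0 - h t))%C with (h 0) by ring. now apply Uh.
  - intros s Hs. cbn [fst snd].
    assert (E : h 1 = h 0) by (unfold h; now rewrite G01).
    rewrite E. replace (h 0 + s * (h 0 - h 0))%C with (h 0) by ring.
    split; now apply Uh.
Qed.

(** For the hyperbolic distance [d], this is [sinh (d / 2) ^ 2]. *)
Definition hyp (x y : C) : R :=
  Cmod (x - y) * Cmod (x - y) / ((1 - Cmod x * Cmod x) * (1 - Cmod y * Cmod y)).

Definition defect (x : C) : R := 1 - Cmod x * Cmod x.

Lemma defect_pos x : unit_disc x -> 0 < defect x.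
Proof. unfold unit_disc, defect. intros H. assert (P := Cmod_ge_0 x). nra. Qed.

(** As [hyp] is an increasing function of the pseudo-hyperbolic distance, this is the
    Schwarz-Pick lemma. *)
Lemma hyp_contract psi x y : holomorphic_map unit_disc unit_disc psi -> unit_disc x -> unit_disc y ->
  hyp (psi x) (psi y) <= hyp x y.
Proof.
  intros H Hx Hy. assert (S := schwarz_pick psi x y H Hx Hy).
  assert (A := defect_pos _ Hx). assert (B := defect_pos _ Hy). destruct H as [_ Hm].
  assert (A' := defect_pos _ (Hm _ Hx)). assert (B' := defect_pos _ (Hm _ Hy)).
  unfold hyp, defect in *.
  set (N := Cmod (psi x - psi y) * Cmod (psi x - psi y)) in *. set (M := Cmod (x - y) * Cmod (x - y)) in *.
  set (P := (1 - Cmod x * Cmod x) * (1 - Cmod y * Cmod y)) in *.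
  set (P' := (1 - Cmod (psi x) * Cmod (psi x)) * (1 - Cmod (psi y) * Cmod (psi y))) in *.
  assert (HP : 0 < P) by (unfold P; apply Rmult_lt_0_compat; lra).
  assert (HP' : 0 < P') by (unfold P'; apply Rmult_lt_0_compat; lra).
  clearbody N M P P'.
  apply (proj1 (Rle_div_r (N / P') M P HP)).
  replace (N / P' * P) with ((N * P) / P') by (field; lra).
  apply Rle_div_l; lra.
Qed.

Fixpoint hyp_sum (l : list C) (x : C) : R :=
  match l with nil => 0 | p :: l => hyp x p + hyp_sum l x end.

(** In the hyperboloid model [1 + 2 * hyp x p] is the Minkowski product of the vectors
    representing [x] and [p], hence linear in the latter; [(a, b)] is the sum of the
    vectors that represent the points of [l], and it is again timelike. *)
Lemma hyp_sum_form (l : list C) : l <> nil -> (forall p, In p l -> unit_disc p) ->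
  exists (a : R) (b : C), Cmod b < a /\ forall x, unit_disc x ->
    INR (length l) + 2 * hyp_sum l x =
    (a * (1 + Cmod x * Cmod x) - 2 * (fst b * fst x + snd b * snd x)) / defect x.
Proof.
  assert (One : forall p, unit_disc p -> exists (a : R) (b : C), Cmod b < a /\ forall x, unit_disc x ->
    1 + 2 * hyp x p = (a * (1 + Cmod x * Cmod x) - 2 * (fst b * fst x + snd b * snd x)) / defect x).
  { intros p Hp. assert (Dp := defect_pos p Hp).
    exists ((1 + Cmod p * Cmod p) / defect p), (RtoC (2 / defect p) * p)%C. split.
    - rewrite Cmod_mult, Cmod_RtoC_pos by (left; apply Rdiv_lt_0_compat; lra).
      enough (0 < (1 + Cmod p * Cmod p) / defect p - 2 / defect p * Cmod p) by lra.
      replace ((1 + Cmod p * Cmod p) / defect p - 2 / defect p * Cmod p) with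
        ((1 - Cmod p) * (1 - Cmod p) / defect p) by (field; lra).
      apply Rdiv_lt_0_compat; auto. unfold unit_disc in Hp. nra.
    - intros x Hx. assert (Dx := defect_pos x Hx).
      unfold hyp. fold (defect x) (defect p).
      assert (E : Cmod (x - p) * Cmod (x - p) = Cmod x * Cmod x + Cmod p * Cmod p - 2 * (fst p * fst x + snd p * snd x)).
      { rewrite !Cmod_sqr. simpl. ring. }
      rewrite E. simpl fst. simpl snd.
      replace (2 / defect p * fst p - 0 * snd p) with (2 / defect p * fst p) by ring.
      replace (2 / defect p * snd p + 0 * fst p) with (2 / defect p * snd p) by ring.
      apply Rmult_eq_reg_r with (defect x * defect p). 2: apply Rgt_not_eq, Rmult_lt_0_compat; lra.
      field_simplify; try lra. unfold defect. ring. }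
  induction l as [|p l IH]; intros N H. congruence.
  destruct (One p (H p (or_introl eq_refl))) as [a1 [b1 [H1 E1]]].
  destruct l as [|p' l].
  - exists a1, b1. split; auto. intros x Hx. rewrite <- E1 by auto. simpl. ring.
  - destruct IH as [a2 [b2 [H2 E2]]]. discriminate. intros; apply H; now right.
    exists (a1 + a2), (b1 + b2)%C. split.
    + assert (T := Cmod_triangle b1 b2). lra.
    + intros x Hx. change (length (p :: p' :: l)) with (S (length (p' :: l))). rewrite S_INR.
      change (hyp_sum (p :: p' :: l) x) with (hyp x p + hyp_sum (p' :: l) x).
      specialize (E1 x Hx). specialize (E2 x Hx). assert (Dx := defect_pos x Hx).
      replace (INR (length (p' :: l)) + 1 + 2 * (hyp x p + hyp_sum (p' :: l) x)) with
        ((1 + 2 * hyp x p) + (INR (length (p' :: l)) + 2 * hyp_sum (p' :: l) x)) by ring.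
      rewrite E1, E2. simpl. field. lra.
Qed.

(** The unique minimiser is the centre of mass of the points in the hyperboloid model. *)
Lemma hyp_sum_centre (l : list C) : l <> nil -> (forall p, In p l -> unit_disc p) ->
  exists c, unit_disc c /\ forall x, unit_disc x -> hyp_sum l x <= hyp_sum l c -> x = c.
Proof.
  intros N H. destruct (hyp_sum_form l N H) as [a [b [Hab E]]].
  assert (Pb := Cmod_ge_0 b).
  set (k := sqrt (a * a - Cmod b * Cmod b)).
  assert (Hk2 : k * k = a * a - Cmod b * Cmod b) by (apply sqrt_sqrt; nra).
  assert (Hk : 0 < k) by (apply sqrt_lt_R0; nra).
  (* The point of the disc represented by the vector (a, b), whose Minkowski norm is k. *)
  set (c := (RtoC (/ (a + k)) * b)%C).
  assert (Hi : 0 < / (a + k)) by (apply Rinv_0_lt_compat; lra).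
  assert (Mc : Cmod c = / (a + k) * Cmod b) by (unfold c; rewrite Cmod_mult, Cmod_RtoC_pos by lra; reflexivity).
  assert (Hc : unit_disc c).
  { unfold unit_disc. rewrite Mc. apply Rmult_lt_reg_l with (a + k). lra.
    rewrite <- Rmult_assoc, Rinv_r by lra. lra. }
  assert (Eb : forall x, fst b * fst x + snd b * snd x = (a + k) * (fst c * fst x + snd c * snd x)).
  { intros x. unfold c. simpl. field. lra. }
  assert (Ec : (a + k) * (Cmod c * Cmod c) = a - k).
  { rewrite Mc. replace ((a + k) * (/ (a + k) * Cmod b * (/ (a + k) * Cmod b))) with
     (Cmod b * Cmod b / (a + k)) by (field; lra).
    apply Rmult_eq_reg_r with (a + k); [|lra]. unfold Rdiv. rewrite Rmult_assoc, Rinv_l by lra. lra. }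
  assert (F : forall x, unit_disc x -> INR (length l) + 2 * hyp_sum l x = k + (a + k) * (Cmod (x - c) * Cmod (x - c)) / defect x).
  { intros x Hx. assert (Dx := defect_pos x Hx). rewrite E, Eb by auto.
    assert (X : Cmod (x - c) * Cmod (x - c) = Cmod x * Cmod x + Cmod c * Cmod c - 2 * (fst c * fst x + snd c * snd x)).
    { rewrite !Cmod_sqr. simpl. ring. }
    assert (Nd : defect x <> 0) by now apply Rgt_not_eq.
    assert (Y : (a + k) * (Cmod (x - c) * Cmod (x - c)) =
      (a + k) * (Cmod x * Cmod x) + (a - k) - 2 * ((a + k) * (fst c * fst x + snd c * snd x))).
    { rewrite X, <- Ec. ring. }
    rewrite Y. apply Rmult_eq_reg_r with (defect x); [|exact Nd].
    generalize (fst c * fst x + snd c * snd x). intros u. clear - Nd.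
    replace ((k + ((a + k) * (Cmod x * Cmod x) + (a - k) - 2 * ((a + k) * u)) / defect x) * defect x) with
      (k * defect x + ((a + k) * (Cmod x * Cmod x) + (a - k) - 2 * ((a + k) * u))) by (field; exact Nd).
    unfold Rdiv. rewrite Rmult_assoc, Rinv_l by exact Nd. unfold defect. ring. }
  exists c. split; auto. intros x Hx L.
  assert (Fx := F x Hx). assert (Fc := F c Hc). rewrite Cmod_sub_diag in Fc.
  assert (Dx := defect_pos x Hx).
  replace ((a + k) * (0 * 0) / defect c) with 0 in Fc by (unfold Rdiv; ring).
  assert (Z : (a + k) * (Cmod (x - c) * Cmod (x - c)) / defect x <= 0) by lra.
  apply Ceq_minus, Cmod_eq_0. assert (P := Cmod_ge_0 (x - c)). apply NNPP. intros Nz.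
  assert (0 < (a + k) * (Cmod (x - c) * Cmod (x - c)) / defect x).
  { apply Rdiv_lt_0_compat; auto. apply Rmult_lt_0_compat; nra. }
  lra.
Qed.

Fixpoint orbit (tau : C -> C) (n : nat) (p : C) : list C :=
  match n with O => nil | S n => p :: orbit tau n (tau p) end.

Lemma hyp_sum_app l1 l2 x : hyp_sum (l1 ++ l2) x = hyp_sum l1 x + hyp_sum l2 x.
Proof. induction l1 as [|p l1 IH]; simpl; [|rewrite IH]; ring. Qed.

Lemma orbit_snoc tau n p : orbit tau (S n) p = orbit tau n p ++ (Nat.iter n tau p :: nil).
Proof.
  revert p. induction n as [|n IH]; intros p. reflexivity.
  change (orbit tau (S (S n)) p) with (p :: orbit tau (S n) (tau p)). rewrite IH.
  simpl. do 3 f_equal. clear. induction n as [|n IH]; simpl; [auto|now rewrite IH].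
Qed.

Lemma orbit_map tau n p : map tau (orbit tau n p) = orbit tau n (tau p).
Proof. revert p. induction n as [|n IH]; intros p; simpl; [|rewrite IH]; auto. Qed.

(** A holomorphic self-map contracts [hyp] and permutes a cycle, so it fixes the centre
    of the cycle. *)
Lemma fixed_point_of_cycle tau n p : holomorphic_map unit_disc unit_disc tau -> unit_disc p ->
  Nat.iter (S n) tau p = p -> exists c, unit_disc c /\ tau c = c.
Proof.
  intros Ht Hp Hcyc. assert (Hm := proj2 Ht). set (l := orbit tau (S n) p).
  assert (Hl : forall q, In q l -> unit_disc q).
  { unfold l. clear l Hcyc. revert p Hp. induction (S n) as [|m IH]; intros p Hp q Hq; simpl in Hq; [tauto|].
    destruct Hq as [<-|Hq]; auto. apply (IH (tau p)); auto. }
  destruct (hyp_sum_centre l) as [c [Hc Hmin]]; auto. { unfold l; simpl; discriminate. }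
  exists c. split; auto. apply Hmin; auto.
  assert (Contr : forall l, (forall q, In q l -> unit_disc q) -> hyp_sum (map tau l) (tau c) <= hyp_sum l c).
  { clear l Hl Hmin. induction l as [|q l IH]; intros Hl; simpl. lra.
    assert (A := hyp_contract tau c q Ht Hc (Hl q (or_introl eq_refl))).
    assert (B := IH (fun q H => Hl q (or_intror H))). lra. }
  specialize (Contr l Hl). unfold l in Contr at 1. rewrite orbit_map, orbit_snoc, hyp_sum_app in Contr.
  unfold l at 1. change (orbit tau (S n) p) with (p :: orbit tau n (tau p)).
  assert (It : Nat.iter n tau (tau p) = p).
  { rewrite <- Hcyc at 2. clear. induction n as [|n IH]; simpl in *; [auto|now rewrite IH]. }
  rewrite It in Contr. simpl in *. lra.
Qed.

(** Two distinct points with the same image give a lift [tau] of [pi] through itself that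
    moves one to the other; it preserves each fibre.  On a finite fibre it
    would have a cycle, hence a fixed point in the disc, and then it would be the
    identity by uniqueness of lifts. *)
Lemma fibre_infinite D pi a : ~ simply_connected D -> D a -> holomorphic_covering unit_disc D pi ->
  forall l : list C, exists x, unit_disc x /\ pi x = a /\ ~ In x l.
Proof.
  intros Nsc Da Hcov l. apply NNPP. intros HN.
  assert (Fin : forall x, unit_disc x -> pi x = a -> In x l).
  { intros x Hx Ex. apply NNPP. intros Ni. apply HN. now exists x. }
  assert (Hc := Hcov). destruct Hc as [Hpi [Sur _]].
  assert (Inj : exists x y, unit_disc x /\ unit_disc y /\ pi x = pi y /\ x <> y).
  { apply NNPP. intros M. apply Nsc. apply (simply_connected_of_injective D pi Hcov).
    intros x y Hx Hy E. apply NNPP. intros N. apply M. now exists x, y. }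
  destruct Inj as [x [y [Hx [Hy [E N]]]]].
  destruct (lift_exists D pi pi x y Hcov Hpi Hx Hy) as [tau [Ht [Tx Tp]]]; auto.
  assert (Tm := proj2 Ht).
  destruct (Sur a Da) as [p [Hp Ep]].
  assert (It : forall n, unit_disc (Nat.iter n tau p) /\ pi (Nat.iter n tau p) = a).
  { induction n as [|n [I1 I2]]; simpl; auto. split; auto. rewrite Tp; auto. }
  assert (Rep : exists i j, (i < j)%nat /\ Nat.iter i tau p = Nat.iter j tau p).
  { apply NNPP. intros M.
    set (L := map (fun i => Nat.iter i tau p) (seq 0 (S (length l)))).
    assert (ND : NoDup L).
    { apply NoDup_map_NoDup_ForallPairs; [|apply seq_NoDup]. intros i j _ _ Eij.
      destruct (Nat.lt_trichotomy i j) as [Lt|[Q|Lt]]; auto; exfalso; apply M; eauto. }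
    assert (Inc : incl L l).
    { intros q Hq. apply in_map_iff in Hq. destruct Hq as [i [<- _]]. apply Fin; apply It. }
    assert (Len := NoDup_incl_length ND Inc). unfold L in Len. rewrite length_map, length_seq in Len. lia. }
  destruct Rep as [i [j [Lt Eij]]].
  destruct (fixed_point_of_cycle tau (j - i - 1) (Nat.iter i tau p) Ht) as [c [Hcd Fc]].
  - apply It.
  - rewrite <- Nat.iter_add. replace (S (j - i - 1) + i)%nat with j by lia. now symmetry.
  - apply N. rewrite <- Tx. symmetry.
    apply (holomorphic_lift_unique D pi tau (fun w => w) c Hcov); auto.
    split; auto. apply holomorphic_on_iff. intros; apply hol_id.
Qed.
(** * Products over countable sets *)

Lemma Rprod_app l1 l2 : Rprod (l1 ++ l2) = Rprod l1 * Rprod l2.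
Proof. induction l1 as [|x l1 IH]; simpl. ring. rewrite IH. ring. Qed.

Lemma Rprod_range (f : C -> R) l : (forall x, In x l -> 0 <= f x <= 1) -> 0 <= Rprod (map f l) <= 1.
Proof.
  induction l as [|x l IH]; intros H; simpl. lra.
  assert (A := H x (or_introl eq_refl)). assert (B := IH (fun y Hy => H y (or_intror Hy))). nra.
Qed.

Lemma Rprod_pos (f : C -> R) l : (forall x, In x l -> 0 < f x) -> 0 < Rprod (map f l).
Proof.
  induction l as [|x l IH]; intros H; simpl. lra.
  apply Rmult_lt_0_compat. apply H; now left. apply IH. intros; apply H; now right.
Qed.

Lemma Rprod_le (f g : C -> R) l : (forall x, In x l -> 0 <= f x <= g x) ->
  Rprod (map f l) <= Rprod (map g l).
Proof.
  intros H. enough (0 <= Rprod (map f l) <= Rprod (map g l)) by lra.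
  induction l as [|x l IH]; simpl. lra.
  assert (A := H x (or_introl eq_refl)). assert (B := IH (fun y Hy => H y (or_intror Hy))).
  split. apply Rmult_le_pos; lra. apply Rmult_le_compat; lra.
Qed.

Lemma Rprod_le_eq (f g : C -> R) l : (forall x, In x l -> 0 < f x <= g x) ->
  Rprod (map g l) <= Rprod (map f l) -> forall x, In x l -> f x = g x.
Proof.
  induction l as [|x l IH]; intros H E y Hy. destruct Hy.
  assert (A := H x (or_introl eq_refl)).
  assert (Pf : 0 < Rprod (map f l)) by (apply Rprod_pos; intros; apply H; now right).
  assert (L : Rprod (map f l) <= Rprod (map g l)).
  { apply Rprod_le. intros w Hw. assert (X := H w (or_intror Hw)). lra. }
  simpl in E. destruct Hy as [<-|Hy].
  - apply Rle_antisym. lra. apply Rnot_lt_le. intros Lt. nra.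
  - apply IH; auto. intros; apply H; now right. apply Rnot_lt_le. intros Lt. nra.
Qed.

Lemma Rprod_incl (f : C -> R) l : forall L, (forall x, In x L -> 0 <= f x <= 1) -> NoDup l -> incl l L ->
  Rprod (map f L) <= Rprod (map f l).
Proof.
  induction l as [|x l IH]; intros L HL ND Inc. apply Rprod_range; auto.
  destruct (in_split x L) as [L1 [L2 ->]]. apply Inc; now left.
  inversion ND as [|? ? Nx ND']; subst.
  assert (K : Rprod (map f (L1 ++ L2)) <= Rprod (map f l)).
  { apply IH; auto.
    - intros y Hy. apply HL. apply in_app_iff in Hy. apply in_app_iff. simpl. tauto.
    - intros y Hy. assert (Z := Inc y (or_intror Hy)). apply in_app_iff in Z. apply in_app_iff.
      destruct Z as [Z|[Z|Z]]; auto. subst. tauto. }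
  assert (Fx : 0 <= f x <= 1) by (apply HL, in_app_iff; simpl; auto).
  rewrite map_app, Rprod_app in *. simpl. nra.
Qed.

Lemma Rprod_filter (f : C -> R) (p : C -> bool) l :
  Rprod (map f l) = Rprod (map f (filter p l)) * Rprod (map f (filter (fun x => negb (p x)) l)).
Proof. induction l as [|x l IH]; simpl. ring. destruct (p x); simpl; rewrite IH; ring. Qed.

Lemma length_filter_split (p : C -> bool) l :
  length l = (length (filter p l) + length (filter (fun x => negb (p x)) l))%nat.
Proof. induction l as [|x l IH]; simpl. auto. destruct (p x); simpl; lia. Qed.

Lemma count_occ_filter (p : C -> bool) l x : p x = true ->
  count_occ Ceq_dec (filter p l) x = count_occ Ceq_dec l x.
Proof.
  intros H. induction l as [|y l IH]; simpl. auto.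
  destruct (p y) eqn:E; simpl; destruct (Ceq_dec y x); subst; congruence.
Qed.

Lemma partial_prod_S u n : partial_prod u (S n) = partial_prod u n * u n.
Proof. unfold partial_prod. rewrite seq_S, map_app, Rprod_app. simpl. ring. Qed.

Lemma partial_prod_map (f : C -> R) (e : nat -> C) n :
  partial_prod (fun j => f (e j)) n = Rprod (map f (map e (seq 0 n))).
Proof. unfold partial_prod. now rewrite map_map. Qed.

Lemma partial_prod_range u n : (forall j, 0 <= u j <= 1) -> 0 <= partial_prod u n <= 1.
Proof.
  intros H. induction n as [|n IH]. unfold partial_prod; simpl; lra.
  rewrite partial_prod_S. assert (X := H n). nra.
Qed.

Lemma partial_prod_antitone u n m : (forall j, 0 <= u j <= 1) -> (n <= m)%nat ->
  partial_prod u m <= partial_prod u n.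
Proof.
  intros H L. induction L as [|m L IH]. lra.
  rewrite partial_prod_S. assert (X := H m). assert (Y := partial_prod_range u m H). nra.
Qed.

Lemma partial_prod_strict u n m : (forall j, 0 < u j < 1) -> (n < m)%nat ->
  partial_prod u m < partial_prod u n.
Proof.
  intros H L. assert (H' : forall j, 0 <= u j <= 1) by (intros j; assert (X := H j); lra).
  apply Rle_lt_trans with (partial_prod u (S n)). now apply partial_prod_antitone.
  assert (P : forall k, 0 < partial_prod u k).
  { induction k as [|k IH]. unfold partial_prod; simpl; lra. rewrite partial_prod_S. apply Rmult_lt_0_compat; auto. apply H. }
  rewrite partial_prod_S. assert (X := H n). assert (Y := P n). nra.
Qed.

Lemma eprod_Infty_limit u : (forall j, 0 <= u j <= 1) -> is_lim_seq (partial_prod u) (eprod u Infty).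
Proof.
  intros H. destruct (ex_finite_lim_seq_decr (partial_prod u) 0) as [p Hp].
  - intros n. apply partial_prod_antitone; auto.
  - intros n. apply partial_prod_range; auto.
  - simpl. rewrite (is_lim_seq_unique _ _ Hp). exact Hp.
Qed.

Lemma eprod_Infty_le u n : (forall j, 0 <= u j <= 1) -> eprod u Infty <= partial_prod u n.
Proof.
  intros H. apply (is_lim_seq_decr_compare (partial_prod u) (eprod u Infty)).
  - now apply eprod_Infty_limit.
  - intros k. apply partial_prod_antitone; auto.
Qed.

(** For factors in [0, 1] every enumeration of [A], finite or infinite, gives this infimum
    over finite subsets, so the order of the factors does not matter. *)
Definition is_inf_prod (A : C -> Prop) (f : C -> R) (p : R) : Prop :=
  (forall l, NoDup l -> (forall x, In x l -> A x) -> p <= Rprod (map f l)) /\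
  (forall e, 0 < e -> exists l, NoDup l /\ (forall x, In x l -> A x) /\ Rprod (map f l) < p + e).

Lemma is_inf_prod_mono (A B : C -> Prop) f g p q : (forall x, B x -> A x) ->
  (forall x, B x -> 0 <= f x <= g x) -> is_inf_prod A f p -> is_inf_prod B g q -> p <= q.
Proof.
  intros HBA Hfg [Hp _] [_ Hq]. apply Rnot_lt_le. intros L.
  destruct (Hq (p - q)) as [l [ND [Hl Hlt]]]. lra.
  assert (X := Hp l ND (fun x Hx => HBA x (Hl x Hx))).
  assert (Y := Rprod_le f g l (fun x Hx => Hfg x (Hl x Hx))). lra.
Qed.

Lemma is_inf_prod_unique A f p q : (forall x, A x -> 0 <= f x) ->
  is_inf_prod A f p -> is_inf_prod A f q -> p = q.
Proof.
  intros H Hp Hq.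
  apply Rle_antisym; eapply (is_inf_prod_mono A A f f); eauto; intros x Hx; specialize (H x Hx); lra.
Qed.

Lemma eprod_is_inf A f N e : (forall x, A x -> 0 <= f x <= 1) -> enumerates N e A ->
  is_inf_prod A f (eprod (fun j => f (e j)) N).
Proof.
  intros Hf [Inj Sur].
  assert (HA : forall j, lt_enat j N -> A (e j)) by (intros j Hj; apply Sur; eauto).
  assert (ND : forall n, (forall j, (j < n)%nat -> lt_enat j N) -> NoDup (map e (seq 0 n))).
  { intros n Hn. apply NoDup_map_NoDup_ForallPairs; [|apply seq_NoDup].
    intros i j Hi Hj. apply in_seq in Hi, Hj. apply Inj; apply Hn; lia. }
  assert (InA : forall n, (forall j, (j < n)%nat -> lt_enat j N) -> forall x, In x (map e (seq 0 n)) -> A x).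
  { intros n Hn x Hx. apply in_map_iff in Hx. destruct Hx as [j [<- Hj]]. apply in_seq in Hj. apply HA, Hn. lia. }
  destruct N as [n|].
  - cbn [eprod]. rewrite partial_prod_map. simpl in *. split.
    + intros l NDl Hl. apply Rprod_incl; auto.
      * intros x Hx. apply Hf, (InA n); auto.
      * intros x Hx. apply Hl, Sur in Hx. destruct Hx as [j [Hj <-]]. apply in_map, in_seq. lia.
    + intros eps He. exists (map e (seq 0 n)). split; [auto|]. split; [apply InA; auto|lra].
  - set (u := fun j => f (e j)). assert (Hu : forall j, 0 <= u j <= 1).
    { intros j. apply Hf, HA. exact I. }
    split.
    + intros l NDl Hl.
      assert (Ex : exists n, incl l (map e (seq 0 n))).
      { clear NDl. induction l as [|x l IH]. exists O. intros y [].
        destruct IH as [n Hn]. intros; apply Hl; now right.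
        destruct (proj1 (Sur x)) as [j [_ Hj]]. apply Hl; now left.
        exists (n + S j)%nat. intros y [<-|Hy].
        - rewrite <- Hj. apply in_map, in_seq. lia.
        - apply Hn, in_map_iff in Hy. destruct Hy as [i [<- Hi]]. apply in_seq in Hi. apply in_map, in_seq. lia. }
      destruct Ex as [n Hn]. apply Rle_trans with (partial_prod u n). now apply eprod_Infty_le.
      unfold u. rewrite partial_prod_map. apply Rprod_incl; auto.
      intros x Hx. apply Hf, (InA n); auto. intros; exact I.
    + intros eps He. assert (L := eprod_Infty_limit u Hu). apply is_lim_seq_spec in L.
      destruct (L (mkposreal eps He)) as [n Hn]. specialize (Hn n (Nat.le_refl n)). simpl pos in Hn.
      exists (map e (seq 0 n)). split. apply ND. intros; exact I. split. apply InA. intros; exact I.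
      rewrite <- partial_prod_map. apply Rabs_def2 in Hn. fold u. lra.
Qed.

Lemma is_prod_over_iff A f p : (forall x, A x -> 0 <= f x <= 1) ->
  (is_prod_over A f p <-> at_most_countable A /\ is_inf_prod A f p).
Proof.
  intros Hf. split.
  - intros [HA H]. split; auto. destruct HA as [N [e He]]. rewrite (H N e He). now apply eprod_is_inf.
  - intros [HA H]. split; auto. intros N e He. apply (is_inf_prod_unique A f); auto.
    intros x Hx. now apply Hf. now apply eprod_is_inf.
Qed.

Lemma Glb_attained (E : R -> Prop) m : E m -> (forall x, E x -> m <= x) -> real (Glb_Rbar E) = m.
Proof.
  intros H L. rewrite (is_glb_Rbar_unique E m). reflexivity.
  split. intros x Hx. now apply L. intros b Hb. now apply Hb.
Qed.

(** * Fibres ordered by modulus *)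

Lemma list_argmin (Q : C -> Prop) (l : list C) : (exists x, In x l /\ Q x) ->
  exists x, In x l /\ Q x /\ forall y, In y l -> Q y -> Cmod x <= Cmod y.
Proof.
  induction l as [|a l IH]; intros [x [Hx Qx]]. destruct Hx.
  destruct (classic (exists x, In x l /\ Q x)) as [H|H].
  - destruct (IH H) as [m [M1 [M2 M3]]].
    destruct (classic (Q a /\ Cmod a <= Cmod m)) as [[Qa La]|Na].
    + exists a. split. now left. split; auto. intros y [<-|Hy] Qy. lra. specialize (M3 y Hy Qy). lra.
    + exists m. split. now right. split; auto. intros y [<-|Hy] Qy; auto.
      apply Rnot_lt_le. intros L. apply Na. split; auto. lra.
  - destruct Hx as [<-|Hx]; [|exfalso; eauto].
    exists a. split. now left. split; auto. intros y [<-|Hy] Qy. lra. exfalso; eauto.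
Qed.

Definition fibre (pi : C -> C) (a x : C) : Prop := unit_disc x /\ pi x = a.

Lemma fibre_min D pi a l : holomorphic_covering unit_disc D pi ->
  (exists x, fibre pi a x /\ ~ In x l) ->
  exists x, fibre pi a x /\ ~ In x l /\ forall y, fibre pi a y -> ~ In y l -> Cmod x <= Cmod y.
Proof.
  intros Hcov [x [[Hx Ex] Nx]].
  destruct (fibre_locally_finite D pi a (Cmod x) Hcov Hx) as [L HL].
  destruct (list_argmin (fun y => fibre pi a y /\ ~ In y l) L) as [m [M1 [[M2 M3] M4]]].
  { exists x. split. apply HL; auto. lra. split; auto. split; auto. }
  exists m. split; auto. split; auto. intros y Fy Ny.
  destruct (Rle_or_lt (Cmod y) (Cmod x)) as [Le|Lt].
  - apply M4. apply HL; auto. apply Fy. auto.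
  - apply Rle_trans with (Cmod x); [|lra]. apply M4. apply HL; auto. lra. split; auto. split; auto.
Qed.

(** A point of smallest modulus among those not yet listed is chosen repeatedly; local finiteness
    guarantees that it exists and that no point of the fibre is left out. *)
Lemma fibre_enumeration D pi a : holomorphic_covering unit_disc D pi ->
  (forall l : list C, exists x, unit_disc x /\ pi x = a /\ ~ In x l) ->
  exists eta, enumerates Infty eta (fibre pi a) /\ forall j, Cmod (eta j) <= Cmod (eta (S j)).
Proof.
  intros Hcov Hinf.
  assert (Ex : forall l, exists x, fibre pi a x /\ ~ In x l /\ forall y, fibre pi a y -> ~ In y l -> Cmod x <= Cmod y).
  { intros l. apply (fibre_min D); auto. destruct (Hinf l) as [x [A [B E]]]. exists x. split; auto. split; auto. }
  set (nxt := fun l => proj1_sig (constructive_indefinite_description _ (Ex l))).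
  assert (Hn : forall l, fibre pi a (nxt l) /\ ~ In (nxt l) l /\ forall y, fibre pi a y -> ~ In y l -> Cmod (nxt l) <= Cmod y).
  { intros l. unfold nxt. destruct constructive_indefinite_description as [x Hx]. exact Hx. }
  clearbody nxt. clear Ex.
  set (pre := fix pre n := match n with O => nil | S n => nxt (pre n) :: pre n end).
  set (eta := fun n => nxt (pre n)).
  assert (Hpre : forall n x, In x (pre n) <-> exists j, (j < n)%nat /\ eta j = x).
  { induction n as [|n IH]; intros x; simpl. split; [tauto|intros [j [Hj _]]; lia].
    rewrite IH. split.
    - intros [<-|[j [Hj E]]]. exists n. split; auto. exists j. split; auto.
    - intros [j [Hj E]]. destruct (Nat.eq_dec j n) as [->|]. now left. right. exists j. split; [lia|auto]. }
  assert (Hlen : forall n, length (pre n) = n) by (induction n; simpl; auto).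
  assert (Hnd : forall n, NoDup (pre n)).
  { induction n; simpl; constructor; auto. apply Hn. }
  exists eta. split; [split|].
  - assert (Lt : forall i j, (i < j)%nat -> eta i <> eta j).
    { intros i j L E. destruct (Hn (pre j)) as [_ [N _]]. apply N. apply Hpre. exists i. split; auto. }
    intros i j _ _ E. destruct (Nat.lt_trichotomy i j) as [L|[L|L]]; auto.
    destruct (Lt i j L E). destruct (Lt j i L (eq_sym E)).
  - intros x. split.
    + intros Fx. apply NNPP. intros N.
      destruct (fibre_locally_finite D pi a (Cmod x) Hcov (proj1 Fx)) as [L HL].
      assert (Inc : incl (pre (S (length L))) L).
      { intros y Hy. apply Hpre in Hy. destruct Hy as [j [_ <-]].
        destruct (Hn (pre j)) as [F1 [_ F2]]. apply HL; [|apply F1].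
        apply F2; auto. rewrite Hpre. intros [i [_ E]]. apply N. exists i. split; [exact I|auto]. }
      assert (Z := NoDup_incl_length (Hnd _) Inc). rewrite Hlen in Z. lia.
    + intros [j [_ <-]]. apply Hn.
  - intros j. apply (Hn (pre j)). apply Hn. intros H.
    destruct (Hn (pre (S j))) as [_ [N _]]. apply N. simpl. now right.
Qed.

(** Among [n + 1] distinct points of the fibre, one has an index at least [n] in the
    enumeration, hence a modulus at least that of [eta n]; it is removed and the induction
    goes on. *)
Lemma sorted_prod_le F eta e : enumerates Infty eta F -> (forall x, F x -> unit_disc x) ->
  (forall j, Cmod (eta j) <= Cmod (eta (S j))) -> NoDup e -> (forall x, In x e -> F x) ->
  partial_prod (fun j => Cmod (eta j)) (length e) <= Rprod (map Cmod e).
Proof.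
  intros [Inj Sur] HF Hs.
  assert (Mono : forall i j, (i <= j)%nat -> Cmod (eta i) <= Cmod (eta j)).
  { intros i j L. induction L as [|j L IH]. lra. assert (X := Hs j). lra. }
  assert (Hu : forall j, 0 <= Cmod (eta j) <= 1).
  { intros j. split. apply Cmod_ge_0. left. apply (HF (eta j)). apply Sur. exists j. split; [exact I|auto]. }
  remember (length e) as n eqn:En. revert e En. induction n as [|n IH]; intros e En ND He.
  - destruct e; [|discriminate]. unfold partial_prod. simpl. lra.
  - assert (Ex : exists x j, In x e /\ eta j = x /\ (n <= j)%nat).
    { apply NNPP. intros N.
      assert (Inc : incl e (map eta (seq 0 n))).
      { intros x Hx. destruct (proj1 (Sur x) (He x Hx)) as [j [_ Hj]]. rewrite <- Hj.
        apply in_map, in_seq. destruct (Nat.le_gt_cases n j); [|lia]. exfalso. apply N. exists x, j. auto. }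
      assert (Z := NoDup_incl_length ND Inc). rewrite length_map, length_seq in Z. lia. }
    destruct Ex as [x [j [Hx [Ej Hj]]]]. destruct (in_split x e Hx) as [e1 [e2 ->]].
    rewrite partial_prod_S, map_app, Rprod_app. simpl.
    assert (IH' : partial_prod (fun j => Cmod (eta j)) n <= Rprod (map Cmod (e1 ++ e2))).
    { apply IH. rewrite length_app in *. simpl in En. lia. eapply NoDup_remove_1; eauto.
      intros y Hy. apply He. apply in_app_iff in Hy. apply in_app_iff. simpl. tauto. }
    rewrite map_app, Rprod_app in IH'.
    assert (M := Mono n j Hj). rewrite Ej in M. assert (X := Hu n).
    assert (Y := partial_prod_range (fun j => Cmod (eta j)) n Hu).
    apply Rle_trans with ((Rprod (map Cmod e1) * Rprod (map Cmod e2)) * Cmod x); [|right; ring].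
    apply Rmult_le_compat; lra.
Qed.
(** * Discs through the covering *)

(** Each factor [w - x] of the product divides [u], because [v] does not vanish at [x]. *)
Lemma vanish_cancel u v x k : holomorphic_on unit_disc u -> holomorphic_on unit_disc v -> unit_disc x ->
  v x <> 0%C -> vanishes_to_order (fun w => u w * v w)%C x k -> vanishes_to_order u x k.
Proof.
  intros Hu Hv Hx Nv. revert u Hu. induction k as [|k IH]; intros u Hu V.
  - exists u. split; auto. intros w _. change ((w - x) ^ 0)%C with (RtoC 1). ring.
  - assert (Z := vanishes_0 _ _ _ Hx V). cbv beta in Z.
    assert (U0 : u x = 0%C) by (apply NNPP; intros N; now apply (Cmult_neq_0 (u x) (v x))).
    destruct (divide_zero unit_disc u x unit_disc_open Hu Hx U0) as [u1 [Hu1 [E1 _]]].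
    destruct V as [h [Hh Eh]].
    destruct (IH u1 Hu1) as [g [Hg Eg]].
    + exists h. split; auto. apply (cancel_factor _ _ x); auto.
      * rewrite holomorphic_on_iff in *. intros w Hw. apply hol_mult; auto.
      * rewrite holomorphic_on_iff in *. intros w Hw. apply hol_mult; auto.
        apply (hol_pow (fun w => w - x)%C). apply hol_sub_const.
      * intros w Hw. replace ((w - x) * (u1 w * v w))%C with ((w - x) * u1 w * v w)%C by ring.
        rewrite <- E1, Eh, Cpow_S by auto. ring.
    + exists g. split; auto. intros w Hw. rewrite E1, Eg, Cpow_S by auto. ring.
Qed.

(** The value of [q] at [eta] is the derivative of [pi], which does not vanish because [pi]
    has a holomorphic local inverse. *)
Lemma covering_factor D pi eta : holomorphic_covering unit_disc D pi -> unit_disc eta ->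
  exists q, holomorphic_on unit_disc q /\ q eta <> 0%C /\
    forall y, (pi y - pi eta = (y - eta) * q y)%C.
Proof.
  intros Hcov He. assert (Hc := Hcov). destruct Hc as [[Hpi Dpi] _].
  destruct (divide_zero unit_disc (fun y => pi y - pi eta)%C eta unit_disc_open) as [q [Hq [E Dq]]]; auto.
  - rewrite holomorphic_on_iff in *. intros x Hx. apply hol_minus; auto. apply hol_const.
  - ring.
  - exists q. split; auto. split; auto. intros Z. rewrite Z in Dq.
    destruct (covering_sheets D pi (pi eta) Hcov (Dpi eta He)) as [V [I [S [s [HV [Vp [S1 [S2 [S3 [S4 [S5 S6]]]]]]]]]]].
    destruct (S3 eta He Vp) as [i Hi]. destruct (S6 i _ Vp) as [m Hm].
    assert (D1 : diff_at pi eta 0).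
    { replace (RtoC 0) with (RtoC 0 + RtoC 0)%C by ring.
      apply diff_at_ext_loc with (fun y => (pi y - pi eta) + pi eta)%C 1; [lra|intros; ring|].
      apply diff_at_plus; auto. apply diff_at_const. }
    assert (D2 := diff_at_comp (s i) pi eta m 0 D1 Hm).
    destruct (open_C _ _ (S1 i) Hi) as [d [Hd Hd']].
    assert (D3 := diff_at_ext_loc _ (fun y => y) eta _ d Hd (fun y Hy => S5 i y (Hd' y Hy)) D2).
    assert (X := diff_at_unique _ _ _ _ D3 (diff_at_id eta)). apply C1_nz. rewrite <- X. ring.
Qed.

Lemma vanishes_1 f x : holomorphic_on unit_disc f -> unit_disc x -> f x = 0%C -> vanishes_to_order f x 1.
Proof.
  intros Hf Hx H0. destruct (divide_zero unit_disc f x unit_disc_open Hf Hx H0) as [g [Hg [E _]]].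
  exists g. split; auto. intros w _. now rewrite Cpow_1_r, E.
Qed.

(** The points of [l] that [psi] sends to [eta], counted with multiplicity, are zeros of
    [blaschke eta] composed with [psi], a function bounded by 1 whose value at 0 is [eta]. *)
Lemma fibre_point_le D pi psi eta (l : list C) : holomorphic_covering unit_disc D pi ->
  holomorphic_map unit_disc unit_disc psi -> psi 0%C = 0%C -> unit_disc eta ->
  (forall x, In x l -> unit_disc x /\ psi x = eta /\
     vanishes_to_order (fun w => pi (psi w) - pi eta)%C x (count_occ Ceq_dec l x)) ->
  Cmod eta <= Rprod (map Cmod l).
Proof.
  intros Hcov [Hpsi Mpsi] H0 He Hl.
  destruct (covering_factor D pi eta Hcov He) as [q [Hq [Nq Eq]]].
  assert (Hpsi' := proj1 (holomorphic_on_iff _ _) Hpsi).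
  rewrite <- (blaschke_0_r eta), <- H0.
  apply (blaschke_zeros l (fun w => blaschke eta (psi w))).
  - apply holomorphic_on_iff. intros w Hw. apply (hol_comp (blaschke eta)); auto. apply blaschke_hol; auto. now apply Mpsi.
  - intros w Hw. left. apply blaschke_lt_1; auto. now apply Mpsi.
  - intros x Hx. destruct (Hl x Hx) as [Dx [Ex Vx]]. split; auto.
    assert (Hu : holomorphic_on unit_disc (fun w => psi w - eta)%C).
    { apply holomorphic_on_iff. intros w Hw. apply hol_minus; auto. apply hol_const. }
    assert (Hv : holomorphic_on unit_disc (fun w => q (psi w))).
    { rewrite holomorphic_on_iff in *. intros w Hw. apply (hol_comp q); auto. }
    destruct (vanish_cancel (fun w => psi w - eta)%C (fun w => q (psi w)) x (count_occ Ceq_dec l x)) as [g [Hg Eg]]; auto.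
    + now rewrite Ex.
    + destruct Vx as [h [Hh Eh]]. exists h. split; auto. intros w Hw. rewrite <- Eh by auto. now rewrite Eq.
    + exists (fun w => g w * (- (1) / (1 - Cconj eta * psi w)))%C. split.
      * rewrite holomorphic_on_iff in *. intros w Hw. apply hol_mult; auto. apply hol_div.
        apply hol_const. apply hol_minus. apply hol_const. apply hol_mult. apply hol_const. auto.
        apply blaschke_den_neq; auto. left. now apply Mpsi.
      * intros w Hw. rewrite Cmult_assoc, <- Eg by auto. unfold blaschke. field.
        apply blaschke_den_neq; auto. left. now apply Mpsi.
Qed.

(** The points of [l] are grouped by their images under [psi], and [fibre_point_le] applies to
    each group.  If there are as many images as points, all groups are singletons. *)
Lemma image_points D pi a psi : holomorphic_covering unit_disc D pi ->
  holomorphic_map unit_disc unit_disc psi -> psi 0%C = 0%C ->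
  forall l : list C, (forall x, In x l -> unit_disc x /\ pi (psi x) = a /\
     vanishes_to_order (fun w => pi (psi w) - a)%C x (count_occ Ceq_dec l x)) ->
  exists e, NoDup e /\ (forall y, In y e -> fibre pi a y /\ exists x, In x l /\ psi x = y) /\
    (length e <= length l)%nat /\ Rprod (map Cmod e) <= Rprod (map Cmod l) /\
    (length e = length l -> Rprod (map Cmod e) = Rprod (map (fun x => Cmod (psi x)) l)).
Proof.
  intros Hcov Hpsi H0 l. remember (length l) as n eqn:En. revert l En.
  induction n as [n IH] using (well_founded_induction Wf_nat.lt_wf). intros l -> Hl.
  destruct l as [|x0 l'].
  - exists nil. split. constructor. split. intros y []. simpl. repeat split; auto; lra.
  - set (l := x0 :: l') in *. set (eta := psi x0).
    destruct (Hl x0 (or_introl eq_refl)) as [Dx0 [Ex0 _]]. assert (Deta : unit_disc eta) by (now apply Hpsi).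
    set (p := fun x => if Ceq_dec (psi x) eta then true else false).
    assert (Pt : forall x, p x = true <-> psi x = eta) by (intros x; unfold p; destruct Ceq_dec; split; congruence).
    set (l1 := filter p l). set (l2 := filter (fun x => negb (p x)) l).
    assert (Split := length_filter_split p l). fold l1 l2 in Split.
    assert (L1 : (1 <= length l1)%nat).
    { unfold l1, l. simpl. assert (E : p x0 = true) by now apply Pt. rewrite E. simpl. lia. }
    destruct (IH (length l2)) with (l := l2) as [e [ND [He [Len [Le Eq]]]]]; auto. lia.
    { intros x Hx. apply filter_In in Hx. destruct Hx as [Hx Px]. destruct (Hl x Hx) as [A [B V]].
      split; auto. split; auto. unfold l2. rewrite count_occ_filter; auto. }
    assert (G : Cmod eta <= Rprod (map Cmod l1)).
    { apply (fibre_point_le D pi psi eta l1); auto. intros x Hx. apply filter_In in Hx. destruct Hx as [Hx Px].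
      destruct (Hl x Hx) as [A [B V]]. split; auto. split. now apply Pt.
      unfold l1. rewrite count_occ_filter by auto. unfold eta at 1. now rewrite Ex0. }
    assert (R1 : 0 <= Rprod (map Cmod e)).
    { apply Rprod_range. intros y Hy. destruct (He y Hy) as [[Dy _] _]. unfold unit_disc in Dy.
      split. apply Cmod_ge_0. lra. }
    exists (eta :: e). split; [|split; [|split; [|split]]].
    + constructor; auto. intros Hin. destruct (He eta Hin) as [_ [x [Hx Ex]]].
      apply filter_In in Hx. destruct Hx as [_ Px]. apply Pt in Ex. rewrite Ex in Px. discriminate.
    + intros y [<-|Hy]. split. split; auto. exists x0. split; auto. now left.
      destruct (He y Hy) as [A [x [Hx Ex]]]. split; auto. exists x. split; auto. apply filter_In in Hx. tauto.
    + simpl length at 1. lia.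
    + rewrite (Rprod_filter Cmod p l). fold l1 l2. simpl. apply Rmult_le_compat; auto. apply Cmod_ge_0.
    + intros EL. simpl length at 1 in EL.
      assert (E1 : length l1 = 1%nat) by lia. assert (E2 : length e = length l2) by lia.
      rewrite (Rprod_filter (fun x => Cmod (psi x)) p l). fold l1 l2. rewrite <- Eq by auto.
      destruct l1 as [|y [|y' l1']] eqn:El1; try discriminate. simpl. rewrite Rmult_1_r. f_equal. f_equal.
      symmetry. apply Pt. assert (Hy : In y l1) by (rewrite El1; now left). unfold l1 in Hy.
      now apply filter_In in Hy.
Qed.

Lemma vanish_of_NoDup phi a (l : list C) : holomorphic_on unit_disc phi -> NoDup l ->
  (forall x, In x l -> unit_disc x /\ phi x = a) ->
  forall x, In x l -> vanishes_to_order (fun w => phi w - a)%C x (count_occ Ceq_dec l x).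
Proof.
  intros Hphi ND Hl x Hx. rewrite (proj1 (NoDup_count_occ' Ceq_dec l) ND x Hx).
  destruct (Hl x Hx) as [Dx Ex]. apply vanishes_1; auto.
  - rewrite holomorphic_on_iff in *. intros w Hw. apply hol_minus; auto. apply hol_const.
  - rewrite Ex. ring.
Qed.

Lemma vanishes_ext f g x k : (forall w, unit_disc w -> f w = g w) ->
  vanishes_to_order f x k -> vanishes_to_order g x k.
Proof. intros E [h [Hh Eh]]. exists h. split; auto. intros w Hw. rewrite <- E by auto. auto. Qed.

Lemma disc_lift D pi z phi : holomorphic_covering unit_disc D pi -> pi 0%C = z ->
  holomorphic_map unit_disc D phi -> phi 0%C = z ->
  exists psi, holomorphic_map unit_disc unit_disc psi /\ psi 0%C = 0%C /\
    forall w, unit_disc w -> pi (psi w) = phi w.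
Proof.
  intros Hcov Hz Hphi Hphi0. apply (lift_exists D); auto using unit_disc_0. congruence.
Qed.

Lemma image_points_phi D pi a z phi l : holomorphic_covering unit_disc D pi -> pi 0%C = z ->
  holomorphic_map unit_disc D phi -> phi 0%C = z ->
  (forall x, In x l -> unit_disc x /\ phi x = a) ->
  (forall x, In x l -> vanishes_to_order (fun w => phi w - a)%C x (count_occ Ceq_dec l x)) ->
  exists psi e, holomorphic_map unit_disc unit_disc psi /\ psi 0%C = 0%C /\
    (forall w, unit_disc w -> pi (psi w) = phi w) /\
    NoDup e /\ (forall y, In y e -> fibre pi a y) /\
    (length e <= length l)%nat /\ Rprod (map Cmod e) <= Rprod (map Cmod l) /\
    (length e = length l -> Rprod (map Cmod e) = Rprod (map (fun x => Cmod (psi x)) l)).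
Proof.
  intros Hcov Hz Hphi Hphi0 Hl Hv.
  destruct (disc_lift D pi z phi Hcov Hz Hphi Hphi0) as [psi [Hpsi [P0 E]]].
  destruct (image_points D pi a psi Hcov Hpsi P0 l) as [e [A [B [F [G H]]]]].
  - intros x Hx. destruct (Hl x Hx) as [Dx Ex]. split; auto. split. now rewrite E.
    apply vanishes_ext with (2 := Hv x Hx). intros w Hw. now rewrite E.
  - exists psi, e. repeat (split; [auto; fail|]). split. apply B. split; auto.
Qed.

(** The covering itself attains the value on the right.  Any other disc has, among [n] points
    over [a], at most [n] images in the fibre, and their product is smallest for the first
    points of the enumeration. *)
Lemma lempertN_formula D a z pi N eta : holomorphic_covering unit_disc D pi -> pi 0%C = z ->
  enumerates Infty eta (fibre pi a) -> (forall j, Cmod (eta j) <= Cmod (eta (S j))) ->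
  lempertN D N a z = eprod (fun j => Cmod (eta j)) N.
Proof.
  intros Hcov Hz Hen Hs.
  assert (Heta : forall j, fibre pi a (eta j)) by (intros j; apply Hen; exists j; split; [exact I|auto]).
  assert (Hu : forall j, 0 <= Cmod (eta j) <= 1).
  { intros j. split. apply Cmod_ge_0. left. apply (Heta j). }
  apply Glb_attained.
  - exists eta, pi. split. apply Hcov. split; auto. split. intros j _. apply Heta.
    split; auto. intros i j _ _. apply Hen; exact I.
  - intros p [lam [phi [Hphi [Hphi0 [Hlam [Inj ->]]]]]].
    assert (Low : forall n, (forall j, (j < n)%nat -> lt_enat j N) ->
      partial_prod (fun j => Cmod (eta j)) n <= partial_prod (fun j => Cmod (lam j)) n).
    { intros n Hn. set (l := map lam (seq 0 n)).
      assert (Hl : forall x, In x l -> unit_disc x /\ phi x = a).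
      { intros x Hx. apply in_map_iff in Hx. destruct Hx as [j [<- Hj]]. apply in_seq in Hj. apply Hlam, Hn. lia. }
      assert (ND : NoDup l).
      { apply NoDup_map_NoDup_ForallPairs; [|apply seq_NoDup].
        intros i j Hi Hj. apply in_seq in Hi, Hj. apply Inj; apply Hn; lia. }
      destruct (image_points_phi D pi a z phi l Hcov Hz Hphi Hphi0 Hl) as [psi [e [_ [_ [_ [NDe [He [Len [Le _]]]]]]]]].
      { apply vanish_of_NoDup; auto. apply Hphi. }
      assert (Ll : length l = n) by (unfold l; now rewrite length_map, length_seq).
      rewrite (partial_prod_map Cmod lam). fold l.
      eapply Rle_trans; [|apply Le].
      eapply Rle_trans; [|apply (sorted_prod_le (fibre pi a) eta e); auto; intros x Hx; apply Hx].
      apply partial_prod_antitone; auto. lia. }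
    destruct N as [n|].
    + apply Low. auto.
    + assert (Hl : forall j, 0 <= Cmod (lam j) <= 1).
      { intros j. split. apply Cmod_ge_0. left. apply Hlam. exact I. }
      assert (X := is_lim_seq_le _ _ _ _ (fun n => Low n (fun _ _ => I)) (eprod_Infty_limit _ Hu) (eprod_Infty_limit _ Hl)).
      exact X.
Qed.

Lemma rotation_unit t : Cmod (cos t, sin t) = 1.
Proof.
  replace (cos t, sin t) with (polar 0 t).
  - rewrite Cmod_polar. apply exp_0.
  - unfold polar. rewrite exp_0. f_equal; ring.
Qed.

(** The equality case of the Schwarz lemma. *)
Lemma rotated_of_contact pi psi phi p : holomorphic_map unit_disc unit_disc psi -> psi 0%C = 0%C ->
  (forall w, unit_disc w -> pi (psi w) = phi w) ->
  unit_disc p -> p <> 0%C -> Cmod (psi p) = Cmod p -> rotated pi phi.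
Proof.
  intros Hpsi H0 E Hp Np Ep. destruct (schwarz psi Hpsi H0) as [_ S].
  destruct (S p Hp Np Ep) as [t Ht]. exists (fun x => (((cos t, sin t) : C) * x)%C).
  split. now exists t. intros x Hx. rewrite <- Ht, E; auto.
Qed.

Lemma rotated_props D pi z phi : holomorphic_covering unit_disc D pi -> pi 0%C = z -> rotated pi phi ->
  holomorphic_map unit_disc D phi /\ phi 0%C = z /\
  exists c : C, Cmod c = 1 /\ forall y, unit_disc y -> unit_disc (c * y)%C /\ phi (c * y)%C = pi y.
Proof.
  intros [[Hpi Dpi] _] Hz [r [[t Ht] E]]. set (c := (cos t, sin t) : C) in *.
  assert (Mc : Cmod c = 1) by apply rotation_unit.
  assert (Ur : forall x, unit_disc x -> unit_disc (r x)).
  { intros x Hx. rewrite Ht by auto. unfold unit_disc. rewrite Cmod_mult, Mc, Rmult_1_l. exact Hx. }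
  split; [split|split].
  - apply holomorphic_on_iff. rewrite holomorphic_on_iff in Hpi. intros x Hx.
    destruct (open_C _ _ unit_disc_open Hx) as [d [Hd Hd']].
    apply hol_at_ext_loc with (fun x => pi (c * x)%C) d; auto.
    + intros y Hy. rewrite E, Ht; auto.
    + apply (hol_comp pi). apply hol_mult. apply hol_const. apply hol_id. apply Hpi. rewrite <- Ht; auto.
  - intros x Hx. rewrite E by auto. auto.
  - rewrite E, Ht by apply unit_disc_0. rewrite Cmult_0_r. exact Hz.
  - exists (Cconj c). split. now rewrite Cmod_conj. intros y Hy.
    assert (Uy : unit_disc (Cconj c * y)%C).
    { unfold unit_disc. rewrite Cmod_mult, Cmod_conj, Mc, Rmult_1_l. exact Hy. }
    split; auto. rewrite E, Ht by auto. rewrite Cmult_assoc, <- Cmod2_conj, Mc. f_equal.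
    replace (1 ^ 2) with 1 by ring. ring.
Qed.

(** Extremality forces [N] distinct images in the fibre, because fewer points have a strictly
    larger product; then the product of the [|psi x|] equals that of the [|x|], so
    the factors agree one by one. *)
Lemma extremal_discN_iff D a z pi N eta phi : holomorphic_covering unit_disc D pi -> pi 0%C = z ->
  enumerates Infty eta (fibre pi a) -> (forall j, Cmod (eta j) <= Cmod (eta (S j))) ->
  (1 <= N)%nat -> z <> a -> (extremal_discN D N a z phi <-> rotated pi phi).
Proof.
  intros Hcov Hz Hen Hs HN Nza.
  assert (Heta : forall j, fibre pi a (eta j)) by (intros j; apply Hen; exists j; split; [exact I|auto]).
  assert (Npos : forall x, fibre pi a x -> 0 < Cmod x < 1).
  { intros x [Dx Ex]. split; auto. apply Cmod_gt_0. intros ->. congruence. }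
  assert (Hu : forall j, 0 < Cmod (eta j) < 1) by (intros; apply Npos, Heta).
  split.
  - intros [Hphi [Hphi0 [l [Hlen [Hl [Hv Hval]]]]]].
    rewrite (lempertN_formula D a z pi (Fin N) eta) in Hval by auto. cbn [eprod] in Hval.
    destruct (image_points_phi D pi a z phi l Hcov Hz Hphi Hphi0 Hl Hv)
      as [psi [e [Hpsi [P0 [E [ND [He [Len [Le Eq]]]]]]]]].
    assert (S := sorted_prod_le (fibre pi a) eta e Hen (fun x Hx => proj1 Hx) Hs ND He).
    assert (LN : length e = N).
    { destruct (Nat.lt_ge_cases (length e) N) as [L|L]; [|lia].
      assert (X := partial_prod_strict _ _ _ Hu L). lra. }
    assert (LL : length e = length l) by lia. specialize (Eq LL). rewrite LN in S.
    destruct l as [|x l]; [simpl in Hlen; lia|].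
    destruct (schwarz psi Hpsi P0) as [Sch _].
    assert (Px : forall y, In y (x :: l) -> 0 < Cmod (psi y) <= Cmod y).
    { intros y Hy. destruct (Hl y Hy) as [Dy Ey]. split; auto. apply Npos. split. now apply Hpsi. now rewrite E. }
    assert (X := Rprod_le_eq (fun y => Cmod (psi y)) Cmod (x :: l) Px ltac:(lra) x (or_introl eq_refl)).
    destruct (Hl x (or_introl eq_refl)) as [Dx Ex].
    apply (rotated_of_contact pi psi phi x); auto.
    apply Cmod_pos_neq. destruct (Px x (or_introl eq_refl)). lra.
  - intros Hrot. destruct (rotated_props D pi z phi Hcov Hz Hrot) as [Hphi [Hphi0 [c [Mc Hc]]]].
    split; auto. split; auto. set (l := map (fun j => c * eta j)%C (seq 0 N)).
    assert (Nc : c <> 0%C) by (apply Cmod_pos_neq; lra).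
    assert (Hl : forall x, In x l -> unit_disc x /\ phi x = a).
    { intros x Hx. apply in_map_iff in Hx. destruct Hx as [j [<- _]]. destruct (Heta j) as [A B].
      destruct (Hc (eta j) A) as [A' B']. split; auto. congruence. }
    exists l. split; [|split; [|split]]; auto.
    + unfold l. rewrite length_map, length_seq. lia.
    + apply vanish_of_NoDup; auto. apply Hphi. apply NoDup_map_NoDup_ForallPairs; [|apply seq_NoDup].
      intros i j _ _ Ei. apply Cmult_cancel_l in Ei; auto. apply Hen; auto; exact I.
    + rewrite (lempertN_formula D a z pi (Fin N) eta) by auto. cbn [eprod]. unfold partial_prod, l.
      rewrite map_map. f_equal. apply map_ext. intros j. rewrite Cmod_mult, Mc. ring.
Qed.

Definition min_section (D : C -> Prop) (pi mu : C -> C) : Prop :=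
  forall b, D b -> fibre pi b (mu b) /\ forall x, fibre pi b x -> Cmod (mu b) <= Cmod x.

Lemma min_section_exists D pi : holomorphic_covering unit_disc D pi -> exists mu, min_section D pi mu.
Proof.
  intros Hcov.
  assert (Ex : forall b, exists x, D b -> fibre pi b x /\ forall y, fibre pi b y -> Cmod x <= Cmod y).
  { intros b. destruct (classic (D b)) as [Db|Db]; [|exists (RtoC 0); tauto].
    destruct (proj1 (proj2 Hcov) b Db) as [x Hx].
    destruct (fibre_min D pi b nil Hcov) as [m [M1 [_ M2]]]. exists x. split; auto.
    exists m. intros _. split; auto. }
  exists (fun b => proj1_sig (constructive_indefinite_description _ (Ex b))).
  intros b Db. destruct constructive_indefinite_description as [x Hx]. simpl. auto.
Qed.

Lemma lempert_formula D A z pi mu : holomorphic_covering unit_disc D pi -> pi 0%C = z ->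
  at_most_countable A -> (forall b, A b -> D b) -> min_section D pi mu ->
  is_prod_over A (fun b => Cmod (mu b)) (lempert D A z).
Proof.
  intros Hcov Hz HA HAD Hmu.
  assert (R : forall b, A b -> 0 <= Cmod (mu b) <= 1).
  { intros b Hb. split. apply Cmod_ge_0. left. apply (Hmu b); auto. }
  destruct HA as [N [e He]]. assert (HA : at_most_countable A) by now exists N, e.
  set (p := eprod (fun j => Cmod (mu (e j))) N).
  assert (Hp : is_inf_prod A (fun b => Cmod (mu b)) p) by now apply (eprod_is_inf A (fun b => Cmod (mu b))).
  assert (Pp : is_prod_over A (fun b => Cmod (mu b)) p) by now apply is_prod_over_iff.
  replace (lempert D A z) with p; auto. symmetry. apply Glb_attained.
  - exists mu, pi. split. apply Hcov. split; auto. split; auto. intros a Ha. apply Hmu; auto.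
  - intros p' [lam [phi [Hphi [Hphi0 [Hlam Hprod]]]]].
    destruct (disc_lift D pi z phi Hcov Hz Hphi Hphi0) as [psi [Hpsi [P0 E]]].
    destruct (schwarz psi Hpsi P0) as [Sch _].
    apply is_prod_over_iff in Hprod.
    + apply (is_inf_prod_mono A A (fun b => Cmod (mu b)) (fun b => Cmod (lam b))); auto; try tauto.
      intros b Hb. destruct (Hlam b Hb) as [D1 E1]. split. apply Cmod_ge_0.
      apply Rle_trans with (Cmod (psi (lam b))); auto. apply Hmu; auto. split. now apply Hpsi. now rewrite E.
    + intros b Hb. split. apply Cmod_ge_0. left. now apply Hlam.
Qed.

(** A factor where [f < g] keeps the infimum for [g] away from a positive infimum for [f]. *)
Lemma is_inf_prod_eq A f g p b : (forall x, A x -> 0 <= f x <= g x) -> (forall x, A x -> g x <= 1) ->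
  is_inf_prod A f p -> is_inf_prod A g p -> 0 < p -> A b -> f b = g b.
Proof.
  intros Hfg H1 [Hf _] [_ Hg] Hp Hb.
  assert (Pos : p <= f b).
  { assert (X := Hf (b :: nil) ltac:(constructor; [intros []|constructor]) ltac:(intros x [<-|[]]; auto)).
    simpl in X. lra. }
  destruct (Hfg b Hb) as [_ [L|E]]; auto. exfalso.
  destruct (Hg (p * (g b / f b - 1))) as [l [ND [Hl Hlt]]].
  { apply Rmult_lt_0_compat; auto. apply Rlt_0_minus. apply Rlt_div_r; lra. }
  replace (p + p * (g b / f b - 1)) with (p * g b / f b) in Hlt by (field; lra).
  assert (K : exists l', NoDup l' /\ (forall x, In x l' -> A x) /\ ~ In b l' /\ g b * Rprod (map g l') <= Rprod (map g l)).
  { destruct (in_dec Ceq_dec b l) as [Hin|Hout].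
    - destruct (in_split b l Hin) as [l1 [l2 ->]]. exists (l1 ++ l2).
      assert (N := NoDup_remove l1 l2 b ND). split. tauto. split.
      intros x Hx. apply Hl. apply in_app_iff in Hx. apply in_app_iff. simpl. tauto.
      split. tauto. rewrite !map_app, !Rprod_app. simpl. right. ring.
    - exists l. split; auto. split; auto. split; auto.
      assert (X : 0 <= Rprod (map g l)).
      { apply Rprod_range. intros x Hx. assert (Y := Hfg x (Hl x Hx)). assert (Z := H1 x (Hl x Hx)). lra. }
      assert (H1b := H1 b Hb). nra. }
  destruct K as [l' [ND' [Hl' [Nb Hle]]]].
  assert (X := Hf (b :: l') ltac:(now constructor) ltac:(intros x [<-|Hx]; auto)). simpl in X.
  assert (Y := Rprod_le f g l' (fun x Hx => Hfg x (Hl' x Hx))).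
  assert (Z : p * g b / f b <= g b * Rprod (map g l')).
  { assert (Pf := Rlt_le_trans _ _ _ Hp Pos). apply (proj2 (Rle_div_l (p * g b) (g b * Rprod (map g l')) (f b) Pf)).
    assert (Gb : 0 <= g b) by (apply Rlt_le, Rlt_trans with (f b); auto).
    apply Rle_trans with (g b * (f b * Rprod (map f l'))).
    - rewrite (Rmult_comm p). now apply Rmult_le_compat_l.
    - rewrite Rmult_assoc. apply Rmult_le_compat_l; auto. rewrite Rmult_comm.
      apply Rmult_le_compat_r; auto. now apply Rlt_le. }
  lra.
Qed.

(** The products over [B] of [|mu b|] and [|lam b|] both equal the Lempert function, so a
    single factor gives [|psi (lam b)| = |lam b|]. *)
Lemma extremal_disc_iff D A z pi phi : holomorphic_covering unit_disc D pi -> pi 0%C = z ->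
  (exists b, A b) -> at_most_countable A -> (forall b, A b -> D b) -> 0 < lempert D A z ->
  (extremal_disc D A z phi <-> rotated pi phi).
Proof.
  intros Hcov Hz [b0 Hb0] HA HAD Hpos.
  destruct (min_section_exists D pi Hcov) as [mu Hmu].
  assert (Form := lempert_formula D A z pi mu Hcov Hz HA HAD Hmu).
  assert (Rmu : forall b, A b -> 0 <= Cmod (mu b) <= 1).
  { intros b Hb. split. apply Cmod_ge_0. left. apply (Hmu b); auto. }
  assert (Inf := proj2 (proj1 (is_prod_over_iff A _ _ Rmu) Form)).
  split.
  - intros [Hphi [Hphi0 [B [lam [[b Hb] [HBA [Hlam Hprod]]]]]]].
    destruct (disc_lift D pi z phi Hcov Hz Hphi Hphi0) as [psi [Hpsi [P0 E]]].
    destruct (schwarz psi Hpsi P0) as [Sch _].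
    assert (Rlam : forall x, B x -> 0 <= Cmod (lam x) <= 1).
    { intros x Hx. split. apply Cmod_ge_0. left. now apply Hlam. }
    destruct (proj1 (is_prod_over_iff B _ _ Rlam) Hprod) as [HB InfB].
    assert (Ml : forall x, B x -> Cmod (mu x) <= Cmod (psi (lam x)) <= Cmod (lam x)).
    { intros x Hx. destruct (Hlam x Hx) as [D1 E1]. split; auto. apply Hmu; auto. split. now apply Hpsi. now rewrite E. }
    destruct HB as [N [e He]].
    set (q := eprod (fun j => Cmod (mu (e j))) N).
    assert (InfM : is_inf_prod B (fun x => Cmod (mu x)) q).
    { apply (eprod_is_inf B (fun x => Cmod (mu x))); auto. }
    assert (Q1 : lempert D A z <= q).
    { apply (is_inf_prod_mono A B (fun x => Cmod (mu x)) (fun x => Cmod (mu x))); auto.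
      intros x Hx. split. apply Cmod_ge_0. lra. }
    assert (Q2 : q <= lempert D A z).
    { apply (is_inf_prod_mono B B (fun x => Cmod (mu x)) (fun x => Cmod (lam x))); auto.
      intros x Hx. split. apply Cmod_ge_0. destruct (Ml x Hx). lra. }
    assert (Q : q = lempert D A z) by lra. rewrite Q in InfM.
    assert (Eb := is_inf_prod_eq B _ _ _ b (fun x Hx => conj (Cmod_ge_0 (mu x)) (Rle_trans _ _ _ (proj1 (Ml x Hx)) (proj2 (Ml x Hx))))
      (fun x Hx => proj2 (Rlam x Hx)) InfM InfB Hpos Hb).
    cbv beta in Eb. destruct (Ml b Hb) as [M1 M2]. destruct (Hlam b Hb) as [Db Elb].
    apply (rotated_of_contact pi psi phi (lam b)); auto; [|lra].
    apply Cmod_pos_neq. rewrite <- Eb.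
    destruct InfM as [InfM _].
    assert (X := InfM (b :: nil) ltac:(constructor; [intros []|constructor]) ltac:(intros x [<-|[]]; auto)).
    simpl in X. lra.
  - intros Hrot. destruct (rotated_props D pi z phi Hcov Hz Hrot) as [Hphi [Hphi0 [c [Mc Hc]]]].
    split; auto. split; auto. exists A, (fun b => c * mu b)%C.
    split. now exists b0. split; auto. split.
    + intros b Hb. destruct (Hmu b (HAD b Hb)) as [[D1 E1] _]. destruct (Hc (mu b) D1) as [A' B']. split; auto. congruence.
    + replace (fun b => Cmod (c * mu b)) with (fun b => Cmod (mu b)); auto.
      apply functional_extensionality. intros b. rewrite Cmod_mult, Mc. ring.
Qed.

Theorem proposition2 (D : C -> Prop) (a z : C) (pi : C -> C)
  (D_domain : plane_domain D)
  (D_not_sc : ~ simply_connected D)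
  (D_boundary : exists p q : C, p <> q /\ boundary D p /\ boundary D q)
  (D_a : D a) (D_z : D z)
  (pi_covering : holomorphic_covering unit_disc D pi)
  (pi_0 : pi 0%C = z) :
  (forall (N : enat) (eta : nat -> C),
     lt_enat 0 N ->
     enumerates Infty eta (fun x => unit_disc x /\ pi x = a) ->
     (forall j : nat, Cmod (eta j) <= Cmod (eta (S j))) ->
     lempertN D N a z = eprod (fun j => Cmod (eta j)) N) /\
  (forall (K : nat) (N : enat),
     (1 <= K)%nat -> lt_enat K N -> z <> a ->
     lempertN D N a z < lempertN D (Fin K) a z) /\
  (forall A : C -> Prop,
     (exists b, A b) -> at_most_countable A -> (forall b, A b -> D b) ->
     exists m : C -> R,
       (forall b, A b -> is_min (fibre_moduli pi b) (m b)) /\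
       is_prod_over A m (lempert D A z)) /\
  (forall N : nat,
     (1 <= N)%nat -> z <> a ->
     forall phi : C -> C, extremal_discN D N a z phi <-> rotated pi phi) /\
  (forall A : C -> Prop,
     (exists b, A b) -> at_most_countable A -> (forall b, A b -> D b) ->
     0 < lempert D A z ->
     forall phi : C -> C, extremal_disc D A z phi <-> rotated pi phi).
Proof.
  assert (Fib : exists eta, enumerates Infty eta (fibre pi a) /\ forall j, Cmod (eta j) <= Cmod (eta (S j))).
  { apply (fibre_enumeration D); auto. now apply (fibre_infinite D). }
  split; [|split; [|split; [|split]]].
  - intros N eta _ Hen Hs. now apply (lempertN_formula D a z pi).
  - intros K N HK HKN Nza. destruct Fib as [eta [Hen Hs]].
    rewrite !(lempertN_formula D a z pi _ eta) by auto.
    assert (Hu : forall j, 0 < Cmod (eta j) < 1).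
    { intros j. destruct (proj2 (proj2 Hen (eta j))) as [Dj Ej]. exists j; split; [exact I|auto].
      split; auto. apply Cmod_gt_0. intros Z. rewrite Z in Ej. congruence. }
    assert (Hu' : forall j, 0 <= Cmod (eta j) <= 1) by (intros j; assert (X := Hu j); lra).
    destruct N as [n|]; cbn [eprod].
    + now apply partial_prod_strict.
    + apply Rle_lt_trans with (partial_prod (fun j => Cmod (eta j)) (S K)).
      apply (eprod_Infty_le (fun j => Cmod (eta j))); auto. apply partial_prod_strict; auto.
  - intros A _ HA HAD. destruct (min_section_exists D pi pi_covering) as [mu Hmu].
    exists (fun b => Cmod (mu b)). split.
    + intros b Hb. destruct (Hmu b (HAD b Hb)) as [[D1 E1] M]. split.
      exists (mu b). auto. intros x [y [Dy [Ey ->]]]. apply M. split; auto.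
    + now apply (lempert_formula D A z pi mu).
  - intros N HN Nza phi. destruct Fib as [eta [Hen Hs]]. now apply (extremal_discN_iff D a z pi N eta).
  - intros A Hne HA HAD Hpos phi. now apply (extremal_disc_iff D A z pi).
Qed.
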